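(* Let $\mathfrak g$ be a Lie algebra endowed with a Banach–Lie norm $\|\cdot\|_{\mathfrak g}$, and let $\alpha$ be a $\mathfrak g$-valued continuous measure of finite variation on an interval $I$, with total variation $\int\|\alpha\|_{\mathfrak g}$. Let $\eta^{\bowtie}_{\mathrm R,n}(\alpha)$ and $\eta^{\leftrightarrow}_{\mathrm R,n}(\alpha)$ ($n\geq1$) be the terms of the inward and outward expanding symmetric Wilcox expansions of $\alpha$, respectively. Then, coefficientwise in the powers of the formal variable $T$ (i.e. for each $n\geq1$ the coefficient of $T^n$ on the left is at most the coefficient of $T^n$ on the right, the right side being expanded as a power series at $T=0$), $$\sum_{n=1}^\infty T^n\cdot\|\eta^{\bowtie}_{\mathrm R,n}(\alpha)\|_{\mathfrak g}\ \leq\ 2-2\sqrt{1-T\cdot\left(\int\|\alpha\|_{\mathfrak g}\right)}.$$ In particular, the inward expanding symmetric Wilcox expansion is convergent, in the sense that $\sum_{n=1}^\infty\|\eta^{\bowtie}_{\mathrm R,n}(\alpha)\|_{\mathfrak g}<+\infty$, if $\int\|\alpha\|_{\mathfrak g}<1$. The same statements (the same coefficientwise bound and the same convergence criterion) hold for the outward expanding symmetric Wilcox expansion, i.e. with $\eta^{\leftrightarrow}_{\mathrm R,n}(\alpha)$ in place of $\eta^{\bowtie}_{\mathrm R,n}(\alpha)$.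
   Context: A Banach–Lie norm on a (real or complex) Lie algebra $\mathfrak g$ is a complete norm with $\|[X,Y]\|_{\mathfrak g}\leq\|X\|_{\mathfrak g}\|Y\|_{\mathfrak g}$. Measures: a continuous measure of finite variation on a (possibly infinite) interval $I$ with values in a Banach space is a countably additive vector-valued Borel measure $\alpha$ on $I$ with $\alpha(\{t\})=0$ for all $t\in I$ and finite total variation $\int\|\alpha\|=\sup\sum_i\|\alpha(J_i)\|$, the supremum being over finite partitions of $I$ into subintervals. For example, $\alpha$ may be given by a Bochner integrable density. For a continuous $n$-linear map $P$, the integral $\int_{t_1\leq\ldots\leq t_n\in I}P(\alpha(t_1),\ldots,\alpha(t_n))$ is the integral of $P$ against the product measure over the ordered simplex, i.e. the limit of $\sum_{i_1<\ldots<i_n}P(\alpha(J_{i_1}),\ldots,\alpha(J_{i_n}))$ over ordered finite partitions $J_1<\ldots<J_N$ of $I$ into intervals, as the maximal variation of $\alpha$ on the $J_i$ tends to $0$. Time-ordered exponential: for a Banach algebra valued continuous measure $\phi$ of finite variation and a formal commuting variable $T$, $$\exp_{\mathrm R}(T\cdot\phi)=1+\sum_{n=1}^\infty T^n\int_{t_1\leq\ldots\leq t_n\in I}\phi(t_1)\cdots\phi(t_n).$$ Symmetric Wilcox expansions: there are unique universal commutator (Lie) polynomials $\eta^{\bowtie}_n(X_1,\ldots,X_n)$ and $\eta^{\leftrightarrow}_n(X_1,\ldots,X_n)$, linear in each variable, such that for every such $\phi$, as formal power series in $T$, the following hold. Inward expanding: $$\exp_{\mathrm R}(T\cdot\phi)=\exp(T\eta^{\bowtie}_{\mathrm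 R,1}(\phi)/2)\exp(T^2\eta^{\bowtie}_{\mathrm R,2}(\phi)/2)\exp(T^3\eta^{\bowtie}_{\mathrm R,3}(\phi)/2)\ldots\ \cdot\ \ldots\exp(T^3\eta^{\bowtie}_{\mathrm R,3}(\phi)/2)\exp(T^2\eta^{\bowtie}_{\mathrm R,2}(\phi)/2)\exp(T\eta^{\bowtie}_{\mathrm R,1}(\phi)/2).$$ Outward expanding: $$\exp_{\mathrm R}(T\cdot\phi)=\ldots\exp(T^3\eta^{\leftrightarrow}_{\mathrm R,3}(\phi)/2)\exp(T^2\eta^{\leftrightarrow}_{\mathrm R,2}(\phi)/2)\exp(T\eta^{\leftrightarrow}_{\mathrm R,1}(\phi)/2)\ \cdot\ \exp(T\eta^{\leftrightarrow}_{\mathrm R,1}(\phi)/2)\exp(T^2\eta^{\leftrightarrow}_{\mathrm R,2}(\phi)/2)\exp(T^3\eta^{\leftrightarrow}_{\mathrm R,3}(\phi)/2)\ldots$$ Here $$\eta^{\bowtie}_{\mathrm R,n}(\phi)=\int_{t_1\leq\ldots\leq t_n\in I}\eta^{\bowtie}_n(\phi(t_1),\ldots,\phi(t_n)),\qquad \eta^{\leftrightarrow}_{\mathrm R,n}(\phi)=\int_{t_1\leq\ldots\leq t_n\in I}\eta^{\leftrightarrow}_n(\phi(t_1),\ldots,\phi(t_n)).$$ Equivalently, $\eta^{\bowtie}_n(X_1,\ldots,X_n)$ is the part linear in each of $X_1,\ldots,X_n$ of the Lie polynomial $L_n$ in the unique inward factorization $$\exp(TX_1)\cdots\exp(TX_n)=\exp(TL_1/2)\exp(T^2L_2/2)\exp(T^3L_3/2)\ldots\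 \cdot\ \ldots\exp(T^3L_3/2)\exp(T^2L_2/2)\exp(TL_1/2)$$ in noncommuting formal variables $X_1,\ldots,X_n$, where $L_m$ is homogeneous of degree $m$ and free of $T$; and $\eta^{\leftrightarrow}_n(X_1,\ldots,X_n)$ is the part linear in each of $X_1,\ldots,X_n$ of the Lie polynomial $L_n$ in the unique outward factorization $$\exp(TX_1)\cdots\exp(TX_n)=\ldots\exp(T^3L_3/2)\exp(T^2L_2/2)\exp(TL_1/2)\ \cdot\ \exp(TL_1/2)\exp(T^2L_2/2)\exp(T^3L_3/2)\ldots$$ in noncommuting formal variables $X_1,\ldots,X_n$, where again $L_m$ is homogeneous of degree $m$ and free of $T$ (the $L_m$ of the two factorizations being different in general). E.g. in both cases the first two polynomials are $X_1$ and $\frac12[X_1,X_2]$. Since these are Lie polynomials, $\eta^{\bowtie}_{\mathrm R,n}(\alpha)$ and $\eta^{\leftrightarrow}_{\mathrm R,n}(\alpha)$ are defined by the same integral formulas for $\mathfrak g$-valued $\alpha$. *)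

(* Defs.v *)
From HB Require Import structures.
From mathcomp Require Import all_boot all_order all_algebra.
From mathcomp Require Import complex monalg.
From mathcomp Require Import all_classical all_reals all_analysis.

Set Implicit Arguments.
Unset Strict Implicit.
Unset Printing Implicit Defensive.

Import Order.TTheory GRing.Theory Num.Theory.
Import numFieldNormedType.Exports.

Local Open Scope classical_set_scope.
Local Open Scope ring_scope.

Inductive scalar_kind := RealScalars | ComplexScalars.

Definition scalars (R : realType) (k : scalar_kind) : numFieldType :=
  match k with RealScalars => R | ComplexScalars => R[i] end.

(* The norm of a [normedModType K] takes its values in [K]; over [R[i]] these
   are real, so that taking the real part loses nothing. *)
Definition scalar_re (R : realType) (k : scalar_kind) : scalars R k -> R :=
  match k with
  | RealScalars => fun x => x
  | ComplexScalars => fun z => complex.Re z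
  end.

Definition rnorm (R : realType) (k : scalar_kind)
    (V : normedModType (scalars R k)) (x : V) : R :=
  scalar_re `|x|.

Definition is_lie_bracket (K : numFieldType) (V : lmodType K)
    (br : {bilinear V -> V -> V}) : Prop :=
  (forall x, br x x = 0) /\
  (forall x y z, br x (br y z) + br y (br z x) + br z (br x y) = 0).

(* Expressions for commutator polynomials; two expressions denote the same
   commutator polynomial when they have the same value under [lie_assoc]. *)
Inductive lie_term (n : nat) :=
  | LieVar of 'I_n
  | LieZero
  | LieAdd of lie_term n & lie_term n
  | LieScale of rat & lie_term n
  | LieBracket of lie_term n & lie_term n.
Arguments LieZero {n}.

HB.instance Definition _ (n : nat) := gen_eqMixin (lie_term n).
HB.instance Definition _ (n : nat) := gen_choiceMixin (lie_term n).

Fixpoint lie_eval (K : numFieldType) (V : lmodType K) (br : V -> V -> V)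
    (n : nat) (x : 'I_n -> V) (p : lie_term n) : V :=
  match p with
  | LieVar i => x i
  | LieZero => 0
  | LieAdd p q => lie_eval br x p + lie_eval br x q
  | LieScale c p => (ratr c : K) *: lie_eval br x p
  | LieBracket p q => br (lie_eval br x p) (lie_eval br x q)
  end.

Definition ncpoly (n : nat) := {malg rat[{fmonom 'I_n}]}.

Definition ncvar (n : nat) (i : 'I_n) : ncpoly n := << fmu i >>.

Definition lie_assoc (n : nat) (p : lie_term n) : ncpoly n :=
  lie_eval (fun a b : ncpoly n => a * b - b * a) (@ncvar n) p.

Definition nc_homogeneous (n d : nat) (P : ncpoly n) : Prop :=
  forall w : {fmonom 'I_n}, P@_w != 0 -> size w = d.

Definition fps (n : nat) := nat -> ncpoly n.

Definition fps_one (n : nat) : fps n := fun d => if d == 0%N then 1 else 0.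

Definition fps_mul (n : nat) (a b : fps n) : fps n :=
  fun d => \sum_(i < d.+1) a i * b (d - i)%N.

(* exp(T^m x), for m > 0 *)
Definition fps_exp (n m : nat) (x : ncpoly n) : fps n :=
  fun d => if (m %| d)%N then ((d %/ m)`!%:R : rat)^-1 *: x ^+ (d %/ m) else 0.

(* exp(T X_1) ... exp(T X_n) *)
Definition exp_prod (n : nat) : fps n :=
  \big[@fps_mul n/@fps_one n]_(i < n) fps_exp 1 (ncvar i).

(* exp(T L_1 / 2) ... exp(T^M L_M / 2) *)
Definition increasing_half (n : nat) (L : nat -> ncpoly n) (M : nat) : fps n :=
  \big[@fps_mul n/@fps_one n]_(m <- iota 1 M) fps_exp m (2^-1 *: L m).

(* exp(T^M L_M / 2) ... exp(T L_1 / 2) *)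
Definition decreasing_half (n : nat) (L : nat -> ncpoly n) (M : nat) : fps n :=
  \big[@fps_mul n/@fps_one n]_(m <- rev (iota 1 M)) fps_exp m (2^-1 *: L m).

Inductive wilcox_kind := Inward | Outward.

Definition wilcox_partial (kd : wilcox_kind) (n : nat) (L : nat -> ncpoly n)
    (M : nat) : fps n :=
  match kd with
  | Inward => fps_mul (increasing_half L M) (decreasing_half L M)
  | Outward => fps_mul (decreasing_half L M) (increasing_half L M)
  end.

(* The infinite product is the T-adic limit of the partial products. *)
Definition wilcox_factorization (kd : wilcox_kind) (n : nat)
    (L : nat -> ncpoly n) : Prop :=
  forall d : nat, \forall M \near \oo, wilcox_partial kd L M d = exp_prod n d.

(* [p] is the part of [L_n] linear in each of X_1, ..., X_n, for [L] the
   sequence of Lie polynomials of the factorization; [L 0] plays no role. *)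
Definition is_wilcox_poly (kd : wilcox_kind) (n : nat) (p : lie_term n) : Prop :=
  exists L : nat -> lie_term n,
    [/\ forall m, (0 < m)%N -> nc_homogeneous m (lie_assoc (L m)),
        wilcox_factorization kd (fun m => lie_assoc (L m)) &
        forall w : {fmonom 'I_n},
          (lie_assoc p)@_w =
          if perm_eq w (enum 'I_n) then (lie_assoc (L n))@_w else 0].

Definition wilcox_poly (kd : wilcox_kind) (n : nat) : lie_term n :=
  xget LieZero [set p | is_wilcox_poly kd p].

(* Finite partitions into subintervals, listed in increasing order; empty
   pieces are allowed, which is harmless as measures vanish on them. *)
Definition interval_partition (R : realType) (I : set R) (s : seq (set R)) :
    Prop :=
  [/\ forall i, (i < size s)%N -> is_interval (nth set0 s i),
      \bigcup_(i in `I_(size s)) nth set0 s i = I &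
      forall i j, (i < j < size s)%N ->
        forall x y, nth set0 s i x -> nth set0 s j y -> x < y].

Section Measures.
Context (R : realType) (k : scalar_kind).
Context (V : completeNormedModType (scalars R k)).
Implicit Types (alpha : set R -> V) (I : set R).

Definition measure_variation alpha I : \bar R :=
  ereal_sup [set (\sum_(J <- s) rnorm (alpha J))%:E | s in interval_partition I].

(* Only the values of [alpha] on Borel subsets of [I] matter. *)
Definition is_vector_measure I alpha : Prop :=
  forall F : nat -> set R,
    (forall i, measurable (F i)) -> (forall i, F i `<=` I) ->
    trivIset setT F ->
    \sum_(0 <= i < N) alpha (F i) @[N --> \oo] --> alpha (\bigcup_i F i).

Definition is_continuous_measure_fv I alpha : Prop :=
  [/\ is_vector_measure I alpha,
      forall t, I t -> alpha [set t] = 0 &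
      (measure_variation alpha I < +oo)%E].

Definition mesh_filter I alpha : set_system (seq (set R)) :=
  filter_from [set e : R | 0 < e]
    (fun e => [set s | interval_partition I s /\
       forall i, (i < size s)%N ->
         (measure_variation alpha (nth set0 s i) < e%:E)%E]).

Definition ordered_sum (n : nat) (P : ('I_n -> V) -> V) alpha
    (s : seq (set R)) : V :=
  \sum_(f : {ffun 'I_n -> 'I_(size s)} |
        [forall i : 'I_n, forall j : 'I_n, (i < j)%N ==> (f i < f j)%N])
    P (fun i => alpha (nth set0 s (f i))).

Definition ordered_integral (n : nat) (P : ('I_n -> V) -> V) I alpha : V :=
  lim (ordered_sum P alpha s @[s --> mesh_filter I alpha]).

Definition wilcox_term (kd : wilcox_kind) (br : V -> V -> V) I alpha (n : nat) :
    V :=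
  ordered_integral (fun x => lie_eval br x (wilcox_poly kd n)) I alpha.

End Measures.

Definition taylor_coef (R : realType) (f : R -> R) (n : nat) : R :=
  derive1n n f 0 / n`!%:R.

(* Main.v *)
Require Import Defs.
From HB Require Import structures.
From mathcomp Require Import all_boot all_order all_algebra all_fingroup.
From mathcomp Require Import finmap monalg ring lra.

(** Write f(t) = 2 - 2 sqrt(1 - t) = f_1 t + f_2 t^2 + ..., and let w be the
    total variation.  The theorem follows from two estimates: at every tuple x,
    the n-th Wilcox polynomial has norm at most n! f_n |x_1| ... |x_n|
    ([wilcox_poly_bound]), and the ordered integral of a multiadditive map
    bounded by C |x_1| ... |x_n| is at most C w^n / n!
    ([ordered_integral_bound]).  Together they bound the n-th term by f_n w^n,
    which is the Taylor coefficient of f(T w); and f_n <= 1, so that the terms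
    are summable for w < 1.

    The algebraic estimate uses only the terms of the product
    exp(T X_1) ... exp(T X_n) in which no variable occurs twice.  These terms
    form a ring in which elements without constant term are nilpotent, the set
    power series below.  Let the variables be adjoined one at a time.  Adjoining X_k adds to each exponent L_d / 2 the
    terms that contain X_k; they contain it exactly once, so this is a
    perturbation whose effect is exactly of first order; and it multiplies the
    whole product on the right by 1 + X_k.  Let R be the right half of the
    product.  It is multiplied on the left by 1 + D, where D is an explicit sum
    of iterated commutators of old exponents with one perturbation.  The left
    half is the inverse of the right half for the opposite exponents.  Hence
    adjoining X_k amounts to D(s) - D(-s) = R X_k R^(-1), where s stands for
    the exponents and their perturbations.  On the left the terms with an odd
    number of commutators cancel ([symmetric_log_deriv]), whereas the terms
    without commutators add up to the new parts of L_1, L_2, ...; all other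
    terms involve new parts with fewer variables.  This is a recursion for the
    multilinear parts of the L_d.

    To solve the recursion by majorants, put h = f / 2 and assume that f
    bounds the L_d that are already known, in the sense of exponential
    generating functions of the number of variables.  Then the terms of
    R X_k R^(-1) are bounded by e^h, and the terms of D with m commutators by
    (h^m / m!) f' / 2, for the inward and the outward order alike.  Hence the
    bound propagates if e^h + (cosh h - 1) f' <= f' coefficientwise
    ([majorant_recursion]).  As f' = 1 / (1 - h), this reduces to
    1/j! + 1/2! + 1/4! + ... <= 1, the even factorials running up to j!.

    The recursion bounds some Lie expression for each multilinear part of L_d.
    By the Dynkin-Specht-Wever identity, Lie expressions with equal associative
    expansions have equal values in every Lie algebra of characteristic zero
    ([lie_eval_assoc]), so the bound holds for every expression of the Wilcox
    polynomial.

    In the analytic estimate, n! times the sum of a_(i_1) ... a_(i_n) over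
    i_1 < ... < i_n is at most (a_1 + ... + a_N)^n ([increasing_sum_le]), which
    bounds all ordered sums.  The bound passes to the integral because the
    ordered sums converge ([ordered_sum_close]) along a filter that is proper:
    a continuous measure of finite variation has partitions of arbitrarily
    small mesh ([fine_partition_exists]). *)

Set Implicit Arguments.
Unset Strict Implicit.
Unset Printing Implicit Defensive.

Import Order.TTheory GRing.Theory Num.Theory.

Local Open Scope ring_scope.

(** * The coefficients of the majorant *)

(** The coefficients of (1 - t)^(-1/2). *)
Definition invsqrt_coef (m : nat) : rat := \prod_(i < m) ((i.*2.+1)%:R / (i.*2.+2)%:R).

(** The coefficients of 2 - 2 (1 - t)^(1/2). *)
Definition bound_coef (d : nat) : rat := if d is m.+1 then invsqrt_coef m / m.+1%:R else 0.

Lemma invsqrt_coefS m :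
  invsqrt_coef m.+1 = invsqrt_coef m * ((m.*2.+1)%:R / (m.*2.+2)%:R).
Proof. by rewrite /invsqrt_coef big_ord_recr. Qed.

Lemma invsqrt_coef_ge0 m : 0 <= invsqrt_coef m.
Proof. by apply: prodr_ge0 => i _; rewrite divr_ge0 // ler0n. Qed.

Lemma invsqrt_coef_le1 m : invsqrt_coef m <= 1.
Proof.
by apply: prodr_ile1 => i _; rewrite divr_ge0 ?ler0n //= ler_pdivrMr ?ltr0n // mul1r ler_nat.
Qed.

Lemma bound_coef_ge0 d : 0 <= bound_coef d.
Proof. by case: d => //= m; rewrite divr_ge0 ?invsqrt_coef_ge0 ?ler0n. Qed.

Lemma bound_coef_le1 d : bound_coef d <= 1.
Proof.
case: d => //= m; rewrite ler_pdivrMr ?ltr0n // mul1r.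
by apply: le_trans (invsqrt_coef_le1 m) _; rewrite ler1n.
Qed.

Lemma fact_bound_coef m : m.+1`!%:R * bound_coef m.+1 = m`!%:R * invsqrt_coef m.
Proof.
rewrite factS natrM /= [_ * m`!%:R]mulrC -mulrA; congr (_ * _).
by rewrite mulrC divfK // pnatr_eq0.
Qed.

(** The square of (1 - t)^(-1/2) is the geometric series: if c is the generating
    function of the coefficients, then 2 (1 - t) c' = c, and therefore
    (1 - t) (c^2)' = c^2. *)
Lemma invsqrt_conv m : \sum_(i < m.+1) invsqrt_coef i * invsqrt_coef (m - i) = 1.
Proof.
elim: m => [|m IH]; first by rewrite big_ord1 /invsqrt_coef big_ord0 mulr1.
set c := invsqrt_coef in IH *.
(* The differential equation of c, coefficient by coefficient. *)
have step i : c i.+1 *+ i.+1.*2 = c i *+ i.*2.+1.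
  rewrite /c invsqrt_coefS -[LHS]mulr_natr -[RHS]mulr_natr doubleS.
  by rewrite -!mulrA mulVf ?mulr1 // pnatr_eq0.
have sym (F : nat -> nat -> rat) n :
    \sum_(i < n.+1) F i (n - i)%N = \sum_(i < n.+1) F (n - i)%N i.
  rewrite (reindex_inj rev_ord_inj) /=; apply: eq_bigr => i _.
  by rewrite subSS subKn // -ltnS.
have key : (\sum_(i < m.+2) c i * c (m.+1 - i)%N) *+ m.+1 = 1 *+ m.+1.
  rewrite -IH -!sumrMnl.
  transitivity (\sum_(i < m.+2) ((c i *+ i) * c (m.+1 - i)%N *+ 2)).
    transitivity (\sum_(i < m.+2) ((c i *+ i) * c (m.+1 - i)%N
                                   + c i * (c (m.+1 - i)%N *+ (m.+1 - i)%N))).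
      apply: eq_bigr => i _; rewrite mulrnAl mulrnAr -mulrnDr subnKC //.
      by rewrite -ltnS.
    rewrite big_split /= [X in _ + X](sym (fun i j => c i * (c j *+ j))) -big_split.
    by apply: eq_bigr => i _; rewrite /= [c (m.+1 - i)%N * _]mulrC mulr2n.
  rewrite big_ord_recl mulr0n mul0r mul0rn add0r /=.
  transitivity (\sum_(i < m.+1) (c i * c (m - i)%N) *+ i.*2.+1).
    apply: eq_bigr => i _; rewrite /bump /= add1n subSS -mulrnAl -mulrnA muln2 step.
    by rewrite mulrnAl.
  have e : \sum_(i < m.+1) c i * c (m - i)%N *+ i = \sum_(i < m.+1) c i * c (m - i)%N *+ (m - i).
    rewrite (sym (fun i j => c i * c j *+ i)); apply: eq_bigr => i _.
    by rewrite mulrC.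
  transitivity (\sum_(i < m.+1) (c i * c (m - i)%N *+ i + c i * c (m - i)%N *+ i
                               + c i * c (m - i)%N)).
    by apply: eq_bigr => i _; rewrite -mulrnDr -mulrSr addnn.
  rewrite !big_split /= {1}e -!big_split; apply: eq_bigr => i _ /=.
  by rewrite -mulrnDr -mulrSr subnK // -ltnS.
by apply/eqP; rewrite -(eqr_pMn2r (n := m.+1)) // key.
Qed.

(** The coefficient form of (1 - f / 2) f' = 1 for f = 2 - 2 (1 - t)^(1/2). The
    coefficients of f / 2 are consecutive differences of those of f', so that
    the sum reduces to two sums of [invsqrt_conv]. *)
Lemma bound_coef_conv m :
  \sum_(i < m) 2^-1 * bound_coef i.+1 * invsqrt_coef (m - i.+1)
  = invsqrt_coef m - (m == 0%N)%:R.
Proof.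
case: m => [|m]; first by rewrite big_ord0 /invsqrt_coef big_ord0 subrr.
rewrite subr0; set c := invsqrt_coef.
have P i : 2^-1 * bound_coef i.+1 = c i - c i.+1.
  rewrite /c invsqrt_coefS /=; set u := invsqrt_coef i.
  have x0 : (0 : rat) <= i%:R by rewrite ler0n.
  have -> : (i.*2.+1)%:R = 2 * i%:R + 1 :> rat by rewrite -addnn -natr1 natrD; ring.
  have -> : (i.*2.+2)%:R = 2 * i%:R + 2 :> rat by rewrite -addnn -!natr1 natrD; ring.
  rewrite -natr1; field.
  by apply/andP; split; lra.
under eq_bigr => i _ do rewrite P mulrBl subSS.
rewrite sumrB invsqrt_conv.
have := invsqrt_conv m.+1; rewrite big_ord_recl subn0 {1}/invsqrt_coef big_ord0 mul1r.
rewrite -/c => h; rewrite -{1}h.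
rewrite [X in _ + X - _](_ : _ = \sum_(i < m.+1) c i.+1 * c (m - i)%N); last exact: eq_bigr.
exact: addrK.
Qed.

Section PolynomialMajorants.
Implicit Types p q : {poly rat}.

Definition low_order n p := forall m, (m < n)%N -> p`_m = 0.

Lemma low_orderD n p q : low_order n p -> low_order n q -> low_order n (p + q).
Proof. by move=> hp hq m hm; rewrite coefD hp // hq // addr0. Qed.

Lemma low_orderM n n' p q : low_order n p -> low_order n' q -> low_order (n + n') (p * q).
Proof.
move=> hp hq m hm; rewrite coefM big1 // => i _.
have [hi|hi] := ltnP i n; first by rewrite hp // mul0r.
have im : (i <= m)%N by rewrite -ltnS.
by rewrite hq ?mulr0 // ltn_subLR // (leq_trans hm) // leq_add2r.
Qed.

Lemma low_order_mulr n p q : low_order n p -> low_order n (p * q).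
Proof. by move=> hp; rewrite -[n]addn0; apply: low_orderM. Qed.

Lemma low_order_exp p k : low_order 1 p -> low_order k (p ^+ k).
Proof.
by move=> hp; elim: k => [|k IH] //; rewrite exprS -add1n; apply: low_orderM.
Qed.

(** With [bound_deriv], the truncations of h = f / 2 and of f' = 1 / (1 - h),
    where f = 2 - 2 (1 - t)^(1/2). *)
Definition half_bound n : {poly rat} :=
  \sum_(d < n) (2^-1 * bound_coef d.+1) *: 'X^(d.+1).

Definition bound_deriv n : {poly rat} := \poly_(d < n) invsqrt_coef d.

Lemma half_bound_coef n m :
  (half_bound n)`_m = if (0 < m <= n)%N then 2^-1 * bound_coef m else 0.
Proof.
rewrite /half_bound coef_sum; case: m => [|m] /=.
  by rewrite big1 // => d _; rewrite coefZ coefXn /= mulr0.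
case: ltnP => hm.
  rewrite (bigD1 (Ordinal hm)) //= coefZ coefXn eqxx mulr1 big1 ?addr0 // => d.
  by rewrite coefZ coefXn eqSS -val_eqE /= eq_sym => /negPf ->; rewrite mulr0.
rewrite big1 // => d _; rewrite coefZ coefXn eqSS.
by rewrite gtn_eqF ?mulr0 // (leq_trans _ hm).
Qed.

Lemma half_bound_low_order n : low_order 1 (half_bound n).
Proof. by case=> // _; rewrite half_bound_coef. Qed.

Definition nonneg p := forall m, 0 <= p`_m.

Lemma nonnegD p q : nonneg p -> nonneg q -> nonneg (p + q).
Proof. by move=> hp hq m; rewrite coefD addr_ge0. Qed.

Lemma nonnegM p q : nonneg p -> nonneg q -> nonneg (p * q).
Proof. by move=> hp hq m; rewrite coefM sumr_ge0 // => i _; rewrite mulr_ge0. Qed.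

Lemma nonnegX p k : nonneg p -> nonneg (p ^+ k).
Proof.
move=> hp; elim: k => [|k IH]; last by rewrite exprS; apply: nonnegM.
by move=> m; rewrite expr0 coef1 ler0n.
Qed.

Lemma half_bound_ge0 n : nonneg (half_bound n).
Proof.
move=> m; rewrite half_bound_coef; case: ifP => // _.
by rewrite mulr_ge0 ?bound_coef_ge0 // invr_ge0.
Qed.

(** Modulo 'X^n the polynomial (1 - h) f' is 1, and h has no constant term, so
    f' is the geometric series of h. *)
Lemma bound_deriv_geom n N m : (m < n)%N -> (n <= N)%N ->
  (bound_deriv n)`_m = (\sum_(k < N) half_bound n ^+ k)`_m.
Proof.
move=> mn nN; set h := half_bound n; set G := \sum_(k < N) h ^+ k.
suff /(_ m mn) : low_order n (bound_deriv n - G) by rewrite coefB => /eqP; rewrite subr_eq0 => /eqP.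
have hG : 1 - (1 - h) * G = h ^+ N.
  have -> : h ^+ N = (h - 1) * G + 1 by rewrite -subrX1 subrK.
  ring.
have hE : low_order n ((1 - h) * bound_deriv n - 1).
  move=> j jn; rewrite mulrBl mul1r !coefB coef1 coef_poly jn coefM big_ord_recl.
  rewrite half_bound_coef /= mul0r add0r.
  rewrite (eq_bigr (fun i : 'I_j => 2^-1 * bound_coef i.+1 * invsqrt_coef (j - i.+1))).
    by rewrite bound_coef_conv subKr subrr.
  move=> i _; rewrite half_bound_coef /= /bump /= add1n coef_poly.
  rewrite (leq_ltn_trans (leq_subr _ _) jn).
  by rewrite (leq_trans (ltn_ord i) (ltnW jn)).
have -> : bound_deriv n - G
        = h ^+ N * bound_deriv n + ((1 - h) * bound_deriv n - 1) * G.
  by rewrite -hG; ring.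
apply: low_orderD; last exact: low_order_mulr.
apply: low_order_mulr => j jn; by rewrite (low_order_exp (half_bound_low_order n)) // (leq_trans jn).
Qed.

(** By induction on j: the sum over even i grows by at most 1 / (j + 1)!, while
    the first term drops from 1 / j! to 1 / (j + 1)!, and 2 / (j + 1)! <= 1 / j!
    for j > 0. *)
Lemma fact_sum_le1 j :
  (j`!%:R : rat)^-1 + \sum_(i < j.+1 | (0 < i)%N && ~~ odd i) (i`!%:R)^-1 <= 1.
Proof.
case: j => [|j]; first by rewrite big1 ?addr0 //; case => [[]].
elim: j => [|j IH].
  by rewrite big1 ?addr0 // => -[[|[]]].
rewrite big_mkcond big_ord_recr /= -big_mkcond /=; apply: le_trans IH.
rewrite [X in _ <= X]addrC [X in X <= _]addrC -addrA lerD2l.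
apply: (@le_trans _ _ (2 * (j.+2`!%:R)^-1)).
  by case: ifP => _; rewrite mulr_natl mulr2n ?lerD2r ?ler_wpDl ?invr_ge0 ?ler0n // ?lexx.
rewrite [j.+2`!]factS natrM invfM mulrA ger_pMl ?invr_gt0 ?ltr0n ?fact_gt0 //.
by rewrite ler_pdivrMr ?ltr0n // mul1r ler_nat.
Qed.

(** The inequality that closes the recursion: f' dominates
    e^h + (cosh h - 1) f'. With f' expanded as the geometric series of h, it can
    be checked for each power h^j separately, where it is [fact_sum_le1]. *)
Lemma majorant_recursion n N m : (m < n)%N -> (n <= N)%N ->
  (\sum_(k < N) (k`!%:R)^-1 *: half_bound n ^+ k
   + \sum_(k < N | (0 < k)%N && ~~ odd k) (k`!%:R)^-1 *: (half_bound n ^+ k * bound_deriv n))`_m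
  <= invsqrt_coef m.
Proof.
move=> mn nN; set h := half_bound n.
have -> : invsqrt_coef m = (bound_deriv n)`_m by rewrite coef_poly mn.
have Gm j : (j <= m)%N -> (bound_deriv n)`_j = (\sum_(k < N) h ^+ k)`_j.
  by move=> jm; apply: bound_deriv_geom => //; apply: leq_ltn_trans mn.
rewrite Gm // coefD !coef_sum.
have hB k : (h ^+ k * bound_deriv n)`_m = \sum_(j < N | (k <= j)%N) (h ^+ j)`_m.
  have -> : (h ^+ k * bound_deriv n)`_m = (h ^+ k * \sum_(j < N) h ^+ j)`_m.
    rewrite !coefM; apply: eq_bigr => i _; rewrite Gm // leq_subr //.
  rewrite mulr_sumr coef_sum.
  have hz j : (m < j)%N -> (h ^+ j)`_m = 0.
    by move=> mj; rewrite (low_order_exp (half_bound_low_order n)).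
  have mN : (m < N)%N by apply: leq_trans nN.
  rewrite -(big_mkord xpredT (fun j => (h ^+ k * h ^+ j)`_m)).
  rewrite -(big_mkord (fun j => (k <= j)%N) (fun j => (h ^+ j)`_m)).
  have [kN|Nk] := leqP k N; last first.
    rewrite big1_seq ?big1_seq //.
      move=> j /andP[kj]; rewrite mem_index_iota => /andP[_ jN].
      by have := ltn_trans jN (leq_trans Nk kj); rewrite ltnn.
    move=> j _; rewrite -exprD hz // ltn_addr //.
    exact: ltn_trans Nk.
  rewrite [RHS](big_cat_nat (n := k)) //=.
  rewrite [X in _ = X + _]big1_seq ?add0r; last first.
    by move=> j /andP[kj]; rewrite mem_index_iota ltnNge kj andbF.
  rewrite -{2}[k]add0n big_addn.
  rewrite (big_cat_nat (n := N - k) (p := N)) ?leq_subr //=.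
  rewrite [X in _ + X]big1_seq ?addr0; last first.
    move=> j /andP[_]; rewrite mem_index_iota => /andP[jN _].
    by rewrite -exprD hz // (leq_trans mN) // -leq_subLR.
  rewrite [RHS]big_mkcond; apply: eq_bigr => j _.
  by rewrite leq_addl -exprD addnC.
under [X in _ + X <= _]eq_bigr => k _ do rewrite coefZ hB mulr_sumr.
rewrite (exchange_big_dep xpredT) //= -big_split /=; apply: ler_sum => j _.
rewrite coefZ -mulr_suml -mulrDl ler_piMl //.
  by apply: nonnegX; apply: half_bound_ge0.
apply: le_trans (fact_sum_le1 j); rewrite lerD2l.
by rewrite (big_ord_widen_cond N (fun i => (0 < i)%N && ~~ odd i) (fun i => (i`!%:R)^-1)) //.
Qed.

End PolynomialMajorants.

(** * Power series indexed by sets of letters *)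

Section SetPowerSeriesRing.
Variables (I : finType) (A : algType rat).

(** Multilinear power series: the value at S collects the terms in which the
    letters of S, and no others, occur, once each. Products of terms that share
    a letter are dropped. Hence the convolution over decompositions of S. *)
Definition sps : Type := {ffun {set I} -> A}.

HB.instance Definition _ := GRing.Lmodule.copy sps {ffun {set I} -> A}.

Implicit Types (a b c : sps) (S : {set I}).

Definition sps_one : sps := [ffun S => (S == set0)%:R].

Definition sps_mul a b : sps :=
  [ffun S : {set I} => \sum_(T : {set I} | T \subset S) a T * b (S :\: T)].

Lemma sps_mulA : associative sps_mul.
Proof.
move=> a b c; apply/ffunP => S; rewrite !ffunE.
under eq_bigr => T _ do rewrite ffunE mulr_sumr.
under [RHS]eq_bigr => T _ do rewrite ffunE mulr_suml.
rewrite [RHS](exchange_big_dep (fun T : {set I} => T \subset S)) /=; last first.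
  by move=> T U TS UT; apply: subset_trans UT TS.
apply: eq_bigr => T TS.
rewrite [RHS](reindex_onto (fun U => T :|: U) (fun U => U :\: T)) /=; last first.
  move=> U /andP[_ /subsetP TU]; apply/setP => x; rewrite !inE.
  by case: (boolP (x \in T)) => [/TU ->|].
apply: eq_big => [U|U US].
  rewrite subUset TS subsetUl andbT /= subsetD setDUl setDv set0U; congr (_ && _).
  by apply/idP/eqP => [/setDidPl|/setDidPl].
rewrite mulrA; congr (_ * b _ * c _); last by rewrite setDDl.
rewrite setDUl setDv set0U; apply/esym/setDidPl.
by move: US; rewrite subsetD => /andP[].
Qed.

Lemma sps_mul1l : left_id sps_one sps_mul.
Proof.
move=> a; apply/ffunP => S; rewrite ffunE (bigD1 set0) ?sub0set //= ffunE eqxx.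
rewrite mul1r setD0 big1 ?addr0 // => T /andP[_ /negPf T0].
by rewrite ffunE T0 mul0r.
Qed.

Lemma sps_mul1r : right_id sps_one sps_mul.
Proof.
move=> a; apply/ffunP => S; rewrite ffunE (bigD1 S) //= ffunE setDv eqxx.
rewrite mulr1 big1 ?addr0 // => T /andP[TS TnS].
rewrite ffunE setD_eq0; case: (boolP (S \subset T)) => [ST|]; last by rewrite mulr0.
by move: TnS; rewrite eqEsubset TS ST.
Qed.

Lemma sps_mulDl : left_distributive sps_mul +%R.
Proof.
move=> a b c; apply/ffunP => S; rewrite !ffunE -big_split.
by apply: eq_bigr => T _; rewrite ffunE mulrDl.
Qed.

Lemma sps_mulDr : right_distributive sps_mul +%R.
Proof.
move=> a b c; apply/ffunP => S; rewrite !ffunE -big_split.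
by apply: eq_bigr => T _; rewrite ffunE mulrDr.
Qed.

Lemma sps_one_neq0 : sps_one != 0.
Proof.
apply/eqP => /ffunP/(_ set0); rewrite !ffunE eqxx => /eqP.
by rewrite oner_eq0.
Qed.

HB.instance Definition _ := GRing.Zmodule_isNzRing.Build sps
  sps_mulA sps_mul1l sps_mul1r sps_mulDl sps_mulDr sps_one_neq0.

Lemma sps_scaleAl (k : rat) a b : k *: (a * b) = (k *: a) * b.
Proof.
apply/ffunP => S; rewrite !ffunE scaler_sumr.
by apply: eq_bigr => T _; rewrite ffunE scalerAl.
Qed.

HB.instance Definition _ := GRing.Lmodule_isLalgebra.Build rat sps sps_scaleAl.

Lemma sps_scaleAr (k : rat) a b : k *: (a * b) = a * (k *: b).
Proof.
apply/ffunP => S; rewrite !ffunE scaler_sumr.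
by apply: eq_bigr => T _; rewrite ffunE scalerAr.
Qed.

HB.instance Definition _ := GRing.Lalgebra_isAlgebra.Build rat sps sps_scaleAr.

Lemma spsM a b S : (a * b) S = \sum_(T : {set I} | T \subset S) a T * b (S :\: T).
Proof. by rewrite ffunE. Qed.

Lemma sps1 S : (1 : sps) S = (S == set0)%:R.
Proof. by rewrite ffunE. Qed.

Lemma spsD a b S : (a + b) S = a S + b S. Proof. by rewrite ffunE. Qed.
Lemma spsZ (k : rat) a S : (k *: a) S = k *: a S. Proof. by rewrite ffunE. Qed.
Lemma spsN a S : (- a) S = - a S. Proof. by rewrite ffunE. Qed.
Lemma sps0 S : (0 : sps) S = 0. Proof. by rewrite ffunE. Qed.
Lemma sps_sum J (r : seq J) (P : pred J) (F : J -> sps) S :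
  (\sum_(j <- r | P j) F j) S = \sum_(j <- r | P j) F j S.
Proof. by elim/big_rec2: _ => [|j y1 y2 _ <-]; rewrite ?sps0 ?spsD. Qed.

End SetPowerSeriesRing.

(** * Divided powers and the adjoint action *)

Section DividedPowers.
Variable B : algType rat.
Implicit Types (x y z d : B) (k i j : nat).

Definition lbr x z := x * z - z * x.

Definition dpow k x : B := (k`!%:R : rat)^-1 *: x ^+ k.

(** The terms of e^(ad x) z. *)
Definition adpow k x z : B := (k`!%:R : rat)^-1 *: iter k (lbr x) z.

(** The terms of ((e^(ad x) - 1) / ad x) d. *)
Definition psipow k x d : B := (k.+1`!%:R : rat)^-1 *: iter k (lbr x) d.

Lemma factS_inv k : ((k.+1)`!%:R : rat)^-1 * k.+1%:R = (k`!%:R)^-1.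
Proof. by rewrite factS natrM invfM mulrAC mulVf ?mul1r // pnatr_eq0. Qed.

Lemma lbrZ c x z : lbr x (c *: z) = c *: lbr x z.
Proof. by rewrite /lbr -scalerAl -scalerAr scalerBr. Qed.

Lemma lbrDr x y z : lbr x (y + z) = lbr x y + lbr x z.
Proof. by rewrite /lbr mulrDl mulrDr opprD addrACA. Qed.

Lemma lbr0 x : lbr x 0 = 0. Proof. by rewrite /lbr mulr0 mul0r subrr. Qed.

Lemma lbr_iterD i x y z : iter i (lbr x) (y + z) = iter i (lbr x) y + iter i (lbr x) z.
Proof. by elim: i => //= i ->; rewrite lbrDr. Qed.

Lemma lbr_iter0 i x : iter i (lbr x) 0 = 0.
Proof. by elim: i => //= i ->; rewrite lbr0. Qed.

Lemma adpow0 x z : adpow 0 x z = z.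
Proof. by rewrite /adpow fact0 invr1 scale1r. Qed.

Lemma adpowD k x y z : adpow k x (y + z) = adpow k x y + adpow k x z.
Proof. by rewrite /adpow lbr_iterD scalerDr. Qed.

Lemma adpow_z0 k x : adpow k x 0 = 0.
Proof. by rewrite /adpow lbr_iter0 scaler0. Qed.

Lemma adpow_sum k x J (r : seq J) (P : pred J) (F : J -> B) :
  adpow k x (\sum_(j <- r | P j) F j) = \sum_(j <- r | P j) adpow k x (F j).
Proof. exact: (big_morph _ (adpowD k x) (adpow_z0 k x)). Qed.

Lemma dpow_mull k x : x * dpow k x = k.+1%:R *: dpow k.+1 x.
Proof. by rewrite /dpow -scalerAr -exprS scalerA mulrC factS_inv. Qed.

Lemma lbr_adpow k x z : lbr x (adpow k x z) = k.+1%:R *: adpow k.+1 x z.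
Proof. by rewrite /adpow lbrZ /= scalerA mulrC factS_inv. Qed.

Lemma lbr_psipow k x z : lbr x (psipow k x z) = k.+2%:R *: psipow k.+1 x z.
Proof. by rewrite /psipow lbrZ /= scalerA mulrC factS_inv. Qed.

Lemma scaler_natI k y z : k.+1%:R *: y = (k.+1%:R : rat) *: z -> y = z.
Proof. by apply: scalerI; rewrite pnatr_eq0. Qed.

(** Both sides are the sum of (i + j) F i j over i + j = k + 1. *)
Lemma antidiag_weight (F : nat -> nat -> B) k :
  \sum_(i < k.+1) ((i.+1%:R : rat) *: F i.+1 (k - i)%N
                   + ((k - i).+1%:R : rat) *: F i (k.+1 - i)%N)
  = (k.+1%:R : rat) *: \sum_(i < k.+2) F i (k.+1 - i)%N.
Proof.
rewrite scaler_sumr big_split /=.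
transitivity (\sum_(i < k.+2) ((i%:R : rat) *: F i (k.+1 - i)%N
   + ((k.+1 - i)%:R : rat) *: F i (k.+1 - i)%N)); last first.
  apply: eq_bigr => i _; rewrite -scalerDl -natrD subnKC //.
  by rewrite -ltnS.
rewrite [RHS]big_split /=; congr (_ + _).
  by rewrite [RHS]big_ord_recl /= scale0r add0r; apply: eq_bigr.
rewrite [RHS]big_ord_recr /= subnn scale0r addr0; apply: eq_bigr => i _.
by rewrite subSn // -ltnS.
Qed.

(** The degree k part of e^x z = (e^(ad x) z) e^x; multiplying by x on the left
    gives the induction step. *)
Lemma dpow_ad k x z :
  dpow k x * z = \sum_(i < k.+1) adpow i x z * dpow (k - i) x.
Proof.
elim: k => [|k IH].
  by rewrite big_ord1 adpow0 /dpow fact0 invr1 !scale1r expr0 mul1r mulr1.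
apply: (@scaler_natI k).
rewrite -(antidiag_weight (fun i j => adpow i x z * dpow j x)).
rewrite scalerAl -dpow_mull -mulrA IH mulr_sumr.
apply: eq_bigr => i _; have ik : (i <= k)%N by rewrite -ltnS.
rewrite mulrA -{1}[x * _](subrK (adpow i x z * x)) -/(lbr _ _) lbr_adpow mulrDl.
rewrite -scalerAl -mulrA dpow_mull subSn //; congr (_ + _); apply/esym/scalerAr.
Qed.

(** The degree k - 1 part in x of the derivative of the exponential,
    d(e^x) = (((e^(ad x) - 1) / ad x) d) e^x. *)
Lemma dpow_psi k x d :
  ((k`!%:R : rat)^-1 *: \sum_(i < k) x ^+ i * d * x ^+ (k.-1 - i))
  = \sum_(i < k) psipow i x d * dpow (k.-1 - i) x.
Proof.
elim: k => [|k IH]; first by rewrite !big_ord0 scaler0.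
apply: (@scaler_natI k).
rewrite scalerA mulrC factS_inv big_ord_recl /= subn0 expr0 mul1r scalerDr.
have -> : \sum_(i < k) x ^+ (bump 0 i) * d * x ^+ (k - bump 0 i)
        = x * (\sum_(i < k) x ^+ i * d * x ^+ (k.-1 - i)).
  rewrite mulr_sumr; apply: eq_bigr => i _; rewrite exprS !mulrA /bump /= add1n.
  by congr (_ * _ ^+ _); case: (k) i => [[]|m i].
rewrite [X in _ + X = _]scalerAr IH.
case: k {IH} => [|k].
  by rewrite big_ord0 mulr0 addr0 big_ord1 /psipow /dpow /= fact0 !invr1 !scale1r.
rewrite mulr_sumr.
transitivity (psipow 0 x d * dpow k.+1 x + \sum_(i < k.+1)
  ((i.+2%:R : rat) *: (psipow i.+1 x d * dpow (k - i) x)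
   + ((k - i).+1%:R : rat) *: (psipow i x d * dpow (k.+1 - i) x))).
  congr (_ + _).
    by rewrite /psipow /dpow /= invr1 scale1r scalerAr.
  apply: eq_bigr => i _; have ik : (i <= k)%N by rewrite -ltnS.
  rewrite mulrA -{1}[x * _](subrK (psipow i x d * x)) -/(lbr _ _) lbr_psipow mulrDl.
  rewrite -scalerAl -mulrA dpow_mull subSn //; congr (_ + _); apply/esym/scalerAr.
transitivity (\sum_(i < k.+2) psipow i x d * dpow (k.+1 - i) x + \sum_(i < k.+1)
  ((i.+1%:R : rat) *: (psipow i.+1 x d * dpow (k - i) x)
   + ((k - i).+1%:R : rat) *: (psipow i x d * dpow (k.+1 - i) x))).
  rewrite [X in _ = X + _]big_ord_recl /= subn0 -addrA -big_split; congr (_ + _).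
  apply: eq_bigr => i _; rewrite /= addrA; congr (_ + _).
  by rewrite -[i.+2%:R]natr1 addrC scalerDl scale1r.
rewrite (antidiag_weight (fun i j => psipow i x d * dpow j x)).
by rewrite -[k.+2%:R]natr1 addrC scalerDl scale1r.
Qed.

Lemma dpowD k x y : GRing.comm x y ->
  dpow k (x + y) = \sum_(i < k.+1) dpow (k - i) x * dpow i y.
Proof.
move=> cxy; rewrite /dpow exprDn_comm // scaler_sumr; apply: eq_bigr => i _.
have ik : (i <= k)%N by rewrite -ltnS.
rewrite -scaler_nat scalerA -scalerAl -scalerAr scalerA; congr (_ *: _).
rewrite -(bin_fact ik) !natrM.
have f0 m : (m`!%:R : rat) != 0 by rewrite pnatr_eq0 -lt0n fact_gt0.
have b0 : ('C(k, i)%:R : rat) != 0 by rewrite pnatr_eq0 -lt0n bin_gt0.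
by rewrite !invfM [_ * 'C(k, i)%:R]mulrC mulVKf // mulrC.
Qed.

(** The products in the expansion that contain [d] twice vanish. *)
Lemma exprD_first k x d : (forall a, d * a * d = 0) ->
  (x + d) ^+ k = x ^+ k + \sum_(i < k) x ^+ i * d * x ^+ (k.-1 - i).
Proof.
move=> dd; elim: k => [|k IH]; first by rewrite big_ord0 addr0 !expr0.
rewrite exprS IH mulrDl !mulrDr -exprS big_ord_recl /= subn0 expr0 mul1r -addrA.
congr (_ + _); rewrite addrA [X in _ + X = _](_ : _ = 0) ?addr0; last first.
  by rewrite mulr_sumr big1 // => i _; rewrite !mulrA dd mul0r.
rewrite addrC; congr (_ + _); rewrite mulr_sumr; apply: eq_bigr => i _.
rewrite exprS !mulrA /bump /= add1n; congr (_ * _ ^+ _).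
by case: (k) i => [[]|m i].
Qed.

Lemma adpowN k x z : adpow k (- x) z = (-1) ^+ k *: adpow k x z.
Proof.
have lbrN y : lbr (- x) y = - lbr x y by rewrite /lbr mulNr mulrN -opprB opprK addrC.
rewrite /adpow scalerA mulrC -scalerA; congr (_ *: _); elim: k => [|k /= ->].
  by rewrite expr0 scale1r.
by rewrite lbrZ lbrN scalerN -scaleNr exprS mulN1r.
Qed.

End DividedPowers.

(** * Symmetric products of exponentials *)

Lemma triangle_sum (V : nmodType) (F : nat -> nat -> V) N :
  (forall i j, (N <= i + j)%N -> F i j = 0) ->
  \sum_(k < N) \sum_(i < k.+1) F i (k - i)%N = \sum_(i < N) \sum_(j < N) F i j.
Proof.
move=> F0.
transitivity (\sum_(i < N) \sum_(j < N - i) F i j).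
  elim: {F0}N => [|N IH]; first by rewrite !big_ord0.
  rewrite big_ord_recr /= IH [RHS]big_ord_recr /= subSnn big_ord1.
  rewrite [X in _ + X]big_ord_recr /= subnn addrA -big_split; congr (_ + _).
  by apply: eq_bigr => i _ /=; rewrite subSn ?big_ord_recr // ltnW.
apply: eq_bigr => i _; have Nsplit : (N - i + i = N)%N by rewrite subnK // ltnW.
rewrite (big_ord_widen N (F i)) ?leq_subr // big_mkcond; apply: eq_bigr => j _.
by case: ltnP => // h; rewrite F0 // -leq_subLR.
Qed.

Section NilpotentExponential.
Variables (I : finType) (A : algType rat).
Notation sps := (sps I A).
Implicit Types (a b c x z d : sps) (S T : {set I}).

Notation N := (#|I|.+1).

(** A term with the letters of S counts as of degree #|S|. *)
Definition order_ge m a := forall S, (#|S| < m)%N -> a S = 0.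

Lemma order_geD m a b : order_ge m a -> order_ge m b -> order_ge m (a + b).
Proof. by move=> ha hb S hS; rewrite spsD ha // hb // addr0. Qed.

Lemma order_geZ m (k : rat) a : order_ge m a -> order_ge m (k *: a).
Proof. by move=> ha S hS; rewrite spsZ ha // scaler0. Qed.

Lemma order_geN m a : order_ge m a -> order_ge m (- a).
Proof. by move=> ha S hS; rewrite spsN ha // oppr0. Qed.

Lemma order_ge_sum m J (r : seq J) (P : pred J) (F : J -> sps) :
  (forall j, P j -> order_ge m (F j)) -> order_ge m (\sum_(j <- r | P j) F j).
Proof. by move=> h S hS; rewrite sps_sum big1 // => j Pj; rewrite h. Qed.

Lemma order_ge_leq m m' a : (m' <= m)%N -> order_ge m a -> order_ge m' a.
Proof. by move=> mm ha S hS; apply: ha; apply: leq_trans mm. Qed.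

Lemma order_geM m m' a b : order_ge m a -> order_ge m' b -> order_ge (m + m') (a * b).
Proof.
move=> ha hb S hS; rewrite spsM big1 // => T TS.
have [hT|hT] := ltnP #|T| m; first by rewrite ha // mul0r.
rewrite hb ?mulr0 // cardsD (setIidPr TS) ltn_subLR ?subset_leq_card //.
by rewrite (leq_trans hS) // leq_add2r.
Qed.

(** There are only #|I| letters, so that elements of positive order are
    nilpotent, and their exponential series are finite sums. *)
Lemma order_ge_max m a : (#|I| < m)%N -> order_ge m a -> a = 0.
Proof.
move=> hm ha; apply/ffunP => S; rewrite sps0; apply: ha.
by apply: leq_ltn_trans hm; apply: max_card.
Qed.

Lemma order_ge_iter m k x z : order_ge 1 x -> order_ge m z -> order_ge (k + m) (iter k (lbr x) z).
Proof.
move=> hx hz; elim: k => [|k IH] //=; rewrite addSn -add1n.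
by apply: order_geD; [exact: order_geM | apply: order_geN; rewrite addnC; exact: order_geM].
Qed.

Lemma order_ge_adpow m k x z : order_ge 1 x -> order_ge m z -> order_ge (k + m) (adpow k x z).
Proof. by move=> hx hz; apply: order_geZ; apply: order_ge_iter. Qed.

Lemma order_ge_psipow m k x z : order_ge 1 x -> order_ge m z -> order_ge (k + m) (psipow k x z).
Proof. by move=> hx hz; apply: order_geZ; apply: order_ge_iter. Qed.

Lemma order_ge_dpow k x : order_ge 1 x -> order_ge k (dpow k x).
Proof.
move=> hx; apply: order_geZ; elim: k => [|k IH]; first by move=> S.
by rewrite exprS -add1n; apply: order_geM.
Qed.

Lemma order_ge0 a : order_ge 0 a. Proof. by []. Qed.

(** The exponential of an element of positive order. *)
Definition sps_exp x := \sum_(k < N) dpow k x.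

(** The operators e^(ad x) and (e^(ad x) - 1) / ad x, for [x] of positive
    order. *)
Definition exp_ad x z := \sum_(k < N) adpow k x z.
Definition Psi x d := \sum_(k < N) psipow k x d.

Lemma sps_exp_mul x z : order_ge 1 x -> sps_exp x * z = exp_ad x z * sps_exp x.
Proof.
move=> hx; rewrite /sps_exp mulr_suml.
under eq_bigr => k _ do rewrite dpow_ad.
rewrite (triangle_sum (F := fun i j => adpow i x z * dpow j x)); last first.
  move=> i j hij; apply: (order_ge_max hij); apply: order_geM; last exact: order_ge_dpow.
  by have := order_ge_adpow (k := i) hx (@order_ge0 z); rewrite addn0.
by rewrite /exp_ad mulr_suml; apply: eq_bigr => i _; rewrite mulr_sumr.
Qed.

Lemma sps_exp_opp x : order_ge 1 x -> sps_exp x * sps_exp (- x) = 1.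
Proof.
move=> hx; have hNx : order_ge 1 (- x) by apply: order_geN.
have cx : GRing.comm (- x) x by rewrite /GRing.comm mulNr mulrN.
rewrite /sps_exp mulr_suml.
under eq_bigr => k _ do rewrite mulr_sumr.
rewrite -(triangle_sum (F := fun i j => dpow i x * dpow j (- x))); last first.
  by move=> i j hij; apply: (order_ge_max hij); apply: order_geM; apply: order_ge_dpow.
under eq_bigr => k _.
  under eq_bigr => i _.
    have cij : dpow i x * dpow (k - i) (- x) = dpow (k - i) (- x) * dpow i x.
      rewrite /dpow -!scalerAl -!scalerAr scalerA mulrC -scalerA; do 2!congr (_ *: _).
      by apply: commrX; apply: commr_sym; apply: commrX; apply: commr_sym.
    rewrite cij.
    over.
  rewrite -(dpowD k cx) addNr.
  over.
rewrite big_ord_recl /= /dpow fact0 invr1 scale1r expr0 big1 ?addr0 // => k _.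
by rewrite exprS mul0r scaler0.
Qed.

Lemma sps_exp0 : sps_exp 0 = 1.
Proof.
have o0 : order_ge 1 (0 : sps) by move=> S _; rewrite sps0.
by have := sps_exp_opp o0; rewrite oppr0 /sps_exp big_ord_recl /= /dpow fact0 invr1 scale1r
  expr0 big1 ?addr0 // => k _; rewrite exprS mul0r scaler0.
Qed.

(** The derivative of the exponential. It is exact, as [d] enters the powers of
    x + d to first order only. *)
Lemma sps_exp_first x d : order_ge 1 x -> order_ge 1 d -> (forall a, d * a * d = 0) ->
  sps_exp (x + d) = (1 + Psi x d) * sps_exp x.
Proof.
move=> hx hd dd; rewrite mulrDl mul1r.
transitivity (\sum_(k < N) (dpow k x + \sum_(i < k) psipow i x d * dpow (k.-1 - i) x)).
  apply: eq_bigr => k _; rewrite {1}/dpow exprD_first // scalerDr; congr (_ + _).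
  exact: dpow_psi.
rewrite big_split /=; congr (_ + _); rewrite big_ord_recl /= big_ord0 add0r.
have F0 i j : (#|I| <= i + j)%N -> psipow i x d * dpow j x = 0.
  move=> hij; apply: (@order_ge_max (i + 1 + j)); first by rewrite addn1 addSn ltnS.
  by apply: order_geM; [apply: order_ge_psipow | apply: order_ge_dpow].
transitivity (\sum_(k < N) \sum_(i < k.+1) psipow i x d * dpow (k - i) x).
  rewrite [RHS]big_ord_recr /= [X in _ = _ + X]big1 ?addr0 // => i _.
  by apply: F0; rewrite subnKC // -ltnS.
rewrite (triangle_sum (F := fun i j => psipow i x d * dpow j x)); last first.
  by move=> i j hij; apply: F0; apply: ltnW.
by rewrite /Psi mulr_suml; apply: eq_bigr => i _; rewrite /sps_exp mulr_sumr.
Qed.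

(** An ideal of square zero, since the letter [k] cannot occur twice: its
    elements act as exact first-order perturbations. *)
Definition divisible (k : I) a := forall S, k \notin S -> a S = 0.

Lemma divisibleD k a b : divisible k a -> divisible k b -> divisible k (a + b).
Proof. by move=> ha hb S kS; rewrite spsD ha // hb // addr0. Qed.

Lemma divisibleZ k (r : rat) a : divisible k a -> divisible k (r *: a).
Proof. by move=> ha S kS; rewrite spsZ ha // scaler0. Qed.

Lemma divisibleN k a : divisible k a -> divisible k (- a).
Proof. by move=> ha S kS; rewrite spsN ha // oppr0. Qed.

Lemma divisible_sum k J (r : seq J) (P : pred J) (F : J -> sps) :
  (forall j, P j -> divisible k (F j)) -> divisible k (\sum_(j <- r | P j) F j).
Proof. by move=> h S hS; rewrite sps_sum big1 // => j Pj; rewrite h. Qed.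

Lemma divisibleMr k a b : divisible k a -> divisible k (a * b).
Proof.
move=> ha S kS; rewrite spsM big1 // => T TS; rewrite ha ?mul0r //.
by apply: contra kS; apply: (subsetP TS).
Qed.

Lemma divisibleMl k a b : divisible k b -> divisible k (a * b).
Proof.
move=> hb S kS; rewrite spsM big1 // => T TS; rewrite hb ?mulr0 //.
by apply: contra kS; rewrite inE => /andP[].
Qed.

Lemma divisible_mul0 k a b : divisible k a -> divisible k b -> a * b = 0.
Proof.
move=> ha hb; apply/ffunP => S; rewrite sps0 spsM big1 // => T TS.
have [kT|kT] := boolP (k \in T); last by rewrite ha ?mul0r.
by rewrite hb ?mulr0 // inE kT.
Qed.

Lemma divisible_iter k m x z : divisible k z -> divisible k (iter m (lbr x) z).
Proof.
move=> hz; elim: m => //= m IH.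
by apply: divisibleD; [exact: divisibleMl | apply: divisibleN; exact: divisibleMr].
Qed.

Lemma divisible_adpow k m x z : divisible k z -> divisible k (adpow m x z).
Proof. by move=> hz; apply: divisibleZ; apply: divisible_iter. Qed.

Lemma divisible_psipow k m x z : divisible k z -> divisible k (psipow m x z).
Proof. by move=> hz; apply: divisibleZ; apply: divisible_iter. Qed.

Lemma divisible_order_ge1 k z : divisible k z -> order_ge 1 z.
Proof. by move=> hz S; rewrite ltnS leqn0 cards_eq0 => /eqP ->; rewrite hz // inE. Qed.

Implicit Type s : seq (sps * sps).

(** In a list of pairs, the first components are the exponents of the right half
    of a symmetric product, from the centre outwards; the second components are
    perturbations of these exponents. *)
Definition exp_right s := \prod_(p <- s) sps_exp p.1.
Definition exp_right_pert s := \prod_(p <- s) sps_exp (p.1 + p.2).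
Definition exp_left s := \prod_(p <- rev s) sps_exp p.1.
Definition exp_left_pert s := \prod_(p <- rev s) sps_exp (p.1 + p.2).

Definition opp_pairs s := [seq (- p.1, - p.2) | p <- s].

(** The logarithmic derivative of [exp_right] in the direction of the
    perturbations. It is graded by the number of commutators, because this
    number decides the sign of a term under negation of all exponents. *)
Fixpoint log_deriv s (m : nat) : sps :=
  if s is p :: s' then
    psipow m p.1 p.2 + \sum_(i < m.+1) adpow i p.1 (log_deriv s' (m - i)%N)
  else 0.

(** Conjugation of [X] by [exp_right], graded by the number of commutators as
    well. *)
Fixpoint conj_right s (m : nat) (X : sps) : sps :=
  if s is p :: s' then \sum_(i < m.+1) adpow i p.1 (conj_right s' (m - i)%N X)
  else if m is 0 then X else 0.

(** The conditions under which the exponential series are finite and the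
    perturbations exact to first order. *)
Definition is_perturbation k s := forall p, p \in s -> order_ge 1 p.1 /\ divisible k p.2.

Lemma is_perturbation_cons k p s : is_perturbation k (p :: s) -> [/\ order_ge 1 p.1, divisible k p.2 & is_perturbation k s].
Proof.
move=> h; have [h1 h2] := h p (mem_head _ _); split=> // q qs.
by apply: h; rewrite inE qs orbT.
Qed.

Lemma log_deriv_divisible k s m : is_perturbation k s -> divisible k (log_deriv s m).
Proof.
elim: s m => [|p s IH] m /=; first by move=> _ S _; rewrite sps0.
case/is_perturbation_cons => hx hd /IH hs; apply: divisibleD; first exact: divisible_psipow.
by apply: divisible_sum => i _; apply: divisible_adpow.
Qed.

Lemma log_deriv_order_ge k s m : is_perturbation k s -> order_ge m.+1 (log_deriv s m).
Proof.
elim: s m => [|p s IH] m /=; first by move=> _ S _; rewrite sps0.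
case/is_perturbation_cons => hx hd /IH hs; apply: order_geD.
  by rewrite -addn1; apply: order_ge_psipow => //; apply: divisible_order_ge1 hd.
apply: order_ge_sum => i _; apply: (@order_ge_leq (i + (m - i).+1)).
  by rewrite addnS subnKC // -ltnS.
by apply: order_ge_adpow => //; apply: hs.
Qed.

Lemma conj_right_divisible k s m X : divisible k X -> divisible k (conj_right s m X).
Proof.
move=> hX; elim: s m => [|p s IH] [|m] //=; try by move=> S _; rewrite sps0.
  by apply: divisible_sum => i _; apply: divisible_adpow.
by apply: divisible_sum => i _; apply: divisible_adpow.
Qed.

Lemma conj_right_order_ge k s m X : is_perturbation k s -> order_ge m (conj_right s m X).
Proof.
elim: s m => [|p s IH] [|m] //=; try by move=> _ S _; rewrite sps0.
case/is_perturbation_cons => hx hd /IH hs.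
apply: order_ge_sum => i _; apply: (@order_ge_leq (i + (m.+1 - i))).
  by rewrite subnKC // -ltnS.
by apply: order_ge_adpow => //; apply: hs.
Qed.

(** Each factor of the product contributes its own derivative, conjugated by the
    factors to its left; the mixed terms contain the letter [k] twice. *)
Lemma exp_right_first k s : is_perturbation k s ->
  exp_right_pert s = (1 + \sum_(m < N) log_deriv s m) * exp_right s.
Proof.
rewrite /exp_right_pert /exp_right; elim: s => [|p s IH].
  by rewrite !big_nil big1 // addr0 mulr1.
move=> hps; have [hx hd hs] := is_perturbation_cons hps; rewrite !big_cons IH // sps_exp_first //; last first.
- by move=> a; apply: (@divisible_mul0 k) => //; apply: divisibleMr.
- exact: divisible_order_ge1 hd.
set D := \sum_(m < N) log_deriv s m.
have hD : divisible k D by apply: divisible_sum => m _; apply: log_deriv_divisible.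
have -> : \sum_(m < N) log_deriv (p :: s) m = Psi p.1 p.2 + exp_ad p.1 D.
  rewrite /= big_split /=; congr (_ + _).
  rewrite (triangle_sum (F := fun i j => adpow i p.1 (log_deriv s j))); last first.
    move=> i j hij; apply: (@order_ge_max (i + j.+1)); first by rewrite addnS ltnS ltnW.
    by apply: order_ge_adpow => //; apply: log_deriv_order_ge hs.
  by apply: eq_bigr => i _; rewrite adpow_sum.
have E : sps_exp p.1 * (1 + D) = (1 + exp_ad p.1 D) * sps_exp p.1.
  by rewrite mulrDr mulr1 (sps_exp_mul _ hx) mulrDl mul1r.
rewrite mulrA -[_ * sps_exp p.1 * (1 + D)]mulrA E !mulrA; congr (_ * _ * _).
rewrite mulrDr mulr1 mulrDl mul1r [Psi _ _ * _](_ : _ = 0) ?addr0 ?addrA //.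
apply: (@divisible_mul0 k); first by apply: divisible_sum => i _; apply: divisible_psipow.
by apply: divisible_sum => i _; apply: divisible_adpow.
Qed.

Lemma exp_right_mul k s X : is_perturbation k s ->
  exp_right s * X = (\sum_(m < N) conj_right s m X) * exp_right s.
Proof.
rewrite /exp_right; elim: s => [|p s IH] hps.
  rewrite big_nil mul1r mulr1 big_ord_recl big1 ?addr0 // => i _.
have [hx hd hs] := is_perturbation_cons hps.
rewrite big_cons -mulrA IH // mulrA (sps_exp_mul _ hx) mulrA; congr (_ * _ * _).
rewrite /= (triangle_sum (F := fun i j => adpow i p.1 (conj_right s j X))).
  by apply: eq_bigr => i _; rewrite adpow_sum.
move=> i j hij; apply: (order_ge_max hij); apply: order_ge_adpow => //.
exact: conj_right_order_ge hs.
Qed.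

(** A term with m commutators contains m exponents and one perturbation. *)
Lemma log_deriv_opp s m : log_deriv (opp_pairs s) m = (-1) ^+ m.+1 *: log_deriv s m.
Proof.
elim: s m => [|p s IH] m /=; first by rewrite scaler0.
have adZ i x z (c : rat) : adpow i x (c *: z) = c *: adpow i x z.
  rewrite /adpow scalerA mulrC -scalerA; congr (_ *: _).
  by elim: i => //= i ->; rewrite lbrZ.
have psiE x d : psipow m x d = m.+1%:R^-1 *: adpow m x d.
  by rewrite /psipow /adpow scalerA factS natrM invfM.
rewrite scalerDr scaler_sumr; congr (_ + _).
  rewrite !psiE adpowN -scaleN1r adZ !scalerA; congr (_ *: _).
  by rewrite exprSr; congr (_ / _); rewrite -mulrA mulrC.
apply: eq_bigr => i _; rewrite IH adZ adpowN scalerA; congr (_ *: _).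
by rewrite -exprD addSn subnK // -ltnS.
Qed.

Lemma log_deriv_0 s : log_deriv s 0 = \sum_(p <- s) p.2.
Proof.
elim: s => [|p s IH] /=; first by rewrite big_nil.
by rewrite big_cons big_ord1 adpow0 IH /psipow invr1 scale1r.
Qed.

Lemma is_perturbation_opp k s : is_perturbation k s -> is_perturbation k (opp_pairs s).
Proof.
by move=> h _ /mapP[p /h[h1 h2] ->]; split; [exact: order_geN | exact: divisibleN].
Qed.

(** Negating the exponents and reversing the order of the factors inverts a
    product of exponentials. *)
Lemma exp_rightK s : (forall p, p \in s -> order_ge 1 p.1) ->
  exp_right s * exp_left (opp_pairs s) = 1 /\ exp_left (opp_pairs s) * exp_right s = 1.
Proof.
rewrite /exp_right /exp_left; elim: s => [|p s IH] h.
  by rewrite /= !big_nil mulr1.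
have [q qs|h1 h2] := IH; first by apply: h; rewrite inE qs orbT.
have hp : order_ge 1 p.1 by apply: h; rewrite mem_head.
rewrite /= rev_cons -cats1 big_cat big_seq1 big_cons /=; split.
  by rewrite mulrA -[sps_exp _ * _ * _]mulrA h1 mulr1 sps_exp_opp.
rewrite mulrA -[_ * _ * sps_exp p.1]mulrA -{2}[p.1]opprK sps_exp_opp ?mulr1 //.
exact: order_geN.
Qed.

(** Inverting the left half of the product turns it into a right half for the
    negated exponents; hence the derivative of the whole product is the
    difference of the logarithmic derivatives for the exponents and for their
    opposites. Negation changes the sign of the terms with an even number of
    commutators only, so that all terms with an odd number cancel. *)
Lemma symmetric_log_deriv k s X : is_perturbation k s -> divisible k X ->
  exp_left_pert s * exp_right_pert s = exp_left s * exp_right s * (1 + X) ->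
  \sum_(m < N) (1 + (-1) ^+ m : rat) *: log_deriv s m
  = \sum_(m < N) conj_right s m X.
Proof.
move=> hs hX; set D := \sum_(m < N) log_deriv s m.
set D' := \sum_(m < N) log_deriv (opp_pairs s) m.
have hs' := is_perturbation_opp hs.
have hD : divisible k D by apply: divisible_sum => m _; apply: log_deriv_divisible.
have hD' : divisible k D' by apply: divisible_sum => m _; apply: log_deriv_divisible.
have oppK t : opp_pairs (opp_pairs t) = t.
  by rewrite /opp_pairs -map_comp map_id_in // => -[x d] _ /=; rewrite !opprK.
have [_ RK] := exp_rightK (fun p ps => (hs p ps).1).
have [L'K LK] := exp_rightK (fun p ps => (hs' p ps).1).
rewrite oppK in LK L'K.
(* The perturbed exponents are exponents of positive order themselves, so the
   perturbed left half is inverse to the perturbed opposite right half. *)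
have [L''K _] : exp_right_pert (opp_pairs s) * exp_left_pert s = 1 /\ True.
  pose t := [seq (p.1 + p.2, p.2) | p <- opp_pairs s].
  have [q|h _] := @exp_rightK t.
    by move=> /mapP[p /hs'[h1 h2] ->] /=; apply: order_geD => //; exact: divisible_order_ge1 h2.
  split=> //; rewrite -h; congr (_ * _).
    by rewrite /exp_right_pert /exp_right /t !big_map.
  rewrite /exp_left_pert /exp_left /t /opp_pairs -map_comp -map_comp -map_rev big_map.
  by apply: eq_bigr => p _ /=; rewrite -opprD opprK.
have L'E : exp_left_pert s = exp_left s * (1 - D').
  have := exp_right_first hs'; rewrite -/D' => E; rewrite E in L''K.
  have D'D' : (1 - D') * (1 + D') = 1.
    by rewrite mulrDl mul1r mulNr mulrDr mulr1 (divisible_mul0 hD' hD') addr0 addrK.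
  have := congr1 (fun u => exp_left s * (1 - D') * u) L''K.
  rewrite mulr1 => <-; rewrite !mulrA -[_ * (1 - D') * _]mulrA D'D' mulr1.
  by rewrite LK mul1r.
rewrite L'E (exp_right_first hs) -/D => E.
have {}E : (1 - D') * (1 + D) * exp_right s = exp_right s * (1 + X).
  by have := congr1 (fun u => exp_right (opp_pairs s) * u) E; rewrite !mulrA L'K !mul1r.
have {E} : (D - D') * exp_right s = (\sum_(m < N) conj_right s m X) * exp_right s.
  rewrite -(exp_right_mul X hs).
  have D'D : (1 - D') * (1 + D) = 1 + (D - D').
    by rewrite mulrDl mul1r mulNr mulrDr mulr1 (divisible_mul0 hD' hD) addr0 addrA.
  by move: E; rewrite D'D mulrDl mul1r [RHS]mulrDr mulr1 => /addrI.
move/(congr1 (fun u => u * exp_left (opp_pairs s))).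
have [KR _] := exp_rightK (fun p ps => (hs p ps).1).
rewrite -!mulrA KR !mulr1 => <-.
rewrite /D /D' -sumrB; apply: eq_bigr => m _; rewrite log_deriv_opp exprS mulN1r.
by rewrite scaleNr opprK scalerDl scale1r.
Qed.

End NilpotentExponential.

(** * Lie expressions and the Dynkin map *)

Lemma ratr_rat (c : rat) : (ratr c : rat) = c.
Proof. by rewrite /ratr divq_num_den. Qed.

Section LinearExtension.
Variables (n : nat) (K : numFieldType) (V : lmodType K).
Implicit Types (F : seq 'I_n -> V) (P Q : ncpoly n).

(** The linear map with prescribed values on words; the values may lie in a
    space over a larger field than the rationals. *)
Definition lin F P : V := \sum_(w <- msupp P) (ratr P@_w : K) *: F w.

Lemma linEw F P (d : {fset {fmonom 'I_n}}) : (msupp P `<=` d)%fset ->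
  lin F P = \sum_(w <- d) (ratr P@_w : K) *: F w.
Proof.
move=> Pd; rewrite /lin (big_fset_incl _ Pd) //= => w _ /mcoeff_outdom ->.
by rewrite rmorph0 scale0r.
Qed.

Lemma linD F P Q : lin F (P + Q) = lin F P + lin F Q.
Proof.
rewrite (linEw F (msuppD_le P Q)) (linEw F (fsubsetUl (msupp P) (msupp Q))).
rewrite (linEw F (fsubsetUr (msupp P) (msupp Q))) -big_split; apply: eq_bigr => w _.
by rewrite mcoeffD rmorphD scalerDl.
Qed.

Lemma lin0 F : lin F 0 = 0.
Proof. by rewrite /lin msupp0 big_seq_fset0. Qed.

Lemma linZ F c P : lin F (c *: P) = (ratr c : K) *: lin F P.
Proof.
rewrite (linEw F (msuppZ_le c P)) /lin scaler_sumr; apply: eq_bigr => w _.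
by rewrite mcoeffZ rmorphM scalerA.
Qed.

Lemma linB F P Q : lin F (P - Q) = lin F P - lin F Q.
Proof. by rewrite linD -[- Q](@scaleN1r rat) linZ rmorphN1 scaleN1r. Qed.

Lemma lin_sum F J (r : seq J) (p : pred J) (f : J -> ncpoly n) :
  lin F (\sum_(j <- r | p j) f j) = \sum_(j <- r | p j) lin F (f j).
Proof. exact: (big_morph _ (linD F) (lin0 F)). Qed.

Lemma linU F c (w : {fmonom 'I_n}) : lin F << c *g w >> = (ratr c : K) *: F w.
Proof. by rewrite (linEw F msuppU_le) big_seq_fset1 mcoeffUU. Qed.

Lemma linM F P Q : lin F (P * Q) =
  \sum_(u <- msupp P) \sum_(v <- msupp Q) (ratr P@_u * ratr Q@_v : K) *: F (u ++ v).
Proof.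
rewrite malgME lin_sum; apply: eq_bigr => u _; rewrite lin_sum; apply: eq_bigr => v _.
by rewrite linU rmorphM /=; congr (_ *: F _); rewrite /mmul /= /fmmul unlock.
Qed.
End LinearExtension.

Section Dynkin.
Variables (n : nat) (K : numFieldType) (V : lmodType K) (br : {bilinear V -> V -> V}).
Hypothesis br_lie : is_lie_bracket br.
Variable x : 'I_n -> V.
Implicit Types (p q : lie_term n) (v : V) (u w : seq 'I_n) (P Q : ncpoly n).

Definition word_ad w v : V := foldr (fun i => br (x i)) v w.

(** The right-normed bracket of a word. *)
Fixpoint dynkin_word w : V :=
  if w is i :: w' then (if w' is [::] then x i else br (x i) (dynkin_word w')) else 0.

Lemma dynkin_word_cat u w : w != [::] -> dynkin_word (u ++ w) = word_ad u (dynkin_word w).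
Proof.
move=> w0; elim: u => //= i u <-; case E: (u ++ w) => [|//].
by case: w w0 E => //; case: u.
Qed.

Lemma word_ad_cat u w v : word_ad (u ++ w) v = word_ad u (word_ad w v).
Proof. by rewrite /word_ad foldr_cat. Qed.

Lemma word_adD w : {morph word_ad w : a b / a + b}.
Proof. by move=> a b; elim: w => //= i w ->; rewrite linearDr. Qed.

Lemma word_adZ w c v : word_ad w (c *: v) = c *: word_ad w v.
Proof. by elim: w => //= i w ->; rewrite linearZr_LR. Qed.

Lemma word_ad0 w : word_ad w 0 = 0.
Proof. by elim: w => //= i w ->; rewrite linear0r. Qed.

(** The maps on words are split by degree, as Dynkin's identity multiplies each
    degree by a different factor. *)
Definition graded (F : seq 'I_n -> V) d w := if size w == d then F w else 0.

Definition ad_deg d P v := lin (graded (word_ad^~ v) d) P.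
Definition dynkin_deg d P := lin (graded dynkin_word d) P.

(** The contribution of the terms of degree [d] to the value of a Lie expression;
    the value alone does not determine it, since the Lie algebra need not be
    graded. *)
Fixpoint eval_deg p d : V :=
  match p with
  | LieVar i => if d == 1%N then x i else 0
  | LieZero => 0
  | LieAdd p q => eval_deg p d + eval_deg q d
  | LieScale c p => (ratr c : K) *: eval_deg p d
  | LieBracket p q => \sum_(i < d.+1) br (eval_deg p i) (eval_deg q (d - i)%N)
  end.

Lemma word_ad_lin w F P : word_ad w (lin F P) = lin (fun u => word_ad w (F u)) P.
Proof.
rewrite /lin (big_morph _ (word_adD w) (word_ad0 w)).
by apply: eq_bigr => u _; rewrite word_adZ.
Qed.

Lemma lin_gradedM (F H : seq 'I_n -> V) d P Q :
  (forall u (v : {fmonom 'I_n}), v \in msupp Q -> F (u ++ v) = word_ad u (H v)) ->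
  lin (graded F d) (P * Q)
  = \sum_(i < d.+1) ad_deg i P (lin (graded H (d - i)%N) Q).
Proof.
move=> FH; rewrite linM /ad_deg /lin [RHS]exchange_big /=; apply: eq_bigr => u _.
have [ud|du] := leqP (size u) d; last first.
  rewrite big1 => [|v _]; last by rewrite /graded size_cat gtn_eqF ?scaler0 // ltn_addr.
  rewrite big1 // => i _; rewrite /graded gtn_eqF ?scaler0 //.
  by apply: leq_trans du; rewrite ltn_ord.
rewrite (bigD1 (Ordinal (ud : size u < d.+1)%N)) //= [X in _ + X]big1 ?addr0; last first.
  by move=> i; rewrite -val_eqE /graded eq_sym /= => /negPf ->; rewrite scaler0.
rewrite {2}/graded eqxx -/(lin _ _) word_ad_lin /lin scaler_sumr.
apply: eq_big_seq => v vQ; rewrite scalerA; congr (_ *: _).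
rewrite /graded size_cat /= -(eqn_add2l (size u) (size v)) subnKC //.
by case: eqP => _; rewrite ?FH // word_ad0.
Qed.

Lemma ad_degD d P Q v : ad_deg d (P + Q) v = ad_deg d P v + ad_deg d Q v.
Proof. exact: linD. Qed.
Lemma ad_degB d P Q v : ad_deg d (P - Q) v = ad_deg d P v - ad_deg d Q v.
Proof. exact: linB. Qed.
Lemma ad_degZ d c P v : ad_deg d (c *: P) v = (ratr c : K) *: ad_deg d P v.
Proof. exact: linZ. Qed.
Lemma dynkin_degD d P Q : dynkin_deg d (P + Q) = dynkin_deg d P + dynkin_deg d Q.
Proof. exact: linD. Qed.
Lemma dynkin_degB d P Q : dynkin_deg d (P - Q) = dynkin_deg d P - dynkin_deg d Q.
Proof. exact: linB. Qed.
Lemma dynkin_degZ d c P : dynkin_deg d (c *: P) = (ratr c : K) *: dynkin_deg d P.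
Proof. exact: linZ. Qed.

Lemma ad_degM d P Q v :
  ad_deg d (P * Q) v = \sum_(i < d.+1) ad_deg i P (ad_deg (d - i)%N Q v).
Proof. by rewrite {1}/ad_deg (lin_gradedM (H := word_ad^~ v)) // => u w _; rewrite word_ad_cat. Qed.

Lemma dynkin_degM d P Q : Q@_(mone : {fmonom 'I_n}) = 0 ->
  dynkin_deg d (P * Q) = \sum_(i < d.+1) ad_deg i P (dynkin_deg (d - i)%N Q).
Proof.
move=> Q1; apply: lin_gradedM => u v vQ; apply: dynkin_word_cat.
by apply: contraL vQ => /eqP v0; rewrite -mcoeff_eq0 (_ : v = mone) ?Q1 //; apply/val_inj; rewrite /= v0 fm1.
Qed.

Lemma lie_assoc_const p : (lie_assoc p)@_(mone : {fmonom 'I_n}) = 0.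
Proof.
rewrite /lie_assoc; elim: p => [i||p IHp q IHq|c p IHp|p IHp q IHq] /=.
- rewrite /ncvar mcoeffU1; case: eqP => // /(congr1 (@fmonom_val _)).
  by rewrite fmuE fm1.
- exact: mcoeff0.
- by rewrite mcoeffD IHp IHq addr0.
- by rewrite mcoeffZ IHp mulr0.
- by rewrite mcoeffB !rmorphM /= IHp IHq mul0r subrr.
Qed.

Lemma brDr a b c : br a (b + c) = br a b + br a c. Proof. exact: linearDr. Qed.
Lemma brDl a b c : br (a + b) c = br a c + br b c. Proof. exact: linearDl. Qed.
Lemma brZr (k : K) a b : br a (k *: b) = k *: br a b. Proof. exact: linearZr_LR. Qed.
Lemma brZl (k : K) a b : br (k *: a) b = k *: br a b. Proof. exact: linearZl_LR. Qed.
Lemma br_suml J (r : seq J) (P : pred J) (F : J -> V) b :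
  br (\sum_(j <- r | P j) F j) b = \sum_(j <- r | P j) br (F j) b.
Proof. exact: (big_morph (br^~ b) (fun a c => brDl a c b) (linear0l _ b)). Qed.
Lemma br_sumr J (r : seq J) (P : pred J) (F : J -> V) b :
  br b (\sum_(j <- r | P j) F j) = \sum_(j <- r | P j) br b (F j).
Proof. exact: (big_morph (br b) (brDr b) (linear0r _ b)). Qed.

Lemma br_anti a b : br a b = - br b a.
Proof.
have [alt _] := br_lie; apply/eqP; rewrite -addr_eq0; apply/eqP.
by have := alt (a + b); rewrite brDl !brDr !alt add0r addr0.
Qed.

Lemma br_jacobi a b v : br (br a b) v = br a (br b v) - br b (br a v).
Proof.
have [_ jac] := br_lie; have := jac a b v.
have brNr c e : br c (- e) = - br c e by rewrite -scaleN1r brZr scaleN1r.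
rewrite (br_anti v a) (br_anti v (br a b)) brNr => /eqP.
by rewrite subr_eq0 => /eqP <-.
Qed.

Lemma eval_deg_0 p : eval_deg p 0 = 0.
Proof.
elim: p => [i||p IHp q IHq|c p IHp|p IHp q IHq] //=; first by rewrite IHp IHq addr0.
  by rewrite IHp scaler0.
by rewrite big_ord1 IHp linear0l.
Qed.

(** The adjoint action of the free Lie algebra extends to an action of the free
    associative algebra, by the Jacobi identity. *)
Lemma ad_deg_lie d p v : ad_deg d (lie_assoc p) v = br (eval_deg p d) v.
Proof.
rewrite /lie_assoc; elim: p d v => [i||p IHp q IHq|c p IHp|p IHp q IHq] d v /=.
- rewrite /ad_deg linU rmorph1 scale1r /graded fmuE /= eq_sym.
  by case: eqP; rewrite ?linear0l.
- by rewrite /ad_deg lin0 linear0l.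
- by rewrite ad_degD IHp IHq brDl.
- by rewrite ad_degZ ratr_rat IHp brZl.
- rewrite ad_degB !ad_degM br_suml.
  rewrite [X in _ - X](reindex_inj rev_ord_inj) -sumrB; apply: eq_bigr => i _ /=.
  have id : (i <= d)%N by rewrite -ltnS.
  rewrite subSS subKn //.
  by rewrite !IHp !IHq br_jacobi.
Qed.

(** The Dynkin-Specht-Wever identity, with values in an arbitrary Lie algebra. On
    a bracket of p and q, the right-normed bracketing is (ad p) applied to that
    of q, minus (ad q) applied to that of p; by induction these are deg q and
    deg p times the bracket, and the degrees add up. *)
Lemma dynkin_deg_lie d p : dynkin_deg d (lie_assoc p) = d%:R *: eval_deg p d.
Proof.
have h q := lie_assoc_const q; rewrite /lie_assoc in h *.
elim: p d => [i||p IHp q IHq|c p IHp|p IHp q IHq] d /=.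
- rewrite /dynkin_deg linU rmorph1 scale1r /graded fmuE /= eq_sym.
  by case: eqP => [->|]; rewrite ?scale1r ?scaler0.
- by rewrite /dynkin_deg lin0 scaler0.
- by rewrite dynkin_degD IHp IHq scalerDr.
- by rewrite dynkin_degZ ratr_rat IHp !scalerA mulrC.
- rewrite dynkin_degB !dynkin_degM ?h //.
  rewrite [X in _ - X](reindex_inj rev_ord_inj) -sumrB scaler_sumr.
  apply: eq_bigr => i _ /=; have id : (i <= d)%N by rewrite -ltnS.
  rewrite subSS subKn // !ad_deg_lie IHp IHq !brZr (br_anti (eval_deg q _)) scalerN opprK.
  by rewrite -scalerDl -natrD subnK.
Qed.

Lemma eval_degE p : exists N, forall M, (N <= M)%N ->
  lie_eval br x p = \sum_(d < M) eval_deg p d.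
Proof.
suff [N [h0 hE]] : exists N, (forall d, (N <= d)%N -> eval_deg p d = 0)
    /\ lie_eval br x p = \sum_(d < N) eval_deg p d.
  exists N => M NM; rewrite hE (big_ord_widen M (eval_deg p)) // big_mkcond.
  by apply: eq_bigr => d _; case: ltnP => // /h0.
have widen N M (F : nat -> V) : (N <= M)%N -> (forall d, (N <= d)%N -> F d = 0) ->
    \sum_(d < N) F d = \sum_(d < M) F d.
  move=> NM F0; rewrite (big_ord_widen M F) // big_mkcond.
  by apply: eq_bigr => d _; case: ltnP => // /F0.
elim: p => [i||p [N [hN EN]] q [M [hM EM]]|c p [N [hN EN]]|p [N [hN EN]] q [M [hM EM]]] /=.
- exists 2; split=> [d|]; first by case: d => [|[]].
  by rewrite !big_ord_recl big_ord0 /= add0r addr0.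
- by exists 0; split=> //; rewrite big_ord0.
- exists (maxn N M); split=> [d|].
    by rewrite geq_max => /andP[/hN -> /hM ->]; rewrite addr0.
  rewrite EN EM (widen N (maxn N M)) ?leq_maxl // (widen M (maxn N M)) ?leq_maxr //.
  by rewrite -big_split.
- by exists N; split=> [d /hN ->|]; rewrite ?scaler0 // EN scaler_sumr.
- have h0 i j : (N + M <= i + j)%N -> br (eval_deg p i) (eval_deg q j) = 0.
    move=> ij; have [iN|/hN ->] := ltnP i N; last exact: linear0l.
    rewrite [eval_deg q j]hM ?linear0r // -(leq_add2l N) (leq_trans ij) //.
    by rewrite leq_add2r ltnW.
  exists (N + M)%N; split=> [d hd|].
    by rewrite big1 // => i _; apply: h0; rewrite subnKC // -ltnS.
  rewrite (triangle_sum (F := fun i j => br (eval_deg p i) (eval_deg q j)) h0).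
  rewrite EN EM (widen N (N + M)%N) ?leq_addr // (widen M (N + M)%N) ?leq_addl //.
  by rewrite br_suml; apply: eq_bigr => i _; rewrite br_sumr.
Qed.

(** Dynkin's identity recovers the part of positive degree d of the value from
    the associative polynomial, up to the invertible factor d; no part of degree
    zero occurs. *)
Lemma lie_eval_assoc p q : lie_assoc p = lie_assoc q -> lie_eval br x p = lie_eval br x q.
Proof.
move=> pq; have [N hN] := eval_degE p; have [M hM] := eval_degE q.
rewrite (hN (maxn N M)) ?leq_maxl // (hM (maxn N M)) ?leq_maxr //.
apply: eq_bigr => -[[|d] _] _ /=; first by rewrite !eval_deg_0.
have /scalerI : (d.+1%:R : K) != 0 by rewrite pnatr_eq0.
by apply; rewrite -!dynkin_deg_lie pq.
Qed.

Lemma lie_eval_homogeneous p d : nc_homogeneous d (lie_assoc p) ->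
  lie_eval br x p = (d%:R : K)^-1 *: lin dynkin_word (lie_assoc p).
Proof.
move=> hp; have [N hN] := eval_degE p.
have dynE e : dynkin_deg e (lie_assoc p) = if e == d then lin dynkin_word (lie_assoc p) else 0.
  rewrite /dynkin_deg /lin; case: eqP => [->|/eqP ed].
    apply: eq_big_seq => w; rewrite -mcoeff_neq0 => /hp wd.
    by rewrite /graded wd eqxx.
  rewrite big1_seq // => w /andP[_]; rewrite -mcoeff_neq0 => /hp wd.
  by rewrite /graded wd eq_sym (negPf ed) scaler0.
have evE e : eval_deg p e = (e%:R : K)^-1 *: dynkin_deg e (lie_assoc p).
  case: e => [|e]; first by rewrite eval_deg_0 invr0 scale0r.
  by rewrite dynkin_deg_lie scalerA mulVf ?scale1r // pnatr_eq0.
rewrite (hN (maxn N d.+1)) ?leq_maxl //.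
rewrite (bigD1 (Ordinal (leq_maxr N d.+1))) //= evE dynE eqxx big1 ?addr0 // => e.
by rewrite -val_eqE evE dynE /= => /negPf ->; rewrite scaler0.
Qed.
End Dynkin.

(** * Multilinear parts of noncommutative polynomials *)

Lemma malg_scaleAr (K : monomType) (R : comNzRingType) (c : R) (P Q : {malg R[K]}) :
  c *: (P * Q) = P * (c *: Q).
Proof.
apply/malgP => k; rewrite mcoeffZ mcoeffMl.
rewrite (mcoeffMlw (d1 := msupp P) (d2 := msupp Q)) ?fsubset_refl ?msuppZ_le //.
rewrite mulr_sumr; apply: eq_bigr => u _; rewrite mulr_sumr; apply: eq_bigr => v _.
by rewrite mcoeffZ mulrnAr mulrCA.
Qed.

HB.instance Definition _ (n : nat) := GRing.Lalgebra.on (ncpoly n).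
HB.instance Definition _ (n : nat) :=
  GRing.Lalgebra_isAlgebra.Build rat (ncpoly n) (@malg_scaleAr _ _).

Section MultilinearParts.
Variable n : nat.
Notation sps := (sps 'I_n (ncpoly n)).
Implicit Types (P Q : ncpoly n) (S T : {set 'I_n}) (w u v : seq 'I_n).

Lemma perm_enumE S w : perm_eq w (enum S) = uniq w && ([set i in w] == S).
Proof.
apply/idP/andP => [h|[uw /eqP <-]].
  split; first by rewrite (perm_uniq h) enum_uniq.
  by apply/eqP/setP => i; rewrite inE (perm_mem h) mem_enum.
by apply: uniq_perm; rewrite ?enum_uniq // => i; rewrite mem_enum inE.
Qed.

Definition multilinear_word w : sps :=
  [ffun S : {set 'I_n} => if perm_eq w (enum S) then << FMonom w >> else 0].

(** At S stands the part of the polynomial in which each letter of S, and no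
    other letter, occurs exactly once. *)
Definition mlpart P : sps := lin (K := rat) multilinear_word P.

(** In a product over decompositions of S only one term survives, since the
    prefix [u] determines its set of letters. *)
Lemma multilinear_word_cat u v :
  multilinear_word (u ++ v) = multilinear_word u * multilinear_word v.
Proof.
apply/ffunP => S; rewrite ffunE spsM.
rewrite perm_enumE cat_uniq (_ : [set i in u ++ v] = [set i in u] :|: [set i in v]); last first.
  by apply/setP => i; rewrite !inE mem_cat.
transitivity (\sum_(T : {set 'I_n} | T \subset S)
   if [&& uniq u, [set i in u] == T, uniq v & [set i in v] == S :\: T]
   then << FMonom (u ++ v) >> else 0 : ncpoly n); last first.
  apply: eq_bigr => T _; rewrite !ffunE !perm_enumE.
  case: (uniq u) => /=; rewrite ?mul0r //; case: (_ == T); rewrite ?mul0r //=.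
  case: (_ && _); rewrite ?mulr0 // malgM_def fgmulUU mulr1.
  by rewrite /mmul /= /fmmul unlock.
have [uS|uS] := boolP ([set i in u] \subset S); last first.
  rewrite big1 => [|T TS]; last first.
    by rewrite ifF //; apply: contraNF uS => /and4P[_ /eqP -> _ _].
  rewrite ifF //; apply: contraNF uS => /andP[_ /eqP <-]; exact: subsetUl.
rewrite (bigD1 [set i in u]) //= eqxx [X in _ + X]big1 ?addr0; last first.
  by move=> T /andP[_ nT]; rewrite eq_sym (negPf nT) andbF.
congr (if _ then _ else _); rewrite -!andbA; case: (uniq u) => //=.
apply/and3P/andP => [[d uv /eqP <-]|[uv /eqP E]].
  split=> //; apply/eqP/setP => i; rewrite !inE.
  have [iu|//] := boolP (i \in u); apply/negbTE/negP => iv.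
  by case/hasP: d; exists i.
split=> //; last first.
  by rewrite E; apply/eqP/setP => i; rewrite inE; move/subsetP: uS => /(_ i);
    rewrite !inE; case: (i \in u) => //= ->.
apply/hasPn => i iv; apply/negP => iu.
by have := in_setD; move/setP/(_ i): E; rewrite !inE iv iu.
Qed.

Lemma mlpartM P Q : mlpart (P * Q) = mlpart P * mlpart Q.
Proof.
rewrite /mlpart linM /lin mulr_suml; apply: eq_bigr => u _.
rewrite mulr_sumr; apply: eq_bigr => v _.
by rewrite multilinear_word_cat -scalerAl -scalerAr scalerA.
Qed.

Lemma mlpartZ c P : mlpart (c *: P) = c *: mlpart P.
Proof. by rewrite /mlpart linZ ratr_rat. Qed.

Lemma mlpart0 : mlpart 0 = 0. Proof. exact: lin0. Qed.

Lemma mlpart_sum J (r : seq J) (p : pred J) (f : J -> ncpoly n) :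
  mlpart (\sum_(j <- r | p j) f j) = \sum_(j <- r | p j) mlpart (f j).
Proof. exact: lin_sum. Qed.

Lemma mlpart1 : mlpart 1 = 1.
Proof.
rewrite /mlpart linU rmorph1 scale1r fm1; apply/ffunP => S; rewrite ffunE sps1.
rewrite perm_enumE /= (_ : [set i in [::]] = set0); last by apply/setP => i; rewrite !inE.
rewrite eq_sym; case: eqP => // _ /=.
by have -> : FMonom [::] = mone :> {fmonom 'I_n} by apply/val_inj; rewrite /= fm1.
Qed.

Lemma mlpartX P k : mlpart (P ^+ k) = mlpart P ^+ k.
Proof. by elim: k => [|k IH]; rewrite ?expr0 ?mlpart1 // !exprS mlpartM IH. Qed.

Lemma mlpart_coef P S (w : {fmonom 'I_n}) :
  (mlpart P S)@_w = if perm_eq w (enum S) then P@_w else 0.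
Proof.
rewrite /mlpart /lin sps_sum raddf_sum /=.
under eq_bigr => u _ do rewrite ratr_rat spsZ mcoeffZ ffunE.
transitivity (\sum_(u <- msupp P) (P@_u *+ (u == w) *+ perm_eq w (enum S))).
  apply: eq_bigr => u _; case: ifP => h; rewrite ?mcoeffU1 ?mcoeff0.
    rewrite (_ : FMonom u = u); last exact/val_inj.
    by case: eqP => [<-|_]; rewrite ?h ?mulr1 // mulr0 mul0rn.
  by rewrite mulr0; case: eqP => [<-|_]; rewrite ?h // mulr0n mul0rn.
rewrite sumrMnl; have -> : \sum_(u <- msupp P) P@_u *+ (u == w) = P@_w.
  by rewrite [in RHS](monalgE P) raddf_sum; apply: eq_bigr => u _ /=; rewrite mcoeffU.
by case: perm_eq.
Qed.

Lemma mlpart_homogeneous d P S : nc_homogeneous d P -> #|S| != d -> mlpart P S = 0.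
Proof.
move=> hP Sd; apply/malgP => w; rewrite mlpart_coef mcoeff0; case: ifP => // h.
apply/eqP; apply: contraNT Sd => /hP <-.
by rewrite (perm_size h) cardE.
Qed.

Lemma mlpart_order_ge d P : nc_homogeneous d P -> order_ge d (mlpart P).
Proof. by move=> hP S Sd; apply: (mlpart_homogeneous hP); rewrite ltn_eqF. Qed.
End MultilinearParts.

Lemma sum_dvdn (V : nmodType) (F : nat -> V) n m : (0 < m)%N ->
  (forall k, (n < k * m)%N -> F k = 0) ->
  \sum_(d < n.+1 | (m %| d)%N) F (d %/ m)%N = \sum_(k < n.+1) F k.
Proof.
move=> m0 F0.
rewrite -(big_mkord (fun d => m %| d)%N (fun d => F (d %/ m)%N)) -(big_mkord xpredT F).
transitivity (\sum_(i <- [seq i <- iota 0 n.+1 | (i * m <= n)%N]) F i); last first.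
  rewrite big_filter big_mkcond /index_iota subn0; apply: eq_bigr => i _.
  by case: leqP => // /F0.
rewrite -big_filter.
rewrite (perm_big [seq (i * m)%N | i <- [seq i <- iota 0 n.+1 | (i * m <= n)%N]]).
  by rewrite big_map; apply: eq_bigr => i _; rewrite mulnK.
apply: uniq_perm; first by rewrite filter_uniq ?iota_uniq.
  rewrite map_inj_uniq ?filter_uniq ?iota_uniq // => i j /eqP.
  by rewrite eqn_pmul2r // => /eqP.
move=> d; rewrite mem_filter mem_index_iota leq0n andTb.
apply/andP/mapP => [[md dn]|[i]].
  exists (d %/ m)%N; last by rewrite divnK.
  rewrite mem_filter divnK // mem_iota leq0n add0n -ltnS dn andTb.
  by apply: leq_ltn_trans dn; apply: leq_div.
by rewrite mem_filter => /andP[im _] ->; rewrite dvdn_mull.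
Qed.

Section Homogeneous.
Variable n : nat.
Notation sps := (sps 'I_n (ncpoly n)).
Implicit Types (P Q : ncpoly n).

Lemma hom0 d : nc_homogeneous d (0 : ncpoly n).
Proof. by move=> w; rewrite mcoeff0 eqxx. Qed.

Lemma hom1 : nc_homogeneous 0 (1 : ncpoly n).
Proof. by move=> w; rewrite mcoeff1; case: (w =P mone) => [->|]; [rewrite fm1 | rewrite eqxx]. Qed.

Lemma hom_var (i : 'I_n) : nc_homogeneous 1 (ncvar i).
Proof. by move=> w; rewrite mcoeffU1; case: (_ =P w) => [<-|]; [rewrite fmuE | rewrite eqxx]. Qed.

Lemma homD d P Q : nc_homogeneous d P -> nc_homogeneous d Q -> nc_homogeneous d (P + Q).
Proof.
move=> hP hQ w; rewrite mcoeffD; have [P0|/hP //] := eqVneq P@_w 0.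
by rewrite P0 add0r => /hQ.
Qed.

Lemma homZ d c P : nc_homogeneous d P -> nc_homogeneous d (c *: P).
Proof. by move=> hP w; rewrite mcoeffZ mulf_eq0 negb_or => /andP[_ /hP]. Qed.

Lemma hom_sum d J (r : seq J) (p : pred J) (f : J -> ncpoly n) :
  (forall j, p j -> nc_homogeneous d (f j)) ->
  nc_homogeneous d (\sum_(j <- r | p j) f j).
Proof. by move=> h; elim/big_ind: _ => //; [exact: hom0 | move=> *; exact: homD]. Qed.

Lemma homM d e P Q : nc_homogeneous d P -> nc_homogeneous e Q ->
  nc_homogeneous (d + e) (P * Q).
Proof.
move=> hP hQ w; rewrite mcoeff_neq0 => /msuppM_le [u [v [uP vQ ->]]].
rewrite /mmul /= /fmmul unlock /= size_cat.
by rewrite hP ?hQ // mcoeff_neq0.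
Qed.

Lemma homX d k P : nc_homogeneous d P -> nc_homogeneous (k * d) (P ^+ k).
Proof.
by move=> hP; elim: k => [|k IH]; rewrite ?expr0 ?exprS; [exact: hom1 | exact: homM].
Qed.

Definition fps_homogeneous (a : fps n) := forall d, nc_homogeneous d (a d).

Lemma fps_one_hom : fps_homogeneous (@fps_one n).
Proof. by case=> [|d]; [exact: hom1 | exact: hom0]. Qed.

Lemma fps_mul_hom a b : fps_homogeneous a -> fps_homogeneous b ->
  fps_homogeneous (fps_mul a b).
Proof.
move=> ha hb d; apply: hom_sum => i _; have id : (i <= d)%N by rewrite -ltnS.
by rewrite -[X in nc_homogeneous X](subnKC id); apply: homM.
Qed.

Lemma fps_exp_hom m P : nc_homogeneous m P -> fps_homogeneous (fps_exp m P).
Proof.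
move=> hP d; rewrite /fps_exp; case: ifP => [md|_]; last exact: hom0.
by apply: homZ; rewrite -[X in nc_homogeneous X](divnK md); apply: homX.
Qed.

Lemma fps_prod_hom J (r : seq J) (f : J -> fps n) :
  (forall j, fps_homogeneous (f j)) ->
  fps_homogeneous (\big[@fps_mul n/@fps_one n]_(j <- r) f j).
Proof.
move=> h; elim/big_ind: _ => //; [exact: fps_one_hom | exact: fps_mul_hom].
Qed.

(** The multilinear parts of a power series in T. The powers of T are dropped:
    for homogeneous series they can be read off from the number of letters. *)
Definition fps_mlpart (a : fps n) : sps := \sum_(d < n.+1) mlpart (a d).

Lemma fps_mlpart1 : fps_mlpart (@fps_one n) = 1.
Proof.
rewrite /fps_mlpart big_ord_recl big1 /= ?addr0; first exact: mlpart1.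
by move=> i _; exact: mlpart0.
Qed.

Lemma fps_mlpartM a b : fps_homogeneous a -> fps_homogeneous b ->
  fps_mlpart (fps_mul a b) = fps_mlpart a * fps_mlpart b.
Proof.
move=> ha hb; rewrite /fps_mlpart /fps_mul.
transitivity (\sum_(d < n.+1) \sum_(i < d.+1) mlpart (a i) * mlpart (b (d - i)%N)).
  by apply: eq_bigr => d _; rewrite mlpart_sum; apply: eq_bigr => i _; rewrite mlpartM.
rewrite (triangle_sum (F := fun i j => mlpart (a i) * mlpart (b j))); last first.
  move=> i j hij; apply: (@order_ge_max _ _ (i + j)); first by rewrite card_ord.
  by apply: order_geM; apply: mlpart_order_ge.
by rewrite mulr_suml; apply: eq_bigr => i _; rewrite mulr_sumr.
Qed.

Lemma fps_mlpart_prod J (r : seq J) (f : J -> fps n) :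
  (forall j, fps_homogeneous (f j)) ->
  fps_mlpart (\big[@fps_mul n/@fps_one n]_(j <- r) f j) = \prod_(j <- r) fps_mlpart (f j).
Proof.
move=> h; elim: r => [|j r IH]; first by rewrite !big_nil fps_mlpart1.
by rewrite !big_cons fps_mlpartM ?IH //; apply: fps_prod_hom.
Qed.

Lemma fps_mlpart_exp m P : (0 < m)%N -> nc_homogeneous m P ->
  fps_mlpart (fps_exp m P) = sps_exp (mlpart P).
Proof.
move=> m0 hP; pose F k := dpow k (mlpart P).
have F0 k : (n < k * m)%N -> F k = 0.
  move=> nk; apply: (@order_ge_max _ _ (k * m)); first by rewrite card_ord.
  apply: order_geZ; rewrite -mlpartX; apply: mlpart_order_ge; exact: homX.
rewrite /sps_exp card_ord -(sum_dvdn m0 F0) big_mkcond; apply: eq_bigr => d _.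
by rewrite /fps_exp; case: ifP; rewrite ?mlpart0 // mlpartZ mlpartX.
Qed.
End Homogeneous.

Section Restriction.
Variables (I : finType) (A : algType rat).
Notation sps := (sps I A).
Implicit Types (a b : sps) (S T : {set I}).

(** Setting the variables outside [T] to zero. *)
Definition restr T a : sps := [ffun S : {set I} => if S \subset T then a S else 0].

Lemma restrE T a S : restr T a S = if S \subset T then a S else 0.
Proof. by rewrite ffunE. Qed.

Lemma restr1 T : restr T 1 = 1.
Proof.
apply/ffunP => S; rewrite restrE sps1; case: eqP => [->|_]; first by rewrite sub0set.
by rewrite if_same.
Qed.

Lemma restrD T a b : restr T (a + b) = restr T a + restr T b.
Proof. by apply/ffunP => S; rewrite spsD !restrE spsD; case: ifP; rewrite ?addr0. Qed.

Lemma restr0 T : restr T 0 = 0.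
Proof. by apply/ffunP => S; rewrite restrE sps0 if_same. Qed.

Lemma restrZ T c a : restr T (c *: a) = c *: restr T a.
Proof. by apply/ffunP => S; rewrite spsZ !restrE spsZ; case: ifP; rewrite ?scaler0. Qed.

Lemma restrM T a b : restr T (a * b) = restr T a * restr T b.
Proof.
apply/ffunP => S; rewrite restrE !spsM; case: ifP => [ST|/negbT ST].
  apply: eq_bigr => U US; rewrite !restrE (subset_trans US ST).
  by rewrite (subset_trans (subsetDl _ _) ST).
rewrite big1 // => U US; rewrite !restrE.
case: ifP => UT; rewrite ?mul0r //; case: ifP => DT; rewrite ?mulr0 //.
by move: ST; rewrite -(setID S U) subUset DT (subset_trans (subsetIr _ _) UT).
Qed.

Lemma restr_prod T J (r : seq J) (F : J -> sps) :
  restr T (\prod_(j <- r) F j) = \prod_(j <- r) restr T (F j).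
Proof. exact: (big_morph _ (restrM T) (restr1 T)). Qed.

Lemma restrX T a k : restr T (a ^+ k) = restr T a ^+ k.
Proof. by elim: k => [|k IH]; rewrite ?expr0 ?restr1 // !exprS restrM IH. Qed.

Lemma restr_sps_exp T a : restr T (sps_exp a) = sps_exp (restr T a).
Proof.
rewrite /sps_exp (big_morph _ (restrD T) (restr0 T)); apply: eq_bigr => k _.
by rewrite /dpow restrZ restrX.
Qed.

Lemma restr_order_ge T m a : order_ge m a -> order_ge m (restr T a).
Proof. by move=> ha S hS; rewrite restrE ha // if_same. Qed.

Lemma sps_exp_divisible k a : divisible k a -> sps_exp a = 1 + a.
Proof.
move=> ha; have o0 : order_ge 1 (0 : sps) by move=> S _; rewrite sps0.
have aa b : a * b * a = 0 by apply: (@divisible_mul0 _ _ k) => //; apply: divisibleMr.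
have := sps_exp_first o0 (divisible_order_ge1 ha) aa; rewrite add0r sps_exp0 mulr1 => ->.
congr (1 + _); rewrite /Psi big_ord_recl /= /psipow invr1 scale1r big1 ?addr0 // => i _.
have l0 b : lbr 0 b = 0 by rewrite /lbr mul0r mulr0 subrr.
by rewrite /= l0 scaler0.
Qed.
End Restriction.

(** * The factorization, one variable at a time *)

Section Recursion.
Variables (kd : wilcox_kind) (n : nat) (L : nat -> ncpoly n).
Hypothesis L_hom : forall m, (0 < m)%N -> nc_homogeneous m (L m).
Hypothesis L_wilcox : wilcox_factorization kd L.
Notation sps := (sps 'I_n (ncpoly n)).

Definition wilcox_ml d : sps := mlpart (L d).
Definition ml_var (i : 'I_n) : sps := mlpart (ncvar i).

(** The degrees of the factors in the right half of the product, from the centre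
    outwards. *)
Definition right_degrees M : seq nat :=
  if kd is Inward then rev (iota 1 M) else iota 1 M.

Lemma right_degrees_gt0 M d : d \in right_degrees M -> (0 < d)%N.
Proof.
by rewrite /right_degrees; case: kd; rewrite ?mem_rev mem_iota => /andP[].
Qed.

Lemma right_degrees_perm M : perm_eq (right_degrees M) (iota 1 M).
Proof. by rewrite /right_degrees; case: kd; rewrite ?perm_rev perm_refl. Qed.

Lemma half_hom d : (0 < d)%N -> nc_homogeneous d (2^-1 *: L d).
Proof. by move=> d0; apply: homZ; apply: L_hom. Qed.

Lemma wilcox_ml_order_ge d : (0 < d)%N -> order_ge 1 (wilcox_ml d).
Proof. by move=> d0; apply: order_ge_leq (d0) _; apply: mlpart_order_ge; apply: L_hom. Qed.

Lemma wilcox_ml_supp d (S : {set 'I_n}) : (0 < d)%N -> #|S| != d -> wilcox_ml d S = 0.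
Proof. by move=> d0; apply: mlpart_homogeneous; apply: L_hom. Qed.

Lemma ml_var_divisible i : divisible i (ml_var i).
Proof.
move=> S iS; rewrite /ml_var /mlpart linU rmorph1 scale1r fmuE ffunE ifF //.
by rewrite perm_enumE; apply: contraNF iS => /andP[_ /eqP <-]; rewrite inE mem_head.
Qed.

Lemma ml_varE i (S : {set 'I_n}) : ml_var i S = if S == [set i] then ncvar i else 0.
Proof.
rewrite /ml_var /mlpart linU rmorph1 scale1r fmuE ffunE perm_enumE /= eq_sym.
rewrite (_ : [set j in [:: i]] = [set i]); last by apply/setP => j; rewrite !inE.
by rewrite /ncvar fmuE.
Qed.

Lemma prod_hom (r : seq nat) : all (leq 1) r ->
  fps_homogeneous (\big[@fps_mul n/@fps_one n]_(m <- r) fps_exp m (2^-1 *: L m)).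
Proof.
elim: r => [|m r IH] /=; first by rewrite big_nil => _; exact: fps_one_hom.
case/andP=> m0 hr; rewrite big_cons; apply: fps_mul_hom; last exact: IH.
by apply: fps_exp_hom; apply: half_hom.
Qed.

Lemma prod_mlpart (r : seq nat) : all (leq 1) r ->
  fps_mlpart (\big[@fps_mul n/@fps_one n]_(m <- r) fps_exp m (2^-1 *: L m))
  = \prod_(m <- r) sps_exp (2^-1 *: wilcox_ml m).
Proof.
elim: r => [|m r IH] /=; first by rewrite !big_nil fps_mlpart1.
case/andP=> m0 hr; have hm := half_hom m0.
have E := fps_mlpart_exp m0 hm; rewrite mlpartZ in E.
rewrite big_cons [RHS]big_cons -(IH hr) -E.
apply: fps_mlpartM; first exact: fps_exp_hom.
exact: prod_hom.
Qed.

(** Up to degree [n] the infinite product is reached by a partial product. A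
    variable occurs at most once, so that its exponential becomes 1 + X_i. *)
Lemma wilcox_mlpart : exists2 M, (n <= M)%N &
  (\prod_(d <- rev (right_degrees M)) sps_exp (2^-1 *: wilcox_ml d)) *
  (\prod_(d <- right_degrees M) sps_exp (2^-1 *: wilcox_ml d))
  = \prod_(i < n) (1 + ml_var i).
Proof.
have [M nM hM] : exists2 M, (n <= M)%N &
    forall d, (d < n.+1)%N -> wilcox_partial kd L M d = exp_prod n d.
  have [M h] : exists M, forall N, (M <= N)%N ->
      forall d, (d < n.+1)%N -> wilcox_partial kd L N d = exp_prod n d.
    elim: n.+1 => [|m [M hM]]; first by exists 0.
    have [M' _ hM'] := L_wilcox m; exists (maxn M M') => N.
    rewrite geq_max => /andP[MN M'N] d; rewrite ltnS leq_eqVlt => /predU1P[->|dm].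
      exact: hM'.
    exact: hM.
  by exists (maxn n M); [exact: leq_maxl | apply: h; exact: leq_maxr].
exists M => //.
have hi : all (leq 1) (iota 1 M) by apply/allP => d; rewrite mem_iota => /andP[].
have hr : all (leq 1) (rev (iota 1 M)) by rewrite all_rev.
transitivity (fps_mlpart (wilcox_partial kd L M)).
  rewrite /wilcox_partial /right_degrees /increasing_half /decreasing_half.
  by case: kd; rewrite ?revK fps_mlpartM ?prod_mlpart //; apply: prod_hom.
transitivity (fps_mlpart (exp_prod n)).
  by apply: eq_bigr => d _; rewrite hM.
rewrite /exp_prod fps_mlpart_prod; last by move=> i; apply: fps_exp_hom; apply: hom_var.
apply: eq_bigr => i _; rewrite fps_mlpart_exp //; last exact: hom_var.
exact: sps_exp_divisible (@ml_var_divisible i).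
Qed.

Section Step.
Variable k : 'I_n.

Definition vars_before : {set 'I_n} := [set i : 'I_n | (i < k)%N].

(** Adjoining the variable [k] to those before it changes the multilinear part of
    the exponent of degree [d] from [ml_old] by [ml_new]. *)
Definition ml_old d : sps := restr vars_before (wilcox_ml d).
Definition ml_new d : sps := restr (k |: vars_before) (wilcox_ml d) - ml_old d.

Lemma ml_new_divisible d : divisible k (ml_new d).
Proof.
move=> S kS; rewrite /ml_new spsD spsN !restrE.
suff -> : (S \subset k |: vars_before) = (S \subset vars_before) by rewrite subrr.
apply/idP/idP => [/subsetP h|h]; last exact: subset_trans h (subsetUr _ _).
by apply/subsetP => i iS; have := h i iS; rewrite in_setU1 => /predU1P[ik|//]; rewrite -ik iS in kS.
Qed.

Definition step_pairs M := [seq (2^-1 *: ml_old d, 2^-1 *: ml_new d) | d <- right_degrees M].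

Lemma step_pairs_perturbation M : is_perturbation k (step_pairs M).
Proof.
move=> _ /mapP[d /right_degrees_gt0 d0 ->] /=; split.
  by apply: order_geZ; apply: restr_order_ge; apply: wilcox_ml_order_ge.
by apply: divisibleZ; apply: ml_new_divisible.
Qed.

Lemma restr_vars (T : {set 'I_n}) i : restr T (1 + ml_var i) = if i \in T then 1 + ml_var i else 1.
Proof.
rewrite restrD restr1; have -> : restr T (ml_var i) = if i \in T then ml_var i else 0.
  apply/ffunP => S; rewrite restrE; have [iT|iT] := boolP (i \in T).
    rewrite ml_varE; case: (S =P [set i]) => [->|_]; last by rewrite if_same.
    by rewrite sub1set iT.
  rewrite sps0; case: ifP => // ST; apply: ml_var_divisible.
  by apply: contra iT; apply: (subsetP ST).
by case: ifP => _; rewrite ?addr0.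
Qed.

(** Adjoining the variable [k] perturbs the exponents, and multiplies the product
    of exponentials on the right by the factor 1 + X_k; [symmetric_log_deriv]
    converts this into an equation for the perturbations. *)
Lemma wilcox_step : exists2 M, (n <= M)%N &
  \sum_(m < n.+1) (1 + (-1) ^+ m : rat) *: log_deriv (step_pairs M) m
  = \sum_(m < n.+1) conj_right (step_pairs M) m (ml_var k).
Proof.
have [M nM E] := wilcox_mlpart; exists M => //.
have resE (T : {set 'I_n}) (f : nat -> sps) : (forall d, f d = restr T (wilcox_ml d)) ->
   (\prod_(d <- rev (right_degrees M)) sps_exp (2^-1 *: f d)) *
   (\prod_(d <- right_degrees M) sps_exp (2^-1 *: f d))
   = \prod_(i < n) (if i \in T then 1 + ml_var i else 1).
  move=> fE; transitivity (restr T (\prod_(i < n) (1 + ml_var i))); last first.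
    by rewrite restr_prod; apply: eq_bigr => i _; apply: restr_vars.
  rewrite -E restrM !restr_prod.
  by congr (_ * _); apply: eq_bigr => d _; rewrite restr_sps_exp restrZ fE.
have := @symmetric_log_deriv _ _ k (step_pairs M) (ml_var k) (@step_pairs_perturbation M)
  (@ml_var_divisible k).
rewrite card_ord; apply.
have mapE (F : sps * sps -> sps) (r : seq nat) :
    \prod_(p <- [seq (2^-1 *: ml_old d, 2^-1 *: ml_new d) | d <- r]) F p
    = \prod_(d <- r) F (2^-1 *: ml_old d, 2^-1 *: ml_new d) by rewrite big_map.
have E1 : exp_left (step_pairs M) * exp_right (step_pairs M)
        = \prod_(i < n) (if i \in vars_before then 1 + ml_var i else 1).
  apply: (etrans _ (resE vars_before ml_old (fun=> erefl _))); congr (_ * _).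
    rewrite /exp_left /step_pairs -map_rev; exact: (mapE (fun p => sps_exp p.1)).
  exact: (mapE (fun p => sps_exp p.1)).
have E2 : exp_left_pert (step_pairs M) * exp_right_pert (step_pairs M)
        = \prod_(i < n) (if i \in k |: vars_before then 1 + ml_var i else 1).
  have newE d : ml_old d + ml_new d = restr (k |: vars_before) (wilcox_ml d).
    by rewrite /ml_new addrC subrK.
  apply: (etrans _ (resE (k |: vars_before) _ newE)); congr (_ * _).
    rewrite /exp_left_pert /step_pairs -map_rev.
    apply: (etrans (mapE (fun p => sps_exp (p.1 + p.2)) _)).
    apply: eq_bigr => d _; congr (sps_exp _); exact/esym/scalerDr.
  apply: (etrans (mapE (fun p => sps_exp (p.1 + p.2)) _)).
  apply: eq_bigr => d _; congr (sps_exp _); exact/esym/scalerDr.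
apply: (etrans E2); apply: (etrans _ (congr1 (fun u => u * (1 + ml_var k)) (esym E1))).
pose F i := if insub i is Some j then 1 + ml_var j else 1.
have FK (i : 'I_n) : F i = 1 + ml_var i by rewrite /F -[nat_of_ord i]/(val i) valK.
have FE m (T : {set 'I_n}) : (m <= n)%N -> (forall i : 'I_n, (i \in T) = (i < m)%N) ->
    \prod_(i < n) (if i \in T then 1 + ml_var i else 1) = \prod_(i < m) F i.
  move=> mn hT; rewrite (big_ord_widen n F mn) [RHS]big_mkcond; apply: eq_bigr => i _.
  by rewrite hT FK.
have newP i : (i \in k |: vars_before) = (i < k.+1)%N.
  by rewrite in_setU1 [i \in vars_before]inE ltnS [RHS]leq_eqVlt -val_eqE.
have oldP i : (i \in vars_before) = (i < k)%N by rewrite inE.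
apply: (etrans (FE k.+1 _ (ltn_ord k) newP)).
apply: (etrans _ (congr1 (fun u => u * (1 + ml_var k)) (esym (FE k _ (ltnW (ltn_ord k)) oldP)))).
by rewrite big_ord_recr /= FK.
Qed.
End Step.
End Recursion.

(** * Bounds for the multilinear parts *)

Lemma sum_subsets (I : finType) (V : nmodType) (S : {set I}) (F : nat -> V) :
  \sum_(U : {set I} | U \subset S) F #|U| = \sum_(j < #|S|.+1) F j *+ 'C(#|S|, j).
Proof.
rewrite (partition_big (fun U : {set I} => inord #|U| : 'I_#|S|.+1) xpredT) //=.
apply: eq_bigr => j _.
rewrite (eq_bigr (fun=> F j)); last first.
  move=> U /andP[US /eqP <-]; rewrite inordK // ltnS; exact: subset_leq_card.
rewrite sumr_const -(cards_draws S j); congr (_ *+ _).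
apply: eq_card => U; rewrite !inE; apply: andb_id2l => US.
rewrite -val_eqE /= inordK // ltnS; exact: subset_leq_card.
Qed.

(** A convolution over decompositions of S is a product of exponential generating
    functions. *)
Lemma sum_subsets_fact (I : finType) (S : {set I}) (p q : {poly rat}) :
  \sum_(U : {set I} | U \subset S)
    ((#|U|)`!%:R * p`_#|U|) * ((#|S :\: U|)`!%:R * q`_#|S :\: U|)
  = (#|S|)`!%:R * (p * q)`_#|S|.
Proof.
pose F j : rat := (j`!%:R * p`_j) * ((#|S| - j)`!%:R * q`_(#|S| - j)).
rewrite (eq_bigr (fun U : {set I} => F #|U|)); last first.
  by move=> U US; rewrite /F cardsD (setIidPr US).
rewrite sum_subsets coefM mulr_sumr; apply: eq_bigr => j _.
have jS : (j <= #|S|)%N by rewrite -ltnS.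
by rewrite /F -mulr_natr -(bin_fact jS) !natrM; ring.
Qed.

Section Component.
Variables (I : finType) (A : algType rat) (k : I).
Implicit Types (z w : sps I A) (S : {set I}).

Definition avoids z := forall S, k \in S -> z S = 0.

(** Of the two sets in a decomposition of k |: S exactly one contains [k], and it
    belongs to the factor [w]. *)
Lemma lbr_component z w S : k \notin S -> avoids z -> divisible k w ->
  lbr z w (k |: S) = \sum_(U : {set I} | U \subset S)
    (z U * w (k |: (S :\: U)) - w (k |: (S :\: U)) * z U).
Proof.
move=> kS hz hw; rewrite sumrB.
transitivity ((z * w) (k |: S) - (w * z) (k |: S)); first by rewrite /lbr spsD spsN.
congr (_ - _); [apply: (etrans (spsM z w _)) | apply: (etrans (spsM w z _))].
  rewrite [LHS](bigID (fun T : {set I} => k \in T)) /= big1 ?add0r; last first.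
    by move=> T /andP[_ kT]; rewrite hz ?mul0r.
  apply: eq_big => [U|U US].
    apply/andP/idP => [[/subsetP US kU]|US].
      by apply/subsetP => i iU; have := US i iU; rewrite in_setU1 => /predU1P[ik|//];
        rewrite -ik iU in kU.
    by split; [apply: subset_trans US (subsetUr _ _) | apply: contra kS; apply: subsetP].
  congr (_ * w _); rewrite setDUl; congr (_ :|: _); apply/setP => i; rewrite !inE.
  by case: eqP => [->|]; rewrite ?andbF ?andbT //; case/andP: US => _ ->.
rewrite [LHS](bigID (fun T : {set I} => k \in T)) /= [X in _ + X]big1 ?addr0; last first.
  by move=> T /andP[_ kT]; rewrite hw ?mul0r.
rewrite [LHS](reindex_onto (fun U => k |: (S :\: U)) (fun T => S :\: T)) /=; last first.
  move=> T /andP[/subsetP TS kT]; apply/setP => i; rewrite !inE.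
  case: (eqVneq i k) => [->|ik] /=; first by rewrite kT.
  have := TS i; rewrite in_setU1 (negPf ik) /=.
  by case: (i \in T); case: (i \in S) => //= /(_ isT).
apply: eq_big => [U|U /andP[_ /eqP US]].
  apply/andP/idP => [[_ /eqP <-]|US]; first exact: subsetDl.
  split; first by rewrite setU11 setUS ?subsetDl.
  apply/eqP/setP => i; rewrite !inE; case: (eqVneq i k) => [->|ik] /=.
    by apply/esym/negbTE; apply: contra kS; apply: subsetP.
  have := subsetP US i; case: (i \in U) => [/(_ isT) ->|]; rewrite ?andbF //.
  by case: (i \in S).
have {}US : U \subset S by rewrite -US subsetDl.
congr (_ * z _); apply/setP => i; rewrite !inE; case: (eqVneq i k) => [->|ik] /=.
  by apply/esym/negbTE; apply: contra kS; apply: subsetP.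
by have := subsetP US i; case: (i \in U) => [/(_ isT) ->|_] //; case: (i \in S).
Qed.

End Component.

Lemma sum_even (W : lmodType rat) N (u : nat -> W) :
  \sum_(m < N.+1) (1 + (-1) ^+ m : rat) *: u m
  = (2 : rat) *: u 0 + \sum_(m < N.+1 | (0 < m)%N && ~~ odd m) (2 : rat) *: u m.
Proof.
rewrite [X in _ = _ + X]big_mkcond [X in _ = _ + X]big_ord_recl /= add0r big_ord_recl /= expr0; congr (_ + _).
apply: eq_bigr => m _; rewrite /= -signr_odd /=.
by case: (odd m); rewrite /= ?expr0 ?expr1 ?subrr ?scale0r.
Qed.

Section Representation.
Variables (K : numFieldType) (V : lmodType K) (br : {bilinear V -> V -> V}).
Variable nrm : V -> K.
Hypothesis nrm_ge0 : forall v, 0 <= nrm v.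
Hypothesis nrm0 : nrm 0 = 0.
Hypothesis nrmD : forall u v, nrm (u + v) <= nrm u + nrm v.
Hypothesis nrmZ : forall c v, nrm (c *: v) = `|c| * nrm v.
Hypothesis nrm_br : forall u v, nrm (br u v) <= nrm u * nrm v.
Variables (n : nat) (x : 'I_n -> V).
Notation sps := (sps 'I_n (ncpoly n)).
Implicit Types (S T : {set 'I_n}) (P Q : ncpoly n) (b c : rat).

(** The bound is on the value of some Lie expression for [P], which makes it
    compatible with sums and brackets; that the value at [x] is the same for all
    Lie expressions of [P] enters only at the end. *)
Definition lie_bounded S P b := exists t : lie_term n,
  lie_assoc t = P /\ nrm (lie_eval br x t) <= ratr b * \prod_(i in S) nrm (x i).

Lemma prod_nrm_ge0 S : 0 <= \prod_(i in S) nrm (x i).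
Proof. exact: prodr_ge0. Qed.

Lemma lie_bounded_le S P b c : b <= c -> lie_bounded S P b -> lie_bounded S P c.
Proof.
move=> bc [t [tP tb]]; exists t; split=> //; apply: le_trans tb _.
by apply: ler_wpM2r; rewrite ?prod_nrm_ge0 ?ler_rat.
Qed.

Lemma lie_bounded0 S b : 0 <= b -> lie_bounded S 0 b.
Proof.
move=> b0; exists LieZero; split=> //=.
by rewrite nrm0 mulr_ge0 ?prod_nrm_ge0 // ler0q.
Qed.

Lemma lie_boundedD S P Q b c : lie_bounded S P b -> lie_bounded S Q c ->
  lie_bounded S (P + Q) (b + c).
Proof.
move=> [t [<- tb]] [u [<- uc]]; exists (LieAdd t u); split=> //=.
by rewrite rmorphD mulrDl; apply: le_trans (nrmD _ _) _; apply: lerD.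
Qed.

Lemma lie_boundedZ S P b c : lie_bounded S P b -> lie_bounded S (c *: P) (`|c| * b).
Proof.
move=> [t [<- tb]]; exists (LieScale c t); split.
  by rewrite /lie_assoc /= ratr_rat.
by rewrite /= nrmZ rmorphM /= ratr_norm -mulrA ler_wpM2l.
Qed.

Lemma lie_boundedM S T P Q b c : [disjoint S & T] ->
  lie_bounded S P b -> lie_bounded T Q c ->
  lie_bounded (S :|: T) (P * Q - Q * P) (b * c).
Proof.
move=> ST [t [<- tb]] [u [<- uc]]; exists (LieBracket t u); split=> //=.
rewrite (eq_bigl [predU S & T]) => [|i]; last by rewrite !inE.
rewrite bigU //= rmorphM mulrACA.
by apply: le_trans (nrm_br _ _) _; apply: ler_pM.
Qed.

Lemma lie_bounded_sum S J (r : seq J) (p : pred J) (F : J -> ncpoly n) (f : J -> rat) :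
  (forall j, p j -> lie_bounded S (F j) (f j)) ->
  lie_bounded S (\sum_(j <- r | p j) F j) (\sum_(j <- r | p j) f j).
Proof.
move=> h; elim: r => [|j r IH]; first by rewrite !big_nil; apply: lie_bounded0.
by rewrite !big_cons; case: ifP => // pj; apply: lie_boundedD => //; apply: h.
Qed.

Lemma lie_bounded_var i : lie_bounded [set i] (ncvar i) 1.
Proof. by exists (LieVar i); split=> //=; rewrite big_set1 rmorph1 mul1r. Qed.

Section Sizes.
Variable k : 'I_n.
Implicit Types (z w : sps) (p q : {poly rat}) (M : nat).

(** Components are bounded through exponential generating functions, which are
    multiplicative by [sum_subsets_fact]. *)
Definition size_before p M z := forall S, (#|S| < M)%N ->
  lie_bounded S (z S) ((#|S|)`!%:R * p`_#|S|).

(** The letter [k] is left out of the count: the generating function of the terms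
    that contain a given letter is a derivative. *)
Definition size_at q M z := forall S, k \notin S -> (#|S| < M)%N ->
  lie_bounded (k |: S) (z (k |: S)) ((#|S|)`!%:R * q`_#|S|).

Lemma size_at_leq q M M' z : (M' <= M)%N -> size_at q M z -> size_at q M' z.
Proof. by move=> MM h S kS SM; apply: h => //; apply: leq_trans MM. Qed.

Lemma size_at_le q q' M z : nonneg (q' - q) -> size_at q M z -> size_at q' M z.
Proof.
move=> qq h S kS SM; apply: lie_bounded_le (h S kS SM).
by rewrite ler_wpM2l ?ler0n // -subr_ge0 -coefB.
Qed.

Lemma size_atD q q' M z w : size_at q M z -> size_at q' M w -> size_at (q + q') M (z + w).
Proof.
move=> hz hw S kS SM; rewrite spsD coefD mulrDr.
by apply: lie_boundedD; [apply: hz | apply: hw].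
Qed.

Lemma size_atZ c q M z : size_at q M z -> size_at (`|c| *: q) M (c *: z).
Proof.
by move=> hz S kS SM; rewrite spsZ coefZ mulrCA; apply: lie_boundedZ; apply: hz.
Qed.

Lemma size_at0 M : size_at 0 M 0.
Proof. by move=> S kS SM; rewrite sps0 coef0 mulr0; apply: lie_bounded0. Qed.

Lemma size_at_sum M J (r : seq J) (P : pred J) (F : J -> sps) (f : J -> {poly rat}) :
  (forall j, P j -> size_at (f j) M (F j)) ->
  size_at (\sum_(j <- r | P j) f j) M (\sum_(j <- r | P j) F j).
Proof.
move=> h; elim: r => [|j r IH]; first by rewrite !big_nil; apply: size_at0.
by rewrite !big_cons; case: ifP => // pj; apply: size_atD => //; apply: h.
Qed.

Lemma size_lbr p q M z w : nonneg p -> nonneg q -> avoids k z -> divisible k w -> order_ge 1 z ->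
  size_before p M.+1 z -> size_at q M w -> size_at (p * q) M.+1 (lbr z w).
Proof.
move=> p0 q0 hz hw z1 sz sw S kS SM; rewrite (lbr_component kS hz hw) -sum_subsets_fact.
apply: lie_bounded_sum => U US.
have kSU : k \notin S :\: U by rewrite inE (negPf kS) andbF.
(* The empty set contributes nothing, since [z] has positive order; thus at
   least one letter goes to [z], and [sw] applies to the rest. *)
have [U0|U0] := eqVneq U set0.
  rewrite U0 [z set0]z1 ?cards0 // mul0r mulr0 subrr; apply: lie_bounded0.
  by rewrite !mulr_ge0 ?ler0n ?p0 ?q0.
have -> : k |: S = U :|: (k |: (S :\: U)).
  rewrite setUCA; congr (_ |: _); apply/setP => i; rewrite !inE.
  by have := subsetP US i; case: (i \in U) => // ->.
apply: lie_boundedM.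
- rewrite disjoint_sym disjoints_subset; apply/subsetP => i.
  rewrite !inE => /predU1P[->|/andP[]//].
  by apply: contra kS; apply: subsetP.
- by apply: sz; apply: leq_ltn_trans SM; apply: subset_leq_card.
- apply: sw => //; rewrite cardsD (setIidPr US) ltn_subLR ?subset_leq_card //.
  by rewrite (leq_trans SM) // -add1n leq_add2r card_gt0.
Qed.

(** A commutator with an element of positive order uses up at least one letter.
    Hence its components with one letter more than those bounded for [w] are
    bounded, too; this makes the recursion well founded. *)
Lemma size_iter p q M z w i : nonneg p -> nonneg q -> avoids k z -> divisible k w -> order_ge 1 z ->
  size_before p M.+1 z -> size_at q M w ->
  size_at (p ^+ i * q) (M + (0 < i))%N (iter i (lbr z) w).
Proof.
move=> p0 q0 hz hw z1 sz sw; elim: i => [|i IH] /=; first by rewrite expr0 mul1r addn0.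
rewrite addn1 exprS -mulrA; apply: size_lbr => //.
- by apply: nonnegM => //; apply: nonnegX.
- exact: divisible_iter.
- by apply: size_at_leq IH; apply: leq_addr.
Qed.

Lemma size_scale c q M z : 0 <= c -> size_at q M z -> size_at (c *: q) M (c *: z).
Proof. by move=> c0; rewrite -{1}(ger0_norm c0); apply: size_atZ. Qed.

Section Chain.
Variables (z d : nat -> sps) (h e : nat -> {poly rat}) (M : nat).
Hypothesis h_ge0 : forall j, nonneg (h j).
Hypothesis e_ge0 : forall j, nonneg (e j).

Definition chain_ok (r : seq nat) := forall j, j \in r ->
  [/\ avoids k (z j), order_ge 1 (z j), size_before (h j) M.+1 (z j),
      divisible k (d j) & size_at (e j) M (d j)].

Definition chain r := [seq (z j, d j) | j <- r].

Lemma chain_ok_cons j r : chain_ok (j :: r) -> chain_ok r.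
Proof. by move=> ok i ir; apply: ok; rewrite inE ir orbT. Qed.

Lemma chain_perturbation r : chain_ok r -> is_perturbation k (chain r).
Proof. by move=> ok _ /mapP[j /ok[_ z1 _ dj _] ->]. Qed.

Lemma nonneg_sum J (r : seq J) (f : J -> {poly rat}) : (forall j, nonneg (f j)) ->
  nonneg (\sum_(j <- r) f j).
Proof. by move=> f0 m; rewrite coef_sum sumr_ge0 // => j _; apply: f0. Qed.

Lemma nonnegZ (c : rat) p : 0 <= c -> nonneg p -> nonneg (c *: p).
Proof. by move=> c0 hp m; rewrite coefZ mulr_ge0. Qed.

(** The binomial theorem for the divided powers of a + b. *)
Lemma expand_exp (a b g : {poly rat}) m :
  \sum_(i < m.+1) (i`!%:R : rat)^-1 *: (a ^+ i * (((m - i)`!%:R : rat)^-1 *: (b ^+ (m - i) * g)))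
  = (m`!%:R : rat)^-1 *: ((a + b) ^+ m * g).
Proof.
have -> : (m`!%:R : rat)^-1 *: ((a + b) ^+ m * g) = dpow m (b + a) * g.
  by rewrite /dpow scalerAl addrC.
rewrite dpowD ?mulr_suml; last exact: mulrC.
apply: eq_bigr => i _; rewrite /dpow -!scalerAr -!scalerAl !scalerA.
by congr (_ *: _); rewrite mulrCA mulrA.
Qed.

Lemma inv_fact_ge0 m : 0 <= (m`!%:R : rat)^-1. Proof. by rewrite invr_ge0 ler0n. Qed.

Lemma size_adpow p q w v i M' : nonneg p -> nonneg q -> avoids k w -> divisible k v -> order_ge 1 w ->
  size_before p M.+1 w -> (M' <= M.+1)%N -> size_at q M v -> (i = 0%N -> size_at q M' v) ->
  size_at ((i`!%:R : rat)^-1 *: (p ^+ i * q)) M' (adpow i w v).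
Proof.
move=> p0 q0 hw hv w1 sw MM sv s0; apply: size_scale; first exact: inv_fact_ge0.
case: i s0 => [|i] s0; first by rewrite expr0 mul1r; apply: s0.
apply: (@size_at_leq _ (M + (0 < i.+1))%N); first by rewrite addn1.
exact: size_iter.
Qed.

Lemma size_conj_right r m X : chain_ok r -> divisible k X -> size_at 1 M.+1 X ->
  size_at ((m`!%:R : rat)^-1 *: ((\sum_(j <- r) h j) ^+ m * 1)) M.+1
    (conj_right (chain r) m X).
Proof.
move=> ok hX sX; elim: r m ok => [|j r IH] m ok.
  rewrite big_nil; case: m => [|m] /=.
    by rewrite expr0 mul1r invr1 scale1r.
  by rewrite expr0n mul0r scaler0; apply: size_at0.
have okr := chain_ok_cons ok; have [hz z1 sz _ _] := ok j (mem_head _ _).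
rewrite big_cons -expand_exp; apply: size_at_sum => i _.
apply: size_adpow => //.
- apply: nonnegZ (inv_fact_ge0 _) _; apply: nonnegM; last by move=> l; rewrite coef1 ler0n.
  by apply: nonnegX; apply: nonneg_sum.
- exact: conj_right_divisible.
- by apply: size_at_leq (IH _ okr).
- by move=> _; apply: IH.
Qed.

(** The factor 1 / (m + 1)! of a term of the innermost derivative is bounded by
    1 / m!, and h_j^m by (h_j + H)^m. This loses a little, but results in a
    bound that does not depend on the order of the factors, so that the inward
    and the outward expansions obey the same estimate. *)
Lemma size_log_deriv r m : chain_ok r ->
  size_at ((m`!%:R : rat)^-1 *: ((\sum_(j <- r) h j) ^+ m * (\sum_(j <- r) e j)))
    (M + (0 < m))%N (log_deriv (chain r) m).
Proof.
elim: r m => [|j r IH] m ok.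
  by rewrite !big_nil mulr0 scaler0; apply: size_at0.
have okr := chain_ok_cons ok; have [hz z1 sz hd sd] := ok j (mem_head _ _).
set H := \sum_(i <- r) h i; set E := \sum_(i <- r) e i.
have H0 : nonneg H by apply: nonneg_sum.
have E0 : nonneg E by apply: nonneg_sum.
have fact0 i := inv_fact_ge0 i.
apply: (@size_at_le ((m.+1`!%:R : rat)^-1 *: (h j ^+ m * e j)
                     + (m`!%:R : rat)^-1 *: ((h j + H) ^+ m * E))).
  rewrite !big_cons -/H -/E mulrDr scalerDr [X in X - _]addrC [X in _ - X]addrC opprD addrACA.
  rewrite subrr add0r.
  have -> : (h j + H) ^+ m * e j = h j ^+ m * e j + ((h j + H) ^+ m - h j ^+ m) * e j.
    by rewrite -mulrDl addrCA subrr addr0.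
  rewrite scalerDr addrAC -scalerBl; apply: nonnegD.
    apply: nonnegZ; last by apply: nonnegM => //; apply: nonnegX.
    by rewrite subr_ge0 lef_pV2 ?posrE ?ltr0n ?fact_gt0 // ler_nat factS leq_pmull.
  apply: nonnegZ => //; apply: nonnegM => //.
  rewrite subrXX addrAC subrr add0r; apply: nonnegM => //; apply: nonneg_sum => l.
  by apply: nonnegM; apply: nonnegX => //; apply: nonnegD.
apply: size_atD; first by apply: size_scale => //; apply: size_iter.
rewrite -expand_exp; apply: size_at_sum => i _.
apply: size_adpow => //.
- by apply: nonnegZ => //; apply: nonnegM => //; apply: nonnegX.
- exact: log_deriv_divisible (chain_perturbation okr).
- by case: (0 < m)%N; rewrite ?addn1 ?addn0.
- by apply: size_at_leq (IH _ okr); apply: leq_addr.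
- by move=> i0; rewrite i0 subn0; apply: IH.
Qed.
End Chain.
End Sizes.

Section Main.
Variables (kd : wilcox_kind) (L : nat -> ncpoly n).
Hypothesis L_hom : forall m, (0 < m)%N -> nc_homogeneous m (L m).
Hypothesis L_wilcox : wilcox_factorization kd L.

Let part d := wilcox_ml L d.

(** The bounds for half the exponent of degree [d] and for its perturbation: the
    monomials of degree [d] of f / 2, and of degree d - 1 of f' / 2. *)
Definition h_part d : {poly rat} := if (d <= n)%N then (2^-1 * bound_coef d) *: 'X^d else 0.
Definition e_part d : {poly rat} :=
  if (d <= n)%N then (2^-1 * invsqrt_coef d.-1) *: 'X^(d.-1) else 0.

Lemma half_ge0 : 0 <= (2^-1 : rat). Proof. by []. Qed.

Lemma h_part_ge0 d : nonneg (h_part d).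
Proof.
rewrite /h_part => m; case: ifP => _; last by rewrite coef0.
by rewrite coefZ coefXn mulr_ge0 ?ler0n // mulr_ge0 ?bound_coef_ge0.
Qed.

Lemma e_part_ge0 d : nonneg (e_part d).
Proof.
rewrite /e_part => m; case: ifP => _; last by rewrite coef0.
by rewrite coefZ coefXn mulr_ge0 ?ler0n // mulr_ge0 ?invsqrt_coef_ge0.
Qed.

Lemma sum_right_degrees (W : nmodType) M (f : nat -> W) : (n <= M)%N ->
  (forall d, (n < d)%N -> f d = 0) ->
  \sum_(d <- right_degrees kd M) f d = \sum_(d < n) f d.+1.
Proof.
move=> nM f0; rewrite (perm_big _ (right_degrees_perm kd M)) /=.
rewrite -[1%N]addn0 iotaDl big_map -(subn0 M) -/(index_iota 0 M) big_mkord.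
rewrite (big_ord_widen M (fun d => f d.+1) nM) [RHS]big_mkcond.
by apply: eq_bigr => d _; case: ltnP => // nd; rewrite f0.
Qed.

Lemma sum_h_part M : (n <= M)%N -> \sum_(d <- right_degrees kd M) h_part d = half_bound n.
Proof.
move=> nM; rewrite (sum_right_degrees nM) => [|d nd]; last by rewrite /h_part leqNgt nd.
by apply: eq_bigr => d _; rewrite /h_part ltn_ord.
Qed.

Lemma sum_e_part M : (n <= M)%N ->
  \sum_(d <- right_degrees kd M) e_part d = 2^-1 *: bound_deriv n.
Proof.
move=> nM; rewrite (sum_right_degrees nM) => [|d nd]; last by rewrite /e_part leqNgt nd.
rewrite /bound_deriv poly_def scaler_sumr.
by apply: eq_bigr => d _; rewrite /e_part ltn_ord scalerA.
Qed.

(** By induction on the number of letters. Let [k] be the last letter of S in the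
    equation of [wilcox_step], read at S. The terms without commutators add up
    to the part in question. All other terms are brackets of parts with fewer
    letters; their bounds, given by the induction hypothesis, are added up by
    [majorant_recursion]. *)
Lemma wilcox_lie_bounded (S : {set 'I_n}) : (0 < #|S|)%N ->
  lie_bounded S (part #|S| S) ((#|S|)`!%:R * bound_coef #|S|).
Proof.
move: {2}#|S| (leqnn #|S|) => m; elim: m S => [|m IH] S Sm S0.
  by move: S0; rewrite ltnNge Sm.
have [k kS kmax] : exists2 k, k \in S & forall i, i \in S -> (i <= k)%N.
  have /card_gt0P[i0 i0S] := S0.
  by case: (@arg_maxnP _ i0 (mem S) (@nat_of_ord n) i0S) => k kS kmax; exists k.
pose S' := S :\ k; have kS' : k \notin S' by rewrite !inE eqxx.
have SE : S = k |: S' by rewrite /S' setD1K.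
have cS : #|S| = #|S'|.+1 by rewrite SE cardsU1 kS' add1n.
set M := #|S'|; rewrite -/M in cS.
have {}IH (T : {set 'I_n}) : (0 < #|T| <= M)%N ->
    lie_bounded T (part #|T| T) ((#|T|)`!%:R * bound_coef #|T|).
  by move=> /andP[T0 TM]; apply: IH => //; rewrite (leq_trans TM) // -ltnS -cS.
have Mn : (M < n)%N by rewrite -cS -[X in (_ <= X)%N](card_ord n) max_card.
have [D nD E] := wilcox_step L_hom L_wilcox k.
pose r := right_degrees kd D.
have r0 d : d \in r -> (0 < d)%N by apply: right_degrees_gt0.
pose z d := (2^-1 : rat) *: ml_old L k d.
pose e d := (2^-1 : rat) *: ml_new L k d.
(* The exponents of the equation satisfy the bounds, by the induction
   hypothesis, for all sets with fewer letters than S. *)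
have ok : chain_ok k z e h_part e_part M r.
  move=> d /r0 d0; split.
  - move=> T kT; rewrite /z spsZ /ml_old restrE ifF ?scaler0 //.
    by apply/negP => /subsetP/(_ k kT); rewrite inE ltnn.
  - by apply: order_geZ; apply: restr_order_ge; apply: wilcox_ml_order_ge.
  - move=> T TM; rewrite /z spsZ /ml_old restrE /h_part.
    have Tn : (#|T| <= n)%N by rewrite -[X in (_ <= X)%N](card_ord n) max_card.
    have [Td|Td] := eqVneq #|T| d; last first.
      rewrite (wilcox_ml_supp L_hom) // if_same scaler0; apply: lie_bounded0.
      by rewrite mulr_ge0 ?ler0n ?h_part_ge0.
    subst d; rewrite Tn coefZ coefXn eqxx mulr1.
    case: ifP => _; last first.
      by rewrite scaler0; apply: lie_bounded0; rewrite mulr_ge0 ?ler0n // mulr_ge0 ?bound_coef_ge0.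
    rewrite mulrCA -[X in X * _](ger0_norm half_ge0); apply: lie_boundedZ.
    by apply: IH; rewrite d0 -ltnS.
  - by apply: divisibleZ; apply: ml_new_divisible.
  - move=> T kT TM; rewrite /e spsZ /ml_new spsD spsN /ml_old !restrE /e_part.
    have cT : #|k |: T| = #|T|.+1 by rewrite cardsU1 kT add1n.
    have -> : (k |: T \subset vars_before k) = false.
      by apply/negbTE/negP => /subsetP/(_ k (setU11 _ _)); rewrite inE ltnn.
    rewrite subr0.
    have [Td|Td] := eqVneq #|k |: T| d; last first.
      rewrite (wilcox_ml_supp L_hom) // if_same scaler0; apply: lie_bounded0.
      by rewrite mulr_ge0 ?ler0n ?e_part_ge0.
    subst d; rewrite cT (leq_trans TM (ltnW Mn)) /= coefZ coefXn eqxx mulr1.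
    case: ifP => _; last first.
      rewrite scaler0; apply: lie_bounded0.
      by rewrite mulr_ge0 ?ler0n // mulr_ge0 ?invsqrt_coef_ge0.
    rewrite mulrCA -[X in X * _](ger0_norm half_ge0); apply: lie_boundedZ.
    rewrite -cT -fact_bound_coef -cT; apply: IH.
    by rewrite cT ltnS TM.
have sX : size_at k 1 M.+1 (ml_var k).
  move=> T kT _; rewrite coef1 ml_varE.
  case: (T =P set0) => [->|/eqP T0].
    by rewrite setU0 eqxx cards0 mulr1; apply: lie_bounded_var.
  rewrite ifF; first by apply: lie_bounded0; rewrite mulr_ge0 ?ler0n.
  by apply/negbTE; apply: contra T0 => /eqP kTk; rewrite -subset0 -(setDv [set k]) -{1}(setU1K kT) kTk.
have sL m0 := size_log_deriv h_part_ge0 e_part_ge0 (m := m0) ok.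
have sC m0 := size_conj_right h_part_ge0 m0 ok (@ml_var_divisible n k) sX.
have pairsE : chain z e r = step_pairs kd L k D by [].
rewrite pairsE in sL sC.
(* Without commutators only the exponent of degree #|S| contributes at S. *)
have log0 : log_deriv (step_pairs kd L k D) 0 S = 2^-1 *: part #|S| S.
  rewrite log_deriv_0 -pairsE /chain big_map sps_sum.
  transitivity (\sum_(d <- r) (2^-1 : rat) *: (if d == M.+1 then part #|S| S else 0)).
    apply: eq_big_seq => d /r0 d0; rewrite /= spsZ /ml_new spsD spsN /ml_old !restrE.
    have -> : (S \subset vars_before k) = false.
      by apply/negbTE/negP => /subsetP/(_ k kS); rewrite inE ltnn.
    have -> : (S \subset k |: vars_before k).
      by apply/subsetP => i /kmax; rewrite in_setU1 inE leq_eqVlt -val_eqE.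
    rewrite subr0 -cS; case: eqP => [->//|/eqP dS].
    by rewrite (wilcox_ml_supp L_hom) // eq_sym.
  rewrite -scaler_sumr -big_mkcond -big_filter; congr (_ *: _).
  have -> : [seq d <- r | d == M.+1] = [:: M.+1].
    rewrite filter_pred1_uniq //.
      by rewrite /r (perm_uniq (right_degrees_perm kd D)) iota_uniq.
    by rewrite /r (perm_mem (right_degrees_perm kd D)) mem_iota /= add1n ltnS (leq_trans Mn).
  by rewrite big_seq1.
have key : part #|S| S = \sum_(m0 < n.+1) conj_right (step_pairs kd L k D) m0 (ml_var k) S
    - \sum_(m0 < n.+1 | (0 < m0)%N && ~~ odd m0) (2 : rat) *: log_deriv (step_pairs kd L k D) m0 S.
  have E0 := congr1 (fun f : sps => f S) E; rewrite !sps_sum in E0; rewrite -E0.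
  rewrite (eq_bigr (fun m0 : 'I_n.+1 => (1 + (-1) ^+ m0 : rat) *: log_deriv (step_pairs kd L k D) m0 S)).
    rewrite (sum_even n (fun m0 => log_deriv (step_pairs kd L k D) m0 S)) log0.
    by rewrite scalerA divff // scale1r addrK.
  by move=> m0 _; rewrite spsZ.
(* Including [k], the bound for S is M! times a coefficient of f'. *)
rewrite key cS fact_bound_coef {key E}.
have hmaj := majorant_recursion Mn (leqnSn n).
apply: lie_bounded_le (ler_wpM2l (ler0n _ M`!) hmaj) _.
rewrite coefD mulrDr !coef_sum !mulr_sumr; apply: lie_boundedD.
  apply: lie_bounded_sum => m0 _.
  have := sC m0 S' kS' (ltnSn _); rewrite -SE -/r sum_h_part // mulr1; exact.
rewrite -scaleN1r scaler_sumr.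
rewrite -[X in lie_bounded _ _ X](_ : \sum_(m0 < n.+1 | (0 < m0)%N && ~~ odd m0)
   (M`!%:R * (m0`!%:R^-1 *: (half_bound n ^+ m0 * bound_deriv n))`_M) = _) //.
apply: lie_bounded_sum => m0 /andP[m00 _].
have := sL m0 S' kS'; rewrite -SE m00 addn1 -/r sum_h_part // sum_e_part // => /(_ (ltnSn _)).
move=> /(lie_boundedZ 2)/(lie_boundedZ (-1)).
apply: lie_bounded_le; rewrite normrN normr1 mul1r ger0_norm // -scalerAr !coefZ -/M.
by rewrite mulrCA [2 * _]mulrCA [2 * (_ * _)]mulrA divff // mul1r.
Qed.

End Main.
End Representation.

(** * The Wilcox polynomials *)

Section WilcoxPolynomial.
Variables (K : numFieldType) (V : lmodType K) (br : {bilinear V -> V -> V}).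
Hypothesis br_lie : is_lie_bracket br.
Variables (kd : wilcox_kind) (n : nat) (p : lie_term n).
Hypothesis p_wilcox : is_wilcox_poly kd p.

Lemma wilcox_poly_supp (w : {fmonom 'I_n}) : (lie_assoc p)@_w != 0 -> perm_eq w (enum 'I_n).
Proof.
by have [L [_ _ ->]] := p_wilcox; case: ifP; rewrite ?eqxx.
Qed.

Lemma wilcox_poly_homogeneous : nc_homogeneous n (lie_assoc p).
Proof. by move=> w /wilcox_poly_supp /perm_size ->; rewrite size_enum_ord. Qed.

Lemma dynkin_word_additive (x y z : 'I_n -> V) i w : uniq w -> i \in w ->
  z i = x i + y i -> (forall j, j != i -> z j = x j /\ z j = y j) ->
  dynkin_word br z w = dynkin_word br x w + dynkin_word br y w.
Proof.
move=> + + zi zj; elim: w => //= j w IH /andP[jw uw].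
have off u (x' : 'I_n -> V) : (forall l, l != i -> z l = x' l) -> i \notin u ->
    dynkin_word br z u = dynkin_word br x' u.
  move=> zx'; elim: u => //= l u IHu; rewrite inE negb_or => /andP[il iu].
  by case: u IHu iu => [|l' u] IHu iu; rewrite ?IHu ?zx' // eq_sym.
rewrite inE; have [ij _|ij /= iw] := eqVneq i j.
  subst j; have E1 := off w x (fun l li => (zj l li).1) jw.
  have E2 := off w y (fun l li => (zj l li).2) jw.
  case: w {IH uw jw} E1 E2 => [|l w] // E1 E2.
  by rewrite zi brDl -E1 -E2.
have ji : j != i by rewrite eq_sym.
have [zx zy] := zj j ji.
case: w IH jw uw iw => // l w IH jw uw iw; rewrite IH // brDr -zy -zx.
by [].
Qed.

(** All words of the polynomial contain each variable exactly once, and so do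
    their right-normed brackets, which determine the value. *)
Lemma wilcox_poly_additive (x y z : 'I_n -> V) i :
  z i = x i + y i -> (forall j, j != i -> z j = x j /\ z j = y j) ->
  lie_eval br z p = lie_eval br x p + lie_eval br y p.
Proof.
move=> zi zj; rewrite !(lie_eval_homogeneous br_lie _ wilcox_poly_homogeneous).
rewrite -scalerDr; congr (_ *: _); rewrite /lin -big_split; apply: eq_big_seq => w.
rewrite -mcoeff_neq0 => /wilcox_poly_supp wP.
rewrite /= -scalerDr; congr (_ *: _); apply: (@dynkin_word_additive _ _ _ i) => //.
  by rewrite (perm_uniq wP) enum_uniq.
by rewrite (perm_mem wP) mem_enum.
Qed.

Variable nrm : V -> K.
Hypothesis nrm_ge0 : forall v, 0 <= nrm v.
Hypothesis nrm0 : nrm 0 = 0.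
Hypothesis nrmD : forall u v, nrm (u + v) <= nrm u + nrm v.
Hypothesis nrmZ : forall c v, nrm (c *: v) = `|c| * nrm v.
Hypothesis nrm_br : forall u v, nrm (br u v) <= nrm u * nrm v.

(** The polynomial is the multilinear part of L_n at the set of all variables.
    [wilcox_lie_bounded] bounds another Lie expression for it, which has the same
    value by [lie_eval_assoc]. *)
Lemma wilcox_poly_bound (x : 'I_n -> V) : (0 < n)%N ->
  nrm (lie_eval br x p) <= ratr (n`!%:R * bound_coef n) * \prod_(i < n) nrm (x i).
Proof.
move=> n0; have [L [Lhom Lwil pE]] := p_wilcox.
have cT : #|[set: 'I_n]| = n by rewrite cardsT card_ord.
have := @wilcox_lie_bounded _ _ br nrm nrm_ge0 nrm0 nrmD nrmZ nrm_br n x kd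
  (fun m => lie_assoc (L m)) Lhom Lwil [set: 'I_n].
rewrite cT => /(_ n0) [t [tE tb]].
rewrite (lie_eval_assoc br_lie x (q := t)).
  by apply: le_trans tb _; rewrite (eq_bigl xpredT) // => i; rewrite inE.
rewrite tE; apply/malgP => w; rewrite pE mlpart_coef.
by rewrite (_ : enum [set: 'I_n] = enum 'I_n) //; apply: eq_enum => i; rewrite !inE.
Qed.
End WilcoxPolynomial.

(** * Multiadditive maps and increasing index sequences *)

Section Multiadditive.
Variables (n : nat) (V W : zmodType) (P : ('I_n -> V) -> W).
Hypothesis P_ext : forall x y, x =1 y -> P x = P y.
Hypothesis P_add : forall (x y z : 'I_n -> V) i, z i = x i + y i ->
  (forall j, j != i -> z j = x j /\ z j = y j) -> P z = P x + P y.

Let upd (x : 'I_n -> V) i v j := if j == i then v else x j.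

Lemma multiadditive0 x i : x i = 0 -> P x = 0.
Proof.
move=> xi; have : P x = P x + P x by apply: (P_add (i := i)) => //; rewrite xi addr0.
by move=> /(congr1 (fun v => v - P x)); rewrite subrr addrK.
Qed.

Lemma multiadditive_sum1 J (r : seq J) (y : J -> V) x i :
  P (upd x i (\sum_(j <- r) y j)) = \sum_(j <- r) P (upd x i (y j)).
Proof.
elim: r => [|j r IH]; first by rewrite !big_nil (multiadditive0 (i := i)) // /upd eqxx.
rewrite !big_cons -IH; apply: (P_add (i := i)); rewrite /upd ?eqxx // => l /negPf ->.
by [].
Qed.

Variable J : finType.

(** The variables in [r] are expanded one after the other. The functions take the
    value [j0] elsewhere, so that each choice of indices on [r] is counted
    once. *)
Lemma multiadditive_expand_in (j0 : J) (y : 'I_n -> J -> V) (r : seq 'I_n) x : uniq r ->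
  P (fun i => if i \in r then \sum_j y i j else x i)
  = \sum_(f : {ffun 'I_n -> J} | [forall i, (i \notin r) ==> (f i == j0)])
      P (fun i => if i \in r then y i (f i) else x i).
Proof.
elim: r x => [|i0 r IH] x /=.
  move=> _; rewrite (big_pred1 [ffun=> j0]) => // f; apply/forallP/eqP => [h|-> i].
    by apply/ffunP => i; rewrite ffunE; apply/eqP; apply: h.
  by rewrite ffunE eqxx.
case/andP=> i0r ur.
pose fupd (f : {ffun 'I_n -> J}) j : {ffun 'I_n -> J} := [ffun i => if i == i0 then j else f i].
have ri i : i \in r -> i == i0 = false by apply: contraTF => /eqP ->.
transitivity (P (upd (fun i => if i \in r then \sum_j y i j else x i) i0 (\sum_j y i0 j))).
  by apply: P_ext => i; rewrite /upd inE; case: eqP => [->|].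
rewrite multiadditive_sum1 [RHS](partition_big (fun f : {ffun 'I_n -> J} => f i0) xpredT) //=.
apply: eq_bigr => j _.
transitivity (P (fun i => if i \in r then \sum_j y i j else upd x i0 (y i0 j) i)).
  by apply: P_ext => i; rewrite /upd; case: ifP => // /eqP ->; rewrite (negPf i0r).
rewrite IH // [RHS](reindex_onto (fun f => fupd f j) (fun f => fupd f j0)) /=; last first.
  by move=> f /andP[_ /eqP fj]; apply/ffunP => i; rewrite !ffunE; case: eqP => // ->.
apply: eq_big => [f|f _].
  apply/forallP/andP => [h|[/andP[/forallP h _] /eqP fE] i].
    split; last first.
      apply/eqP/ffunP => i; rewrite !ffunE; case: eqP => // ->.
      by have := h i0; rewrite i0r => /eqP.
    apply/andP; split; last by rewrite ffunE eqxx.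
    apply/forallP => i; apply/implyP; rewrite inE negb_or ffunE => /andP[/negPf -> ir].
    by have := h i; rewrite ir.
  apply/implyP => ir; have := h i; rewrite inE negb_or ffunE ir andbT.
  by case: eqP => [->|//] _; rewrite -fE !ffunE eqxx.
apply: P_ext => i; rewrite inE ffunE /upd.
by case: (eqVneq i i0) => [->|]; rewrite ?(negPf i0r).
Qed.

Lemma multiadditive_expand (y : 'I_n -> J -> V) : (0 < n)%N ->
  P (fun i => \sum_j y i j) = \sum_(f : {ffun 'I_n -> J}) P (fun i => y i (f i)).
Proof.
move=> n0; case: (pickP J) => [j0 _|J0]; last first.
  rewrite [RHS]big1 => [|f _]; last by have := J0 (f (Ordinal n0)).
  by apply: (multiadditive0 (i := Ordinal n0)); rewrite big_pred0.
have := multiadditive_expand_in j0 y (fun=> 0) (enum_uniq 'I_n).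
rewrite (P_ext (y := fun i => \sum_j y i j)); last by move=> i; rewrite mem_enum.
move=> ->; apply: eq_big => [f|f _]; last by apply: P_ext => i; rewrite mem_enum.
by apply/forallP => i; rewrite mem_enum.
Qed.
End Multiadditive.

Definition increasing n N (f : {ffun 'I_n -> 'I_N}) : bool :=
  [forall i : 'I_n, forall j : 'I_n, (i < j)%N ==> (f i < f j)%N].

Lemma increasingP n N (f : {ffun 'I_n -> 'I_N}) :
  reflect (forall i j : 'I_n, (i < j)%N -> (f i < f j)%N) (increasing f).
Proof.
apply: (iffP forallP) => [h i j|h i]; first by apply: implyP; apply: forallP (h i) _.
by apply/forallP => j; apply/implyP; apply: h.
Qed.

(** An increasing self-map of 'I_n is nowhere below the identity; this applies to
    the permutation and to its inverse. *)
Lemma increasing_perm_id n (s : {perm 'I_n}) :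
  (forall i j : 'I_n, (i < j)%N -> (s i < s j)%N) -> s = 1%g.
Proof.
move=> h; have ge_id (t : {perm 'I_n}) : (forall i j : 'I_n, (i < j)%N -> (t i < t j)%N) ->
    forall m (i : 'I_n), i = m :> nat -> (m <= t i)%N.
  move=> ht; elim=> [//|m IH] i im.
  have mn : (m < n)%N by apply: leq_trans (ltn_ord i); rewrite im.
  apply: leq_ltn_trans (IH (Ordinal mn) erefl) _.
  by apply: ht; rewrite /= im.
have hinv (i j : 'I_n) : (i < j)%N -> ((s^-1)%g i < (s^-1)%g j)%N.
  move=> ij; rewrite ltnNge; apply/negP; rewrite leq_eqVlt => /predU1P[e|/h].
    by move: ij; rewrite -(permKV s i) -(permKV s j) (val_inj e) ltnn.
  by rewrite !permKV ltnNge ltnW.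
apply/permP => i; rewrite perm1; apply/val_inj/eqP; rewrite eqn_leq (ge_id s h i i erefl) andbT.
by have := ge_id _ hinv (s i) (s i) erefl; rewrite permK.
Qed.

(** Rearranging the entries of increasing index sequences in all n! ways yields
    distinct sequences, and the sum over all sequences is the n-th power. *)
Lemma increasing_sum_le (R : realDomainType) n N (a : 'I_N -> R) : (forall i, 0 <= a i) ->
  n`!%:R * \sum_(f : {ffun 'I_n -> 'I_N} | increasing f) \prod_i a (f i) <= (\sum_i a i) ^+ n.
Proof.
move=> a0; have -> : (\sum_i a i) ^+ n = \sum_(f : {ffun 'I_n -> 'I_N}) \prod_i a (f i).
  by rewrite -(bigA_distr_bigA (fun _ : 'I_n => a)) prodr_const card_ord.
pose rearr (p : {perm 'I_n} * {ffun 'I_n -> 'I_N}) : {ffun 'I_n -> 'I_N} :=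
  [ffun i => p.2 (p.1 i)].
pose D := [set p : {perm 'I_n} * {ffun 'I_n -> 'I_N} | increasing p.2].
have injD : {in D &, injective rearr}.
  move=> [s f] [t g]; rewrite !inE /= => /increasingP hf /increasingP hg E.
  have {}E i : f (s i) = g (t i) by move/ffunP/(_ i): E; rewrite !ffunE.
  have st : (s^-1 * t = 1)%g.
    apply: increasing_perm_id => i j ij; rewrite !permM ltnNge; apply/negP.
    rewrite leq_eqVlt => /predU1P[e|/hg].
      by have /perm_inj/perm_inj ji := val_inj e; rewrite ji ltnn in ij.
    by rewrite -!E !permKV ltnNge ltnW // hf.
  have sE : t = s by rewrite -[LHS]mul1g -(mulgV s) -mulgA st mulg1.
  by subst t; congr (_, _); apply/ffunP => i; rewrite -(permKV s i) E.
have -> : n`!%:R * \sum_(f : {ffun 'I_n -> 'I_N} | increasing f) \prod_i a (f i)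
        = \sum_(p in D) \prod_i a (rearr p i).
  rewrite (eq_bigl (fun p => xpredT p.1 && increasing p.2)); last by move=> p; rewrite inE.
  rewrite -(pair_big xpredT (@increasing n N) (fun s f => \prod_i a (rearr (s, f) i))) /=.
  rewrite (eq_bigr (fun _ : {perm 'I_n} => \sum_(f : {ffun 'I_n -> 'I_N} | increasing f) \prod_i a (f i))).
    by rewrite sumr_const card_Sn mulr_natl.
  move=> s _; apply: eq_bigr => f _.
  by rewrite [RHS](reindex_inj (@perm_inj _ s)); apply: eq_bigr => i _; rewrite ffunE.
rewrite -(big_imset (fun h : {ffun 'I_n -> 'I_N} => \prod_i a (h i)) injD) /= [X in _ <= X](bigID (mem (rearr @: D))) /=.
by rewrite lerDl sumr_ge0 // => f _; apply: prodr_ge0.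
Qed.

(** Summing over [f] leaves products of column sums. Two factors belong to the
    same column; one of them is bounded by the largest column sum [e], and the
    other n - 1 factors contribute at most w^(n - 1) <= (1 + w)^n. *)
Lemma repeated_column_sum_le (R : realDomainType) n N N' (a : 'I_N -> 'I_N' -> R) (e w : R)
    (l1 l2 : 'I_n) :
  (forall i j, 0 <= a i j) -> (forall j, \sum_i a i j <= e) -> 0 <= e -> 0 <= w ->
  \sum_j \sum_i a i j <= w -> l1 != l2 ->
  \sum_(f : {ffun 'I_n -> 'I_N}) \sum_(g : {ffun 'I_n -> 'I_N'} | g l1 == g l2)
     \prod_l a (f l) (g l) <= e * (1 + w) ^+ n.
Proof.
move=> a0 ce e0 w0 cw l12; pose c j := \sum_i a i j.
have c0 j : 0 <= c j by apply: sumr_ge0.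
rewrite exchange_big /=.
have -> : \sum_(g : {ffun 'I_n -> 'I_N'} | g l1 == g l2)
      \sum_(f : {ffun 'I_n -> 'I_N}) \prod_l a (f l) (g l)
    = \sum_(g : {ffun 'I_n -> 'I_N'} | g l1 == g l2) \prod_l c (g l).
  by apply: eq_bigr => g _; rewrite bigA_distr_bigA.
rewrite (partition_big (fun g : {ffun 'I_n -> 'I_N'} => g l1) xpredT) //=.
pose X := \prod_(l < n | (l != l1) && (l != l2)) w.
have X0 : 0 <= X by apply: prodr_ge0.
have step j : \sum_(g : {ffun 'I_n -> 'I_N'} | (g l1 == g l2) && (g l1 == j)) \prod_l c (g l)
    <= c j * (e * X).
  pose Q (l : 'I_n) : pred 'I_N' := [pred i | (l \in [:: l1; l2]) ==> (i == j)].
  have -> : \sum_(g : {ffun 'I_n -> 'I_N'} | (g l1 == g l2) && (g l1 == j)) \prod_l c (g l)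
          = \prod_l \sum_(i | Q l i) c i.
    rewrite bigA_distr_big_dep; apply: eq_bigl => g.
    apply/andP/familyP => [[/eqP g12 /eqP gj] l|h].
      by rewrite inE; apply/implyP; rewrite !inE => /orP[] /eqP ->; rewrite -?g12 gj.
    have := h l1; have := h l2; rewrite !inE !eqxx orbT /= => /eqP -> /eqP ->.
    by rewrite eqxx.
  have Qj l : l \in [:: l1; l2] -> \sum_(i | Q l i) c i = c j.
    by move=> hl; rewrite (eq_bigl (pred1 j)) ?big_pred1_eq // => i; rewrite /Q /= hl.
  rewrite (bigD1 l1) //= Qj ?mem_head // ler_wpM2l // (bigD1 l2) /=; last by rewrite eq_sym.
  rewrite Qj ?inE ?eqxx ?orbT //; apply: ler_pM => //.
    by apply: prodr_ge0 => l _; apply: sumr_ge0.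
  - exact: ce.
  rewrite /X; apply: ler_prod => l _; rewrite sumr_ge0 //=; apply: le_trans cw.
  by rewrite big_mkcond; apply: ler_sum => i _; case: ifP => // _; exact: c0.
apply: le_trans (ler_sum _ (fun j _ => step j)) _; rewrite -mulr_suml.
apply: (@le_trans _ _ (w * (e * X))); first by rewrite ler_wpM2r ?mulr_ge0.
rewrite mulrCA ler_wpM2l //.
have -> : (1 + w) ^+ n = \prod_(l < n) (1 + w) by rewrite prodr_const card_ord.
have w1 : 1 <= 1 + w by rewrite lerDl.
have w1' : 0 <= 1 + w by apply: le_trans w1.
rewrite (bigD1 l1) //= (bigD1 l2) /=; last by rewrite eq_sym.
apply: ler_pM => //; first by rewrite lerDr.
apply: (@le_trans _ _ (\prod_(l < n | (l != l1) && (l != l2)) (1 + w))).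
  by apply: ler_prod => l _; rewrite w0 lerDr ler01.
by rewrite ler_peMl // prodr_ge0.
Qed.

From mathcomp Require Import complex.
From mathcomp Require Import all_classical all_reals all_analysis.

Import numFieldNormedType.Exports.

Local Open Scope classical_set_scope.
Local Open Scope ring_scope.

(** * Partitions into intervals *)

Section Partitions.
Variable R : realType.
Implicit Types (I J A B : set R) (s t : seq (set R)).

Definition lies_before A B := forall x y, A x -> B y -> x < y.

(** The conditions of [interval_partition] in a form that suits induction on the
    list of pieces. *)
Fixpoint ipartition I s : Prop :=
  if s is J :: s' then
    is_interval J /\ exists2 I', ipartition I' s' & lies_before J I' /\ I = J `|` I'
  else I = set0.

Lemma ipartitionP I s : interval_partition I s <-> ipartition I s.
Proof.
elim: s I => [|J s IH] I /=; split.
- by case=> _ <- _; rewrite -subset0 => x [].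
- by move=> ->; split=> // [|i j]; [rewrite -subset0 => x [] | rewrite ltn0 andbF].
- case=> iv <- ord; split; first exact: (iv 0%N).
  exists (\bigcup_(i in `I_(size s)) nth set0 s i).
    apply/IH; split=> // [i si|i j ij]; first exact: (iv i.+1).
    exact: (ord i.+1 j.+1).
  split; first by move=> x y Jx [i /= si sy]; apply: (ord 0%N i.+1).
  apply/seteqP; split=> x.
    by case=> -[|i] /= si h; [left | right; exists i].
  by case=> [Jx|[i /= si h]]; [exists 0%N | exists i.+1].
- case=> ivJ [I' /IH[iv <- ord] [JI' ->]]; split.
  + by case=> [|i] //= si; apply: iv.
  + apply/seteqP; split=> x.
      by case=> -[|i] /= si h; [left | right; exists i].
    by case=> [Jx|[i /= si h]]; [exists 0%N | exists i.+1].
  + case=> [|i] [|j] //= ij; last exact: ord.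
    by move=> x y Jx sy; apply: JI' => //; exists j.
Qed.

Lemma ipartition_interval1 J : is_interval J -> ipartition J [:: J].
Proof.
move=> iJ; split=> //; exists set0 => //; split; last by rewrite setU0.
by move=> x y.
Qed.

Lemma ipartition_cat I J s t : ipartition I s -> ipartition J t -> lies_before I J ->
  ipartition (I `|` J) (s ++ t).
Proof.
elim: s I => [|K s IH] I /=; first by move=> ->; rewrite set0U.
case=> iK [I' hs [KI' ->]] ht IJ; split=> //; exists (I' `|` J); last first.
  split; last by rewrite setUA.
  by move=> x y Kx [|Jy]; [exact: KI' | apply: IJ => //; left].
by apply: IH => // x y I'x; apply: IJ; right.
Qed.

Lemma ipartition_mem I s J : ipartition I s -> J \in s -> is_interval J /\ J `<=` I.
Proof.
elim: s I => //= K s IH I [iK [I' hs [_ ->]]]; rewrite inE => /predU1P[->|Js].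
  by split=> // x; left.
by have [iJ JI'] := IH _ hs Js; split=> // x /JI'; right.
Qed.

Lemma ipartition_subst I s1 J s2 t : ipartition I (s1 ++ J :: s2) -> ipartition J t ->
  ipartition I (s1 ++ t ++ s2).
Proof.
move=> + ht; elim: s1 I => [|K s1 IH] I /=.
  by case=> iJ [I' hs [JI' ->]]; apply: ipartition_cat.
by case=> iK [I' hs [KI' ->]]; split=> //; exists I' => //; apply: IH.
Qed.

Lemma is_intervalI A B : is_interval A -> is_interval B -> is_interval (A `&` B).
Proof.
move=> hA hB x y [Ax Bx] [Ay By] z xzy.
by split; [exact: hA xzy | exact: hB xzy].
Qed.

Lemma ipartition_restr I J s : ipartition I s -> is_interval J ->
  ipartition (I `&` J) [seq K `&` J | K <- s].
Proof.
move=> + iJ; elim: s I => [|K s IH] I /=; first by move=> ->; rewrite set0I.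
case=> iK [I' hs [KI' ->]]; split; first exact: is_intervalI.
exists (I' `&` J); first exact: IH.
split; last by rewrite setIUl.
by move=> x y [Kx _] [I'y _]; apply: KI'.
Qed.

(** The common refinement, listed along [t] first: each piece of [t] is cut by
    all of [s]. *)
Lemma ipartition_refine I s t : ipartition I s -> ipartition I t ->
  ipartition I [seq K `&` J | J <- t, K <- s].
Proof.
move=> hs; suff H J : J `<=` I -> ipartition J t -> ipartition J [seq K `&` J | J <- t, K <- s].
  exact: H.
elim: t J => [|K t IH] J JI //= [iK [I' ht [KI' JE]]].
rewrite JE; apply: ipartition_cat => //.
  have KE : I `&` K = K by apply/setIidPr => x Kx; apply: JI; rewrite JE; left.
  by have := ipartition_restr hs iK; rewrite KE.
by apply: IH => // x I'x; apply: JI; rewrite JE; right.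
Qed.
End Partitions.

(** * Real norms and vector measures *)

Section Scalars.
Variables (R : realType) (k : scalar_kind).

(** On norms, the inverse of [scalar_re]; see [normE]. *)
Definition scalar_emb : R -> scalars R k :=
  match k with RealScalars => fun x => x | ComplexScalars => fun x => (x%:C)%C end.

Lemma scalar_emb_le a b : (scalar_emb a <= scalar_emb b) = (a <= b).
Proof. by rewrite /scalar_emb; case: k => //=; rewrite lecR. Qed.

Lemma scalar_emb_lt a b : (scalar_emb a < scalar_emb b) = (a < b).
Proof. by rewrite /scalar_emb; case: k => //=; rewrite ltcR. Qed.

Lemma scalar_embD a b : scalar_emb (a + b) = scalar_emb a + scalar_emb b.
Proof. by rewrite /scalar_emb; case: k => //=; rewrite rmorphD. Qed.

Lemma scalar_embM a b : scalar_emb (a * b) = scalar_emb a * scalar_emb b.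
Proof. by rewrite /scalar_emb; case: k => //=; rewrite rmorphM. Qed.

Lemma scalar_emb0 : scalar_emb 0 = 0.
Proof. by rewrite /scalar_emb; case: k => //=; rewrite rmorph0. Qed.

Lemma scalar_emb1 : scalar_emb 1 = 1.
Proof. by rewrite /scalar_emb; case: k => //=; rewrite rmorph1. Qed.

Lemma scalar_emb_ratr (c : rat) : scalar_emb (ratr c) = ratr c.
Proof. by rewrite /scalar_emb; case: k => //=; rewrite fmorph_rat. Qed.

Lemma scalar_emb_prod J (r : seq J) (F : J -> R) :
  scalar_emb (\prod_(j <- r) F j) = \prod_(j <- r) scalar_emb (F j).
Proof. exact: (big_morph _ scalar_embM scalar_emb1). Qed.

Variable V : normedModType (scalars R k).
Implicit Types u v : V.

Lemma normE v : `|v| = scalar_emb (rnorm v).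
Proof.
have := normr_ge0 v; rewrite /rnorm /scalar_emb /scalar_re; move: (`|v|).
case: k => //= -[a b]; rewrite lecE /= => /andP[/eqP -> _].
by [].
Qed.

Lemma rnorm_ge0 v : 0 <= rnorm v.
Proof. by rewrite -scalar_emb_le scalar_emb0 -normE. Qed.

Lemma rnormD u v : rnorm (u + v) <= rnorm u + rnorm v.
Proof. by rewrite -scalar_emb_le scalar_embD -!normE ler_normD. Qed.

Lemma rnorm0 : rnorm (0 : V) = 0.
Proof.
by apply/eqP; rewrite eq_le rnorm_ge0 andbT -scalar_emb_le -normE normr0 scalar_emb0.
Qed.

Lemma rnormN v : rnorm (- v) = rnorm v.
Proof. by rewrite /rnorm normrN. Qed.

Lemma rnormB u v : rnorm (u - v) <= rnorm u + rnorm v.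
Proof. by rewrite -[X in _ <= _ + X]rnormN rnormD. Qed.

Lemma rnorm_sum J (r : seq J) (P : pred J) (F : J -> V) :
  rnorm (\sum_(j <- r | P j) F j) <= \sum_(j <- r | P j) rnorm (F j).
Proof.
elim/big_rec2: _ => [|j y1 y2 _ h]; first by rewrite rnorm0.
by apply: le_trans (rnormD _ _) _; rewrite lerD2l.
Qed.

(** Tolerances are scalars in the definition of the limit; positive scalars are
    real also in the complex case. *)
Lemma rnorm_cvg T (F : set_system T) (FF : Filter F) (f : T -> V) v :
  f x @[x --> F] --> v <-> (forall e : R, 0 < e -> \forall x \near F, rnorm (v - f x) < e).
Proof.
split=> [/cvgrPdist_lt h e e0|h].
  have := h (scalar_emb e); rewrite -scalar_emb0 scalar_emb_lt => /(_ e0).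
  by apply: filterS => x; rewrite normE scalar_emb_lt.
apply/cvgrPdist_lt => e e0.
have [e' e'0 ->] : exists2 e' : R, 0 < e' & e = scalar_emb e'.
  move: e e0 {h}; rewrite /scalar_emb; case: k => [e e0|[a b]]; first by exists e.
  by rewrite ltcE /= => /andP[/eqP -> a0]; exists a.
by apply: filterS (h _ e'0) => x; rewrite normE scalar_emb_lt.
Qed.
End Scalars.

Section VectorMeasure.
Variables (R : realType) (k : scalar_kind) (V : completeNormedModType (scalars R k)).
Variables (I : set R) (alpha : set R -> V).
Implicit Types (J K A B : set R) (s t : seq (set R)).
Hypothesis alpha_measure : is_continuous_measure_fv I alpha.

Lemma measure_limit (F : nat -> set R) : (forall i, measurable (F i)) ->
  (forall i, F i `<=` I) -> trivIset setT F ->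
  forall e : R, 0 < e -> \forall N \near \oo,
    rnorm (alpha (\bigcup_i F i) - \sum_(0 <= i < N) alpha (F i)) < e.
Proof.
have [h _ _] := alpha_measure => mF FI tF.
by apply/rnorm_cvg; apply: h.
Qed.

Lemma rnorm_small (v : V) : (forall e : R, 0 < e -> rnorm v < e) -> v = 0.
Proof.
move=> h; apply/normr0_eq0; rewrite normE -(scalar_emb0 R k); congr (scalar_emb _ _).
apply/eqP; rewrite eq_le rnorm_ge0 andbT leNgt; apply/negP => v0.
by have := h _ v0; rewrite ltxx.
Qed.

(** In the series for a disjoint union of empty sets, consecutive partial sums
    differ by the measure of the empty set, and both are close to the limit. *)
Lemma measure0 : alpha set0 = 0.
Proof.
have lim := measure_limit (fun=> measurable0) (fun=> @sub0set _ I) (@trivIset_set0 _ _ _).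
apply: rnorm_small => e e0.
have e20 : 0 < e / 2 by rewrite divr_gt0.
have [N _ hN] := lim _ e20; have h1 := hN N (leqnn N); have h2 := hN N.+1 (leqnSn N).
rewrite big_nat_recr //= opprD addrA in h2.
rewrite [e]splitr; apply: le_lt_trans (ltrD h1 h2).
set X := alpha _ - _; rewrite -/X in h1 h2 *.
have {1}-> : alpha set0 = X - (X - alpha set0) by rewrite opprB addrC subrK.
exact: rnormB.
Qed.

Lemma measureU A B : measurable A -> measurable B -> A `<=` I -> B `<=` I ->
  A `&` B = set0 -> alpha (A `|` B) = alpha A + alpha B.
Proof.
move=> mA mB AI BI AB; rewrite -bigcup2E.
have mF i : measurable (bigcup2 A B i).
  by rewrite /bigcup2; case: eqP => // _; case: eqP => // _; exact: measurable0.
have FI i : bigcup2 A B i `<=` I by case: i => [|[|i]] // x.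
have tF : trivIset setT (bigcup2 A B) by rewrite -trivIset_bigcup2.
apply/eqP; rewrite -subr_eq0; apply/eqP/rnorm_small => e e0.
have [N _ hN] := measure_limit mF FI tF e0.
have := hN N.+2 (leq_trans (leqnSn N) (leqnSn N.+1)).
by rewrite big_nat_recl // big_nat_recl //= [X in _ + (_ + X)]big1 ?addr0 // => i _; exact: measure0.
Qed.

Lemma interval_measurable J : is_interval J -> measurable J.
Proof. by move=> /is_intervalP ->; exact: measurable_itv. Qed.

Lemma measure_ipartition J s : J `<=` I -> ipartition J s ->
  alpha J = \sum_(K <- s) alpha K.
Proof.
elim: s J => [|K s IH] J JI; first by move=> ->; rewrite big_nil measure0.
move=> [iK [J' hs [KJ' JE]]]; rewrite big_cons.
have J'I : J' `<=` I by move=> x J'x; apply: JI; rewrite JE; right.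
have KI : K `<=` I by move=> x Kx; apply: JI; rewrite JE; left.
have mJ' : measurable J'.
  elim: s J' hs {IH KJ' JE J'I} => [|L s IHs] J' /=; first by move=> ->.
  by case=> iL [J'' /IHs m'' [_ ->]]; apply: measurableU => //; exact: interval_measurable.
rewrite JE measureU ?(IH J') //; first exact: interval_measurable.
by rewrite -subset0 => x [Kx J'x]; have := KJ' x x Kx J'x; rewrite ltxx.
Qed.

(** Continuity from above: the differences of consecutive sets are disjoint, and
    their measures telescope. *)
Lemma measure_nested (J : nat -> set R) : (forall n, measurable (J n)) ->
  (forall n, J n.+1 `<=` J n) -> J 0%N `<=` I ->
  forall e : R, 0 < e -> \forall N \near \oo,
    rnorm (alpha (J N) - alpha (\bigcap_n J n)) < e.
Proof.
move=> mJ Jdec J0I.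
have Jle m n : (m <= n)%N -> J n `<=` J m.
  by move=> /subnK <-; elim: (n - m)%N => [|d IH] // x /Jdec; apply: IH.
have JI n : J n `<=` I by apply: subset_trans J0I; apply: Jle.
set Z := \bigcap_n J n.
have mZ : measurable Z by apply: bigcap_measurable => // n _.
pose F n := J n `\` J n.+1.
have mF n : measurable (F n) by apply: measurableD.
have FI n : F n `<=` I by move=> x [/JI].
have tF : trivIset setT F.
  move=> i j _ _ [x [[Jix nJi] [Jjx nJj]]].
  by case: (ltngtP i j) => // ij; [case: nJi; apply: Jle Jjx | case: nJj; apply: Jle Jix].
have UF : \bigcup_n F n = J 0%N `\` Z.
  apply/seteqP; split=> [x [n _ [Jx nJx]]|x [J0x nZx]].
    by split; [apply: Jle Jx | move=> /(_ n.+1 Logic.I)].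
  apply: contrapT => nF; apply: nZx => n _; elim: n => // n Jnx.
  by apply: contrapT => nJ; apply: nF; exists n.
have sumF N : \sum_(0 <= i < N) alpha (F i) = alpha (J 0%N) - alpha (J N).
  elim: N => [|N IH]; first by rewrite big_geq // subrr.
  have JE : J N = F N `|` J N.+1 by rewrite /F setUC setDUK.
  have aJ : alpha (J N) = alpha (F N) + alpha (J N.+1).
    by rewrite {1}JE measureU // -subset0 => x [[_ nJ] Jx].
  by rewrite big_nat_recr //= IH aJ opprD addrA addrAC subrK.
have J0E : alpha (J 0%N) = alpha (J 0%N `\` Z) + alpha Z.
  rewrite -measureU //; last 4 first.
  - exact: measurableD.
  - by move=> x [/J0I].
  - by move=> x /(_ 0%N Logic.I) /J0I.
  - by rewrite -subset0 => x [[_ nZ] Zx].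
  by rewrite setUC setDUK // => x /(_ 0%N Logic.I).
move=> e e0; have := measure_limit mF FI tF e0; rewrite UF.
by apply: filterS => N; rewrite sumF J0E -addrA opprD addrA subrr add0r opprB.
Qed.

(** Otherwise, cutting at all rationals in turn and always keeping a half that
    cannot be so divided gives nested intervals of large measure that shrink to
    at most one point, which has measure zero. *)
Lemma small_measure_partition J (e : R) : is_interval J -> J `<=` I -> 0 < e ->
  exists2 s, ipartition J s & {in s, forall K, rnorm (alpha K) < e}.
Proof.
move=> iJ JI e0.
pose fine_part K := exists2 s, ipartition K s & {in s, forall K', rnorm (alpha K') < e}.
apply: contrapT => badJ.
(* An enumeration of the rationals. *)
pose q n : R := if @choice.unpickle rat n is Some c then ratr c else 0.
pose low_half K n := K `&` [set x | x < q n].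
pose high_half K n := K `&` [set x | q n <= x].
pose J_ := fix J_ n := if n is m.+1 then
  (if `[< fine_part (low_half (J_ m) m) >] then high_half (J_ m) m else low_half (J_ m) m)
  else J.
have J_bad n : is_interval (J_ n) /\ ~ fine_part (J_ n).
  elim: n => [|n [iJn bad]] //=.
  have iL : is_interval (low_half (J_ n) n).
    apply: is_intervalI => // x y /= xq yq z /andP[_ zy].
    exact: le_lt_trans yq.
  have iH : is_interval (high_half (J_ n) n).
    apply: is_intervalI => // x y /= xq yq z /andP[xz _].
    exact: le_trans xz.
  case: asboolP => [[s hs es]|] //; split=> // -[t ht et]; apply: bad.
  exists (s ++ t); last by move=> K; rewrite mem_cat => /orP[/es|/et].
  have -> : J_ n = low_half (J_ n) n `|` high_half (J_ n) n.
    apply/seteqP; split=> [x Jx|x [[]|[]] //].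
    by case: (ltP x (q n)) => h; [left | right].
  by apply: ipartition_cat => // x y [_ /= xq] [_ /= qy]; apply: lt_le_trans qy.
have Jdec n : J_ n.+1 `<=` J_ n by move=> x /=; case: ifP => _ [].
have mJ n : measurable (J_ n) by apply: interval_measurable; have [] := J_bad n.
set Z := \bigcap_n J_ n.
have Z1 x y : Z x -> Z y -> x <= y.
  move=> Zx Zy; rewrite leNgt; apply/negP => yx.
  have [c] := rat_in_itvoo yx; rewrite in_itv /= => /andP[yc cx].
  have qc : q (choice.pickle c) = ratr c by rewrite /q choice.pickleK.
  have := Zx (choice.pickle c).+1 Logic.I; have := Zy (choice.pickle c).+1 Logic.I => /=.
  rewrite /low_half /high_half qc; case: ifP => _ [_ /= h1] [_ /= h2].
    by have := le_lt_trans h1 yc; rewrite ltxx.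
  by have := lt_trans cx h2; rewrite ltxx.
have Z0 : alpha Z = 0.
  have [->|/set0P[x Zx]] := eqVneq Z set0; first exact: measure0.
  have -> : Z = [set x].
    apply/seteqP; split=> [y Zy|y ->] //=; apply/eqP.
    by rewrite eq_le !Z1.
  by have [_ h _] := alpha_measure; apply: h; apply: JI; apply: (Zx 0%N).
have [N _ hN] := measure_nested mJ Jdec JI e0.
have [iJN] := J_bad N; apply; exists [:: J_ N]; first exact: ipartition_interval1.
move=> K; rewrite inE => /eqP ->.
by have := hN N (leqnn N); rewrite -/Z Z0 subr0.
Qed.
End VectorMeasure.

(** * Fine partitions and the ordered integral *)

Section Variation.
Variables (R : realType) (k : scalar_kind) (V : completeNormedModType (scalars R k)).
Variables (I : set R) (alpha : set R -> V).
Implicit Types (J K : set R) (s t : seq (set R)).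
Hypothesis I_interval : is_interval I.
Hypothesis alpha_measure : is_continuous_measure_fv I alpha.

Definition mass s : R := \sum_(K <- s) rnorm (alpha K).
Definition total_variation : R := fine (measure_variation alpha I).

Lemma mass_ge0 s : 0 <= mass s.
Proof. by apply: sumr_ge0 => K _; exact: rnorm_ge0. Qed.

Lemma mass_variation J s : ipartition J s -> ((mass s)%:E <= measure_variation alpha J)%E.
Proof. by move=> hs; apply: ereal_sup_ubound; exists s => //; apply/ipartitionP. Qed.

Lemma total_variation_fin : measure_variation alpha I = total_variation%:E.
Proof.
rewrite /total_variation fineK // fin_numE; have [_ _ lty] := alpha_measure.
apply/andP; split; last by rewrite lt_eqF.
rewrite gt_eqF //; apply: (lt_le_trans (ltNyr 0)).
apply: le_trans (mass_variation (ipartition_interval1 I_interval)).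
by rewrite lee_fin mass_ge0.
Qed.

Lemma mass_total s : ipartition I s -> mass s <= total_variation.
Proof. by move=> /mass_variation; rewrite total_variation_fin lee_fin. Qed.

Lemma total_variation_ge0 : 0 <= total_variation.
Proof. exact: le_trans (mass_ge0 _) (mass_total (ipartition_interval1 I_interval)). Qed.

Lemma near_optimal (e : R) : 0 < e -> exists2 s, ipartition I s & total_variation - e < mass s.
Proof.
move=> e0; have fin : measure_variation alpha I \is a fin_num by rewrite total_variation_fin.
have [_ [s hs <-]] := ub_ereal_sup_adherent e0 fin.
rewrite -/(measure_variation alpha I) total_variation_fin -EFinB lte_fin => h.
by exists s => //; apply/ipartitionP.
Qed.

Lemma refine_small s J (e : R) : ipartition J s -> J `<=` I -> 0 < e ->
  exists t, [/\ ipartition J t, mass s <= mass t & {in t, forall K, rnorm (alpha K) < e}].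
Proof.
move=> + + e0; elim: s J => [|K s IH] J /=; first by move=> ->; exists [::].
case=> iK [J' hs [KJ' JE]] JI.
have KI : K `<=` I by move=> x Kx; apply: JI; rewrite JE; left.
have [|t [ht st et]] := IH J' hs; first by move=> x J'x; apply: JI; rewrite JE; right.
have [u hu eu] := small_measure_partition alpha_measure iK KI e0.
exists (u ++ t); split.
- by rewrite JE; apply: ipartition_cat.
- rewrite /mass big_cat big_cons; apply: lerD => //.
  by rewrite (measure_ipartition alpha_measure KI hu); apply: rnorm_sum.
- by move=> L; rewrite mem_cat => /orP[/eu|/et].
Qed.

Definition fine_partition (e : R) t := ipartition I t /\
  {in t, forall K, (measure_variation alpha K < e%:E)%E}.

(** Take a partition whose mass is within e / 4 of the total variation, and
    refine it to pieces of norm less than e / 4. No piece K has variation above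
    e / 2, as subdividing it gains at most e / 4 over its norm. *)
Lemma fine_partition_exists (e : R) : 0 < e -> exists t, fine_partition e t.
Proof.
move=> e0; have e40 : 0 < e / 4 by rewrite divr_gt0.
have [s hs es] := near_optimal e40.
have [t [ht st et]] := refine_small hs (@subset_refl _ I) e40.
exists t; split=> // K Kt.
apply: (@le_lt_trans _ _ (e / 2)%:E); last by rewrite lte_fin ltr_pdivrMr // ltr_pMr // ltr1n.
apply: ge_ereal_sup => _ [u /ipartitionP hu <-]; rewrite lee_fin.
have eK := et K Kt; case/splitPr: Kt ht {et} st es => t1 t2 ht st es.
have := mass_total (ipartition_subst ht hu).
move: st es eK; rewrite /mass !big_cat big_cons /= => st es eK h.
by rewrite -/(mass u) in h *; lra.
Qed.

Lemma mesh_filterE (P : set (seq (set R))) (e : R) : 0 < e ->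
  (forall t, fine_partition e t -> P t) -> mesh_filter I alpha P.
Proof.
move=> e0 h; exists e => // t [ht et]; apply: h; split; first exact/ipartitionP.
move=> K /(nthP set0)[i it <-]; exact: et.
Qed.

(** Properness is what gives limits along the filter a meaning; it holds because
    fine partitions exist. *)
Lemma mesh_filter_proper : ProperFilter (mesh_filter I alpha).
Proof.
apply: filter_from_proper => [|e e0]; last first.
  have [t [ht et]] := fine_partition_exists e0; exists t; split.
    exact/ipartitionP.
  by move=> i it; apply: et; apply: mem_nth.
apply: filter_from_filter; first by exists 1; exact: ltr01.
move=> e e' /= e0 e'0; exists (Num.min e e'); first by rewrite /= lt_min e0.
move=> s [hs es]; split; split=> // i it; apply: lt_le_trans (es i it) _;
  by rewrite lee_fin ge_min lexx ?orbT.
Qed.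
End Variation.

Section OrderedIntegral.
Variables (R : realType) (k : scalar_kind) (V : completeNormedModType (scalars R k)).
Variables (I : set R) (alpha : set R -> V).
Implicit Types (J K : set R) (s t : seq (set R)).
Hypothesis I_interval : is_interval I.
Hypothesis alpha_measure : is_continuous_measure_fv I alpha.
Variables (n : nat) (P : ('I_n -> V) -> V) (C : R).
Hypothesis n_gt0 : (0 < n)%N.
Hypothesis C_ge0 : 0 <= C.
Hypothesis P_add : forall (x y z : 'I_n -> V) i, z i = x i + y i ->
  (forall j, j != i -> z j = x j /\ z j = y j) -> P z = P x + P y.
Hypothesis P_bound : forall x, rnorm (P x) <= C * \prod_i rnorm (x i).

Let w := total_variation I alpha.

Definition overlap s t (i : 'I_(size s)) (j : 'I_(size t)) : V :=
  alpha (nth set0 s i `&` nth set0 t j).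

Lemma sum_nth (W : nmodType) s (F : set R -> W) :
  \sum_(K <- s) F K = \sum_(i < size s) F (nth set0 s i).
Proof. by rewrite (big_nth set0) big_mkord. Qed.

Lemma sum_overlap s t (i : 'I_(size s)) : ipartition I s -> ipartition I t ->
  alpha (nth set0 s i) = \sum_(j < size t) overlap i j.
Proof.
move=> hs ht; set K := nth set0 s i.
have [iK KI] : is_interval K /\ K `<=` I by apply: ipartition_mem hs _; apply: mem_nth.
have hK := ipartition_restr ht iK; rewrite (setIidr KI) in hK.
rewrite (measure_ipartition alpha_measure KI hK) big_map sum_nth.
by apply: eq_bigr => j _; rewrite setIC.
Qed.

(** Both [s] and [t] index the pieces of their common refinement: an ordered sum
    over [s] is a sum over pairs of index sequences of which only the first need
    be increasing. *)
Lemma ordered_sum_overlap s t : ipartition I s -> ipartition I t ->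
  ordered_sum P alpha s
  = \sum_(f : {ffun 'I_n -> 'I_(size s)} | increasing f)
     \sum_(g : {ffun 'I_n -> 'I_(size t)}) P (fun l => overlap (f l) (g l)).
Proof.
move=> hs ht; apply: eq_bigr => f _.
rewrite -(multiadditive_expand _ P_add (fun l j => overlap (f l) j) n_gt0).
  by congr P; apply/funext => l; apply: sum_overlap.
by move=> x y /funext ->.
Qed.

Lemma overlap_sym s t (i : 'I_(size s)) (j : 'I_(size t)) : overlap i j = overlap j i.
Proof. by rewrite /overlap setIC. Qed.

Lemma overlap_column s t (e : R) (j : 'I_(size t)) : ipartition I s -> fine_partition I alpha e t ->
  \sum_(i < size s) rnorm (overlap i j) <= e.
Proof.
move=> hs [ht et]; set K := nth set0 t j; have Kt : K \in t by apply: mem_nth.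
have [iK KI] := ipartition_mem ht Kt.
have hK := ipartition_restr hs iK; rewrite (setIidr KI) in hK.
have := le_lt_trans (mass_variation alpha hK) (et K Kt).
rewrite lte_fin => /ltW; apply: le_trans.
by rewrite /mass big_map sum_nth.
Qed.

Lemma overlap_total s t : ipartition I s -> ipartition I t ->
  \sum_(j < size t) \sum_(i < size s) rnorm (overlap i j) <= w.
Proof.
move=> hs ht; have := mass_total I_interval alpha_measure (ipartition_refine hs ht).
apply: le_trans; rewrite /mass big_allpairs_dep /= sum_nth; apply: ler_sum => j _.
by rewrite sum_nth.
Qed.

(** Otherwise a point of the first overlap and a point of the second would be
    ordered one way by [s] and the other way by [t]. *)
Lemma overlap_swap s t (i i' : 'I_(size s)) (j j' : 'I_(size t)) :
  interval_partition I s -> interval_partition I t -> (i < i')%N -> (j' < j)%N ->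
  overlap i j = 0 \/ overlap i' j' = 0.
Proof.
move=> [_ _ os] [_ _ ot] ii' j'j.
have a0 := measure0 alpha_measure.
have [E|/set0P[x [sx tx]]] := eqVneq (nth set0 s i `&` nth set0 t j) set0.
  by left; rewrite /overlap E.
have [E|/set0P[y [sy ty]]] := eqVneq (nth set0 s i' `&` nth set0 t j') set0.
  by right; rewrite /overlap E.
have xy : x < y by apply: os sx sy; rewrite ii' ltn_ord.
have yx : y < x by apply: ot ty tx; rewrite j'j ltn_ord.
by have := lt_trans xy yx; rewrite ltxx.
Qed.

(** Where [g] fails to increase it either repeats a piece, which is what the sum
    on the right records, or decreases; then one of the overlaps is empty by
    [overlap_swap]. *)
Lemma not_increasing_bound s t (f : {ffun 'I_n -> 'I_(size s)}) (g : {ffun 'I_n -> 'I_(size t)}) :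
  interval_partition I s -> interval_partition I t -> increasing f -> ~~ increasing g ->
  rnorm (P (fun l => overlap (f l) (g l)))
  <= \sum_(l : 'I_n * 'I_n | l.1 != l.2)
       (if g l.1 == g l.2 then C * \prod_l' rnorm (overlap (f l') (g l')) else 0).
Proof.
move=> hs ht /increasingP hf; rewrite negb_forall => /existsP[l1].
rewrite negb_forall => /existsP[l2]; rewrite negb_imply -leqNgt => /andP[l12 gl].
have X0 : 0 <= C * \prod_l' rnorm (overlap (f l') (g l')).
  by rewrite mulr_ge0 // prodr_ge0 // => l _; exact: rnorm_ge0.
have S0 : 0 <= \sum_(l : 'I_n * 'I_n | l.1 != l.2)
       (if g l.1 == g l.2 then C * \prod_l' rnorm (overlap (f l') (g l')) else 0).
  by apply: sumr_ge0 => l _; case: ifP.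
apply: le_trans (P_bound _) _.
move: gl; rewrite leq_eqVlt => /predU1P[e|gl].
  rewrite (bigD1 (l1, l2)) /=; last by rewrite neq_ltn l12.
  rewrite (val_inj e) eqxx lerDl; apply: sumr_ge0 => l _; by case: ifP.
apply: le_trans S0; rewrite le_eqVlt; apply/orP; left.
rewrite mulf_eq0; apply/orP; right.
have [e|e] := overlap_swap hs ht (hf _ _ l12) gl.
  by rewrite (bigD1 l1) //= e rnorm0 mul0r.
by rewrite (bigD1 l2) //= e rnorm0 mul0r.
Qed.

Definition mesh_constant : R := (n * n)%:R * (C * (1 + w) ^+ n) *+ 2.

Lemma repeated_bound s t (e : R) : 0 <= e -> ipartition I s -> fine_partition I alpha e t ->
  \sum_(f : {ffun 'I_n -> 'I_(size s)}) \sum_(g : {ffun 'I_n -> 'I_(size t)})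
   \sum_(l : 'I_n * 'I_n | l.1 != l.2)
       (if g l.1 == g l.2 then C * \prod_l' rnorm (overlap (f l') (g l')) else 0)
  <= (n * n)%:R * (C * (1 + w) ^+ n) * e.
Proof.
move=> e0 hs ft; have [ht _] := ft.
under eq_bigr => f _ do rewrite exchange_big /=.
rewrite exchange_big /=.
apply: (@le_trans _ _ (\sum_(l : 'I_n * 'I_n | l.1 != l.2) (C * (1 + w) ^+ n) * e)).
  apply: ler_sum => l l12.
  apply: (@le_trans _ _ (C * \sum_(f : {ffun 'I_n -> 'I_(size s)})
    \sum_(g : {ffun 'I_n -> 'I_(size t)} | g l.1 == g l.2) \prod_l' rnorm (overlap (f l') (g l')))).
    rewrite mulr_sumr; apply: ler_sum => f _; rewrite mulr_sumr [leRHS]big_mkcond /=.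
    by apply: ler_sum => g _; case: ifP.
  rewrite -mulrA ler_wpM2l // mulrC.
  apply: (repeated_column_sum_le (a := fun i j => rnorm (overlap i j))) => //.
  - by move=> i j; exact: rnorm_ge0.
  - by move=> j; apply: overlap_column.
  - exact: total_variation_ge0.
  - exact: overlap_total.
rewrite sumr_const -[leLHS]mulr_natl -[leRHS]mulrA; apply: ler_wpM2r.
  by rewrite mulr_ge0 // mulr_ge0 // exprn_ge0 // addr_ge0 // total_variation_ge0.
rewrite ler_nat -[X in (_ <= X * X)%N]card_ord -card_prod; exact: max_card.
Qed.

(** After both sums are expanded over the common refinement, the pairs of index
    sequences that increase both cancel. In the others one sequence repeats a
    piece, and [repeated_column_sum_le] makes their contribution small with the
    mesh. *)
Lemma ordered_sum_close s t (e : R) : 0 <= e ->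
  fine_partition I alpha e s -> fine_partition I alpha e t ->
  rnorm (ordered_sum P alpha s - ordered_sum P alpha t) <= mesh_constant * e.
Proof.
move=> e0 fs ft; have [hs _] := fs; have [ht _] := ft.
have ps : interval_partition I s by apply/ipartitionP.
have pt : interval_partition I t by apply/ipartitionP.
rewrite (ordered_sum_overlap hs ht) (ordered_sum_overlap ht hs).
under [X in _ - X]eq_bigr => g _.
  under eq_bigr => f _.
    rewrite (_ : (fun l => overlap (g l) (f l)) = (fun l => overlap (f l) (g l))); last first.
      by apply/funext => l; rewrite overlap_sym.
    over.
  over.
pose T (f : {ffun 'I_n -> 'I_(size s)}) (g : {ffun 'I_n -> 'I_(size t)}) :=
  P (fun l => overlap (f l) (g l)).
pose X (f : {ffun 'I_n -> 'I_(size s)}) (g : {ffun 'I_n -> 'I_(size t)}) :=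
  \sum_(l : 'I_n * 'I_n | l.1 != l.2)
       (if g l.1 == g l.2 then C * \prod_l' rnorm (overlap (f l') (g l')) else 0).
pose Y (f : {ffun 'I_n -> 'I_(size s)}) (g : {ffun 'I_n -> 'I_(size t)}) :=
  \sum_(l : 'I_n * 'I_n | l.1 != l.2)
       (if f l.1 == f l.2 then C * \prod_l' rnorm (overlap (g l') (f l')) else 0).
have C0 (u : R) : 0 <= u -> 0 <= C * u by move=> u0; rewrite mulr_ge0.
have X0 f g : 0 <= X f g.
  by apply: sumr_ge0 => l _; case: ifP => // _; apply/C0/prodr_ge0 => *; exact: rnorm_ge0.
have Y0 f g : 0 <= Y f g.
  by apply: sumr_ge0 => l _; case: ifP => // _; apply/C0/prodr_ge0 => *; exact: rnorm_ge0.
have -> : \sum_(f : {ffun 'I_n -> 'I_(size s)} | increasing f) \sum_g T f g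
        - \sum_(g : {ffun 'I_n -> 'I_(size t)} | increasing g) \sum_f T f g
        = \sum_f \sum_g ((if increasing f then T f g else 0) - (if increasing g then T f g else 0)).
  under [RHS]eq_bigr => f _ do rewrite sumrB.
  rewrite sumrB big_mkcond /=; congr (_ - _).
    by apply: eq_bigr => f _; case: ifP => // _; rewrite big1.
  rewrite [RHS]exchange_big /= big_mkcond /=; apply: eq_bigr => g _.
  by case: ifP => // _; rewrite big1.
have bound f g : rnorm ((if increasing f then T f g else 0) - (if increasing g then T f g else 0))
    <= X f g + Y f g.
  have [hf|hf] := boolP (increasing f); have [hg|hg] := boolP (increasing g).
  - by rewrite subrr rnorm0 addr_ge0.
  - rewrite subr0; apply: le_trans (not_increasing_bound ps pt hf hg) _.
    by rewrite lerDl.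
  - rewrite sub0r rnormN /T.
    rewrite (_ : (fun l => overlap (f l) (g l)) = (fun l => overlap (g l) (f l))); last first.
      by apply/funext => l; rewrite overlap_sym.
    apply: le_trans (not_increasing_bound pt ps hg hf) _.
    by rewrite lerDr.
  - by rewrite subrr rnorm0 addr_ge0.
apply: le_trans (rnorm_sum _ _ _) _.
apply: (@le_trans _ _ (\sum_f \sum_g (X f g + Y f g))).
  apply: ler_sum => f _; apply: le_trans (rnorm_sum _ _ _) _.
  by apply: ler_sum => g _; apply: bound.
under eq_bigr => f _ do rewrite big_split.
rewrite big_split /= /mesh_constant mulr2n mulrDl; apply: lerD.
  exact: repeated_bound.
rewrite exchange_big /=; exact: repeated_bound.
Qed.

Lemma ordered_sum_bound s : ipartition I s ->
  rnorm (ordered_sum P alpha s) <= C * (n`!%:R)^-1 * w ^+ n.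
Proof.
move=> hs; apply: le_trans (rnorm_sum _ _ _) _.
apply: (@le_trans _ _ (C * \sum_(f : {ffun 'I_n -> 'I_(size s)} | increasing f)
   \prod_i rnorm (alpha (nth set0 s (f i))))).
  by rewrite mulr_sumr; apply: ler_sum => f _; apply: P_bound.
rewrite -mulrA ler_wpM2l // -ler_pdivrMl ?invr_gt0 ?ltr0n ?fact_gt0 // invrK.
have := @increasing_sum_le R n (size s) (fun i => rnorm (alpha (nth set0 s i))).
move/(_ (fun i => rnorm_ge0 _))/le_trans; apply.
have m : \sum_(i < size s) rnorm (alpha (nth set0 s i)) <= w.
  by rewrite -(sum_nth s (fun K => rnorm (alpha K))); apply: mass_total.
by rewrite lerXn2r ?nnegrE ?sumr_ge0 ?total_variation_ge0 // => i _; exact: rnorm_ge0.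
Qed.

(** The ordered sums form a Cauchy filter by [ordered_sum_close]. Only because
    they converge is the integral a limit of ordered sums, all of which obey the
    bound. *)
Lemma ordered_integral_bound :
  rnorm (ordered_integral P I alpha) <= C * (n`!%:R)^-1 * w ^+ n.
Proof.
have FP := mesh_filter_proper I_interval alpha_measure.
set F := ordered_sum P alpha s @[s --> mesh_filter I alpha].
have cv : cvg F.
  apply/cauchy_cvgP/cauchy_exP => eps eps0.
  have [e e0 ->] : exists2 e : R, 0 < e & eps = scalar_emb k e.
    move: eps eps0; rewrite /scalar_emb; case: (k) => [eps eps0|[a b]]; first by exists eps.
    by rewrite ltcE /= => /andP[/eqP -> a0]; exists a.
  (* Adding 1 avoids division by zero. *)
  pose e' := e / (mesh_constant + 1).
  have M0 : 0 <= mesh_constant.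
    rewrite /mesh_constant mulrn_wge0 // mulr_ge0 // mulr_ge0 // exprn_ge0 //.
    by rewrite addr_ge0 // total_variation_ge0.
  have M1 : 0 < mesh_constant + 1 by rewrite ltr_wpDl.
  have e'0 : 0 < e' by rewrite divr_gt0.
  have [s0 fs0] := fine_partition_exists I_interval alpha_measure e'0.
  exists (ordered_sum P alpha s0).
  apply: (mesh_filterE e'0) => t ft; rewrite -ball_normE /= normE scalar_emb_lt.
  apply: le_lt_trans (ordered_sum_close (ltW e'0) fs0 ft) _.
  by rewrite /e' mulrCA gtr_pMr // ltr_pdivrMr // mul1r ltrDl.
have /rnorm_cvg lF := cv.
rewrite -/F in lF; apply/ler_addgt0Pr => e e0.
have hb : mesh_filter I alpha [set s | rnorm (ordered_sum P alpha s) <= C * (n`!%:R)^-1 * w ^+ n].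
  by apply: (mesh_filterE ltr01) => t [ht _]; apply: ordered_sum_bound.
have [s [/= h1 h2]] := filter_ex (filterI hb (lF e e0)).
rewrite -[ordered_integral _ _ _](subrK (ordered_sum P alpha s)).
by apply: le_trans (rnormD _ _) _; rewrite addrC lerD // ltW.
Qed.
End OrderedIntegral.

(** * The Taylor coefficients of the bound *)

Section Taylor.
Variables (R : realType) (w : R).

Let bound (T : R) : R := 2 - 2 * Num.sqrt (1 - T * w).

Lemma is_derive_pow_affine (a b c T : R) : 0 < 1 - T * w ->
  is_derive T 1 (fun T => b + c * (1 - T * w) `^ a) (c * (- w * a * (1 - T * w) `^ (a - 1))).
Proof.
move=> T0.
have dlin : is_derive T 1 (fun T : R => 1 - T * w) (- w).
  have -> : (fun T : R => 1 - T * w) = cst 1 - (w *: (id : R -> R)).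
    by apply/funext => u /=; rewrite mulrC.
  apply: is_derive_eq; rewrite sub0r /GRing.scale /= mulr1; reflexivity.
have dpow := @is_derive1_comp R (fun u : R => u `^ a) (fun T => 1 - T * w) T _ _
  (is_derive1_powR a T0) dlin.
have -> : (fun T => b + c * (1 - T * w) `^ a)
    = cst b + (c *: ((fun u : R => u `^ a) \o (fun T => 1 - T * w)) : R -> R).
  by apply/funext => u.
apply: is_derive_eq; rewrite add0r /GRing.scale /=; ring.
Qed.

Lemma near_domain (T : R) : 0 < 1 - T * w -> \forall u \near T, 0 < 1 - u * w.
Proof.
move=> T0; have : (fun u : R => 1 - u * w) u @[u --> T] --> 1 - T * w.
  by apply: cvgB; [exact: cvg_cst | apply: cvgM; [exact: cvg_id | exact: cvg_cst]].
by move/(cvgr_gt (1 - T * w)); apply.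
Qed.

Lemma derive1_pow_affine (f : R -> R) (a b c T : R) : 0 < 1 - T * w ->
  (forall u, 0 < 1 - u * w -> f u = b + c * (1 - u * w) `^ a) ->
  derive1 f T = c * (- w * a * (1 - T * w) `^ (a - 1)).
Proof.
move=> T0 fE; rewrite derive1E.
rewrite (near_eq_derive (g := fun u : R => b + c * (1 - u * w) `^ a)) ?oner_neq0 //.
  exact: (@derive_val _ _ _ _ _ _ _ (is_derive_pow_affine a b c T0)).
by apply: filterS (near_domain T0) => u; exact: fE.
Qed.

(** All derivatives are needed on a neighbourhood of 0; the square root is smooth
    where 1 - T w > 0. *)
Lemma bound_derive m (T : R) : 0 < 1 - T * w ->
  derive1n m.+1 bound T
  = ratr (m`!%:R * invsqrt_coef m) * w ^+ m.+1 * (1 - T * w) `^ (2^-1 - m.+1%:R).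
Proof.
elim: m T => [|m IH] T T0.
  rewrite derive1n1 (derive1_pow_affine (a := 2^-1) (b := 2) (c := -2)) //.
    rewrite fact0 /invsqrt_coef big_ord0 mulr1 rmorph1 expr1 mul1r; by field.
  by move=> u /ltW u0; rewrite /bound powR12_sqrt // mulNr.
rewrite derive1nS (derive1_pow_affine (a := 2^-1 - m.+1%:R) (b := 0)
  (c := ratr (m`!%:R * invsqrt_coef m) * w ^+ m.+1)) //; last first.
  by move=> u u0; rewrite add0r IH.
have -> : 2^-1 - m.+1%:R - 1 = 2^-1 - m.+2%:R :> R.
  by rewrite -addrA -opprD (natr1 m.+1).
rewrite invsqrt_coefS factS natrM !rmorphM /= !ratr_nat (exprS _ m.+1).
have -> : ratr (m.*2.+2%:R)^-1 = (m.*2.+2%:R)^-1 :> R by rewrite fmorphV /= ratr_nat.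
have -> : (m.*2.+2)%:R = 2 * m.+1%:R :> R by rewrite -natrM mul2n.
have -> : (m.*2.+1)%:R = 2 * m.+1%:R - 1 :> R.
  by rewrite -natrM mul2n doubleS -[m.*2.+2 in RHS]addn1 natrD addrK.
have m1 : m.+1%:R != 0 :> R by rewrite pnatr_eq0.
move: (_ `^ _) (m.+1%:R) m1 (w ^+ m.+1) (ratr _) (m`!%:R) => P M m1 W c F.
by field.
Qed.

Lemma taylor_coef_bound n : (0 < n)%N ->
  taylor_coef bound n = ratr (bound_coef n) * w ^+ n.
Proof.
case: n => // m _; have T0 : 0 < 1 - 0 * w :> R by rewrite mul0r subr0 ltr01.
rewrite /taylor_coef bound_derive // mul0r subr0 powR1 mulr1.
have F0 : m.+1`!%:R != 0 :> R by rewrite pnatr_eq0 -lt0n fact_gt0.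
by rewrite -fact_bound_coef rmorphM /= ratr_nat [_ * ratr _]mulrC mulrAC mulfK.
Qed.
End Taylor.

(** * The terms of the symmetric Wilcox expansions *)

Section WilcoxTerm.
Variables (R : realType) (k : scalar_kind).
Variables (g : completeNormedModType (scalars R k)) (br : {bilinear g -> g -> g}).
Variables (I : set R) (alpha : set R -> g).
Hypothesis br_lie : is_lie_bracket br.
Hypothesis br_norm : forall x y : g, `|br x y| <= `|x| * `|y|.
Hypothesis I_interval : is_interval I.
Hypothesis alpha_measure : is_continuous_measure_fv I alpha.

Lemma wilcox_term_bound kd n : (0 < n)%N ->
  rnorm (wilcox_term kd br I alpha n) <= ratr (bound_coef n) * total_variation I alpha ^+ n.
Proof.
move=> n0; pose C : R := ratr (n`!%:R * bound_coef n).
have C0 : 0 <= C by rewrite ler0q mulr_ge0 ?ler0n ?bound_coef_ge0.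
have -> : ratr (bound_coef n) = C * (n`!%:R)^-1.
  by rewrite /C rmorphM /= ratr_nat mulrAC mulfV ?mul1r // pnatr_eq0 -lt0n fact_gt0.
(* Without a Wilcox polynomial the choice operator returns the zero expression. *)
rewrite /wilcox_term /wilcox_poly; case: xgetP => [p -> p_wilcox|_];
  apply: ordered_integral_bound => //.
- by move=> x y z i zi zj; exact: (wilcox_poly_additive br_lie p_wilcox zi zj).
- move=> x; rewrite -(scalar_emb_le k) scalar_embM scalar_emb_ratr scalar_emb_prod -normE.
  under eq_bigr do rewrite -normE.
  apply: (wilcox_poly_bound br_lie p_wilcox (nrm := fun v => `|v|)) => //.
  + exact: normr0.
  + exact: ler_normD.
  + exact: normrZ.
- by move=> x y z i _ _ /=; rewrite addr0.
- by move=> x /=; rewrite rnorm0 mulr_ge0 // prodr_ge0 // => i _; apply: rnorm_ge0.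
Qed.

(** Comparison with the geometric series, as [bound_coef] is at most 1. *)
Lemma wilcox_series_finite kd : total_variation I alpha < 1 ->
  (\sum_(1 <= n <oo) (rnorm (wilcox_term kd br I alpha n))%:E < +oo)%E.
Proof.
set w := total_variation I alpha => w1; have w0 : 0 <= w := total_variation_ge0 I_interval alpha_measure.
have tb n := wilcox_term_bound kd (n := n).
apply: (@le_lt_trans _ _ ((1 - w)^-1)%:E); last exact: ltry.
apply: lime_le.
  by apply: is_cvg_nneseries => n _ _; rewrite lee_fin rnorm_ge0.
apply: nearW => N; rewrite sumEFin lee_fin.
have d0 : 0 < 1 - w by rewrite subr_gt0.
rewrite -[leRHS]mul1r ler_pdivlMr //.
have wN : (\sum_(0 <= n < N) w ^+ n) * (1 - w) <= 1.
  rewrite big_mkord mulrC -[1 - w]opprB mulNr -subrX1 opprB.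
  by rewrite lerBlDr lerDl exprn_ge0.
apply: le_trans wN; rewrite ler_pM2r //.
case: N => [|N]; first by rewrite !big_nil.
rewrite [leRHS]big_ltn //; apply: ler_wpDl; first by rewrite exprn_ge0.
rewrite !big_nat; apply: ler_sum => n /andP[n0 _]; apply: le_trans (tb n n0) _.
by rewrite ler_piMl ?exprn_ge0 // -[1](ratr_nat R 1) ler_rat bound_coef_le1.
Qed.
End WilcoxTerm.

Theorem theorem3p5 (R : realType) (k : scalar_kind)
    (g : completeNormedModType (scalars R k)) (br : {bilinear g -> g -> g})
    (I : set R) (alpha : set R -> g)
    (br_lie : is_lie_bracket br)
    (br_norm : forall x y : g, `|br x y| <= `|x| * `|y|)
    (I_interval : is_interval I)
    (alpha_measure : is_continuous_measure_fv I alpha) :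
  let w : R := fine (measure_variation alpha I) in
  let bound (T : R) : R := 2 - 2 * Num.sqrt (1 - T * w) in
  [/\ forall n : nat, (1 <= n)%N ->
        rnorm (wilcox_term Inward br I alpha n) <= taylor_coef bound n,
      w < 1 ->
        (\sum_(1 <= n <oo) (rnorm (wilcox_term Inward br I alpha n))%:E
           < +oo)%E,
      forall n : nat, (1 <= n)%N ->
        rnorm (wilcox_term Outward br I alpha n) <= taylor_coef bound n &
      w < 1 ->
        (\sum_(1 <= n <oo) (rnorm (wilcox_term Outward br I alpha n))%:E
           < +oo)%E].
Proof.
move=> w bound.
have coefs kd n : (1 <= n)%N ->
    rnorm (wilcox_term kd br I alpha n) <= taylor_coef bound n.
  by move=> n0; rewrite taylor_coef_bound //; exact: wilcox_term_bound.
by split; [exact: coefs | exact: wilcox_series_finite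
          | exact: coefs | exact: wilcox_series_finite].
Qed.
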